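(* Let $\ell\ge 1$, let $(\xi_t)_{t\in\mathbb Z}$ be i.i.d. symmetric centered real random variables with continuous distribution such that $\mathbb E|\xi_0|=1$ and $\mathbb E[\xi_0^2]<\infty$, and let $a_j:\mathbb R^\ell\to\mathbb R$ ($j\in\mathbb N=\{0,1,2,\dots\}$) be known continuous functions with $a_0(\theta)>0$ for all $\theta$. Let $\Theta$ be a compact subset of $$\Theta(2)=\Big\{\theta\in\mathbb R^\ell:\ \mathbb E[\xi_0^2]\sum_{j=1}^\infty a_j^2(\theta)<1\Big\}.$$ Assume that for every $\theta\in\Theta$ there are $d(\theta)\in(0,1/2)$ and a slowly varying function $L_\theta(\cdot)$ such that $$a_j(\theta)=L_\theta(j)\,j^{d(\theta)-1}\qquad\text{for all } j\ge1 .$$ Let $\theta^*\in\Theta$ and let $(X_t)_{t\in\mathbb Z}$ be the stationary (long memory) LARCH$(\infty)$ process with parameter $\theta^*$, i.e. the stationary solution of $$X_t=\xi_t\Big(a_0(\theta^* )+\sum_{j=1}^\infty a_j(\theta^* )X_{t-j}\Big),\qquad t\in\mathbb Z.$$ Assume moreover: (i) (Assumption $C_\ell(\Theta)$) $a_k\in\mathcal C^\ell(\Theta)$ for every $k\in\mathbb N$, and there exist $C_a>0$ and $\overline d<1/2$ such that $\sup_{\theta\in\Theta}\sum_{j=0}^{\ell}\|\partial^j_{\theta^j}a_k(\theta)\|\le C_a\,k^{\overline d-1}$ for every $k\ge 1$; (ii) (Assumption (S)) for every $t\in\mathbb Z$, $(M_\theta(t))_{\theta\in\Theta}$ is a separable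 stochastic process on $\Theta$, where $M_\theta(t)=a_0(\theta)+\sum_{k=1}^\infty a_k(\theta)X_{t-k}$; (iii) (Assumption Id$(\Theta)$) if $\theta,\widetilde\theta\in\Theta$ satisfy $a_i(\theta)=a_i(\widetilde\theta)$ for all $i\in\mathbb N$, then $\theta=\widetilde\theta$. Let $$\widehat\theta_n=\operatorname*{Arg\,min}_{\theta\in\Theta}\ \frac1n\sum_{t=1}^n\Big(|X_t|-\Big|a_0(\theta)+\sum_{j=1}^{t-1}a_j(\theta)X_{t-j}\Big|\Big)^2 .$$ Then $\widehat\theta_n\to\theta^*$ almost surely as $n\to\infty$.
   Context: The process $(X_t)$ is observed at times $1,\dots,n$. Under $\theta^*\in\Theta(2)$ the LARCH$(\infty)$ equation has a strictly stationary ergodic causal solution ($X_t$ is a measurable function of $(\xi_{t-j})_{j\ge0}$) with $\mathbb E[X_0^2]<\infty$; this is the solution considered. The infinite sums $\sum_k a_k(\theta)X_{t-k}$ converge in $\mathbb L^2(\Omega)$. $\mathcal C^i(\Theta)$ is the space of $i$-times continuously differentiable functions on $\Theta$; $\partial^k_{\theta^k}\psi(\theta)$ is the array of all partial derivatives of order $k$ of $\psi$, with $\partial^0_{\theta^0}\psi=\psi$; $\|\cdot\|$ is the Euclidean norm (square root of the sum of the squared entries of the array). Empty sums are $0$. $\widehat\theta_n$ denotes a minimizer. *)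

(* Defs.v *)
From HB Require Import structures.
From mathcomp Require Import all_boot all_order all_algebra.
From mathcomp Require Import all_classical all_reals all_analysis.

Set Implicit Arguments.
Unset Strict Implicit.
Unset Printing Implicit Defensive.

Import Order.TTheory GRing.Theory Num.Theory.
Import numFieldNormedType.Exports.

Local Open Scope classical_set_scope.
Local Open Scope ring_scope.

(* Karamata slow variation, in the usual sense where only the behaviour on a
   neighbourhood of +oo matters. *)
Definition slowly_varying (R : realType) (L : R -> R) : Prop :=
  exists x0 : R,
    [/\ measurable_fun `[x0, +oo[ L,
        (forall x, x0 <= x -> 0 < L x) &
        (forall c, 0 < c -> L (c * x) / L x @[x --> +oo] --> (1 : R))].

Section smoothness.
Context {R : realType} {l : nat}.
Implicit Types (f : 'rV[R]_l -> R) (U K : set 'rV[R]_l).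

(* partials [:: i1; ..; ik] f is d^k f / (d theta_i1 .. d theta_ik). *)
Definition partials (s : seq 'I_l) f : 'rV[R]_l -> R :=
  foldr (fun i g x => 'D_(delta_mx 0 i) g x) f s.

Definition derivative_norm (k : nat) f (x : 'rV[R]_l) : R :=
  Num.sqrt (\sum_(s : k.-tuple 'I_l) partials s f x ^+ 2).

Definition Ck_open (k : nat) U f : Prop :=
  forall (s : seq 'I_l) (x : 'rV[R]_l), U x ->
    ((size s < k)%N ->
       forall i : 'I_l, derivable (partials s f) x (delta_mx 0 i)) /\
    ((size s <= k)%N -> {for x, continuous (partials s f)}).

(* C^k on a set that need not be open: C^k on some open neighbourhood of it. *)
Definition Ck_on (k : nat) K f : Prop :=
  exists U, [/\ open U, K `<=` U & Ck_open k U f].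

End smoothness.

(* Cylinder (product) sigma-algebra of R^I. *)
Definition path_measurable (R : realType) (I : Type) : set (set (I -> R)) :=
  <<s [set C | exists (i : I) (B : set R),
         measurable B /\ C = [set x | B (x i)]] >>.

Section processes.
Context d (T : measurableType d) (R : realType) (P : probability T R).
Implicit Types X xi : int -> {RV P >-> R}.

Definition mutually_independent xi : Prop :=
  forall (s : seq int) (B : int -> set R), uniq s ->
    (forall t, measurable (B t)) ->
    P (\bigcap_(t in [set` s]) (xi t @^-1` B t)) =
    (\prod_(t <- s) P (xi t @^-1` B t))%E.

Definition identically_distributed xi : Prop :=
  forall (t : int) (B : set R), measurable B ->
    distribution P (xi t) B = distribution P (xi 0) B.

Definition iid xi : Prop :=
  mutually_independent xi /\ identically_distributed xi.

Definition symmetric_rv (Y : {RV P >-> R}) : Prop :=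
  forall B : set R, measurable B ->
    P [set w | B (- Y w)] = P [set w | B (Y w)].

Definition strictly_stationary X : Prop :=
  forall (h : int) (A : set (int -> R)), path_measurable A ->
    P [set w | A (fun t => X (t + h) w)] = P [set w | A (fun t => X t w)].

Definition ergodic X : Prop :=
  forall A : set (int -> R), path_measurable A ->
    [set x | A (fun t => x (t + 1))] = A ->
    P [set w | A (fun t => X t w)] = 0%E \/ P [set w | A (fun t => X t w)] = 1%E.

Definition causal xi X : Prop :=
  exists f : (nat -> R) -> R,
    (forall B : set R, measurable B -> path_measurable (f @^-1` B)) /\
    forall t, {ae P, forall w, X t w = f (fun j => xi (t - j%:Z) w)}.

Definition L2_cvg (u : nat -> T -> R) (v : T -> R) : Prop :=
  'E_P[(fun w => (u n w - v w) ^+ 2)%R]%E @[n --> \oo] --> 0%E.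

(* Doob separability; the exceptional set N is independent of G and F. *)
Definition separable_process (I : topologicalType) (K : set I)
    (Z : I -> T -> R) : Prop :=
  exists (S : set I) (N : set T),
    [/\ S `<=` K, countable S, K `<=` closure S, P.-negligible N &
        forall (G : set I) (F : set R), open G -> closed F ->
          forall w, ~ N w ->
            (forall th, (S `&` G) th -> F (Z th w)) ->
            forall th, (K `&` G) th -> F (Z th w)].

Section larch.
Context {l : nat}.
Implicit Types (a : nat -> 'rV[R]_l -> R) (th : 'rV[R]_l).

Definition Theta2 xi a : set 'rV[R]_l :=
  [set th | ('E_P[(fun w => xi 0 w ^+ 2)%R] *
             \sum_(1 <= j <oo) (a j th ^+ 2)%:E < 1)%E].

(* Mt is (a version of) a_0(th) + \sum_(k >= 1) a_k(th) X_(t-k), the series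
   being understood in L^2. *)
Definition is_M a X th (t : int) (Mt : {RV P >-> R}) : Prop :=
  L2_cvg (fun N w => a 0%N th + \sum_(1 <= k < N.+1) a k th * X (t - k%:Z) w)
         Mt.

Definition larch_equation xi a th X : Prop :=
  forall t, exists2 Mt : {RV P >-> R},
    is_M a X th t Mt & {ae P, forall w, X t w = xi t w * Mt w}.

Definition larch_process xi a th X : Prop :=
  [/\ larch_equation xi a th X, strictly_stationary X, ergodic X,
      causal xi X & ('E_P[(fun w => X 0 w ^+ 2)%R] < +oo)%E].

Definition contrast a X (n : nat) th (w : T) : R :=
  n%:R^-1 * \sum_(1 <= t < n.+1)
    (`|X t%:Z w| -
     `|a 0%N th + \sum_(1 <= j < t) a j th * X (t%:Z - j%:Z) w|) ^+ 2.

End larch.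
End processes.

(* Main.v *)
(* The contrast at a parameter converges to E(|X_1| - |M_th(1)|)^2, which,
   because |X_1| = |xi_1| |M(1)| with E|xi_1| = 1 and xi_1 independent of the
   past, exceeds its value at thstar by E(|M(1)| - |M_th(1)|)^2. It remains to
   compare contrasts uniformly over Theta, and to identify th.

   Uniformity. Only |a_k| <= C k^(dbar-1) is used, so the coefficients range in
   a fixed box, and finitely many lags are handled by Birkhoff's theorem for
   predictors with rational coefficients. What has to be shown is that almost
   surely the lags j >= 2^K contribute to the averaged squares an amount that
   is small for large K uniformly over the box and over n. Split the lags into
   dyadic blocks [m, 2m), m = 2^k, and the sample into segments of length m. By
   Parseval the contribution of a block is at most the sum of the squares
   of its coefficients, of order m^(2 dbar - 1), times the sum over the segments of
   the maximal periodogram; that maximum is replaced by an l_(2q) norm, off by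
   m^(1/q). This norm is 2-smooth and X_u is conditionally symmetric given the
   past, so the expected energy of a segment is O(m^(1+1/q)). The maximal
   ergodic inequality and Borel-Cantelli then bound the energies of all
   segments at the price of another m^(1/q), and dbar < 1/2 makes the
   contributions of the blocks summable.

   Identification. If |M_th(1)| = |M(1)|, the product of the linear functionals
   M_th(1) - M(1) and M_th(1) + M(1) vanishes. Since xi has no atoms, an affine
   function of xi_u with coefficients in the past of u vanishes only where both
   coefficients do, and this peels off the lags one after the other. A nonzero
   coefficient of the first factor, at lag k, would make M(1 - k) times the
   remote part of the second factor vanish; but a product of two functionals
   with nonzero constant terms, here a_0(thstar) and a_0(th) + a_0(thstar), does
   not vanish, since after peeling off many lags it is close to the product of
   these constants. *)
Require Import Defs.
From HB Require Import structures.
From mathcomp Require Import all_boot all_order all_algebra.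
From mathcomp Require Import all_classical all_reals all_analysis.
From mathcomp Require Import measurable_realfun.
From mathcomp Require Import ring lra zify.

Set Implicit Arguments.
Unset Strict Implicit.
Unset Printing Implicit Defensive.

Import Order.TTheory GRing.Theory Num.Theory.
Import numFieldNormedType.Exports.

Local Open Scope classical_set_scope.
Local Open Scope ring_scope.

(** * Birkhoff's ergodic theorem *)

Section level_sets.
Context d (S : measurableType d) (R : realType).
Implicit Types f g : S -> R.

Lemma measurable_gt_set f r : measurable_fun setT f ->
  measurable [set x | r < f x].
Proof.
move=> mf; rewrite (_ : [set x | _] = setT `&` f @^-1` `]r, +oo[).
  exact: mf.
by rewrite setTI; apply/seteqP; split => x /=; rewrite in_itv/= andbT.
Qed.

Lemma measurable_eq_set f g : measurable_fun setT f -> measurable_fun setT g ->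
  measurable [set x | f x = g x].
Proof.
move=> mf mg; rewrite (_ : [set x | _] = setT `&` (f \- g) @^-1` [set 0]).
  exact: measurable_funB.
by rewrite setTI; apply/seteqP; split => x /=;
  [move->; rewrite subrr|move=> /eqP; rewrite subr_eq0 => /eqP].
Qed.

End level_sets.

Section ergodic_theorem.
Context d (S : measurableType d) (R : realType) (mu : probability S R).
Variable T : S -> S.
Hypothesis measurable_T : measurable_fun setT T.
Hypothesis mu_T : forall A, measurable A -> mu (T @^-1` A) = mu A.
Implicit Types f g : S -> R.

Lemma integrable_mul_indic f (A : set S) : measurable A ->
  mu.-integrable setT (EFin \o f) ->
  mu.-integrable setT (EFin \o (fun x => f x * \1_A x)).
Proof.
move=> mA fi; apply: (le_integrable _ _ _ fi) => //.
  apply/measurable_EFinP; apply: measurable_funM.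
    by apply/measurable_EFinP; exact: measurable_int fi.
  exact: measurable_indic.
move=> x _ /=; rewrite lee_fin normrM indicE.
by case: (x \in A); rewrite ?normr1 ?mulr1// normr0 mulr0.
Qed.

Definition birkhoff f n x := \sum_(0 <= i < n) f (iter i T x).

Lemma birkhoffS f n x : birkhoff f n.+1 x = f x + birkhoff f n (T x).
Proof.
rewrite /birkhoff big_nat_recl//=; congr +%R.
by apply: eq_bigr => i _; rewrite -iterSr.
Qed.

Lemma integrable_comp_preserving f : mu.-integrable setT (EFin \o f) ->
  mu.-integrable setT (EFin \o (f \o T)).
Proof.
move=> /integrableP[mf foo]; apply/integrableP; split.
  by apply/measurable_EFinP; apply: measurableT_comp => //; exact/measurable_EFinP.
rewrite (_ : (fun x => _) = (fun y => `|(f y)%:E|%E) \o T)//.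
have mabs : measurable_fun setT (fun y => `|(f y)%:E|%E : \bar R).
  exact: (measurableT_comp (@abse_measurable _ setT) mf).
have := @ge0_integral_pushforward _ _ _ _ _ _ measurable_T mu setT _
  measurableT mabs (fun y _ => abse_ge0 _).
rewrite preimage_setT => <-.
by rewrite (eq_measure_integral mu)// => A mA _; exact: mu_T.
Qed.

Lemma Rintegral_comp_preserving f : mu.-integrable setT (EFin \o f) ->
  \int[mu]_x f (T x) = \int[mu]_x f x.
Proof.
move=> fi; rewrite /Rintegral; congr fine.
have Ti := integrable_comp_preserving fi.
transitivity (\int[pushforward mu T]_y (EFin \o f) y)%E.
  rewrite integral_pushforward//.
    exact: measurable_int fi.
apply: eq_measure_integral => A mA _; exact: mu_T.
Qed.

(** The maximum of [birkhoff f k x] over [k <= n], in a recursive form that displays its relation to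
    the maximum at [T x]. *)
Fixpoint max_birkhoff f n x :=
  if n is m.+1 then Num.max 0 (f x + max_birkhoff f m (T x)) else 0.

Lemma max_birkhoff_ge0 f n x : 0 <= max_birkhoff f n x.
Proof. by case: n => //= n; rewrite le_max lexx. Qed.

Lemma max_birkhoff_homo f n x : max_birkhoff f n x <= max_birkhoff f n.+1 x.
Proof.
elim: n x => [|n IH] x; first exact: max_birkhoff_ge0.
rewrite [X in X <= _]/= [X in _ <= X]/= ge_max !le_max lexx/=.
by rewrite lerD2l; apply/orP; right; exact: IH.
Qed.

Lemma max_birkhoff_ge f n x : forall k, (k <= n)%N ->
  birkhoff f k x <= max_birkhoff f n x.
Proof.
elim: n x => [|n IH] x [|k]//; rewrite ?birkhoffS /=.
- by rewrite /birkhoff big_geq.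
- by rewrite /birkhoff big_geq//= le_max lexx.
- by move=> kn; rewrite le_max lerD2l IH ?orbT.
Qed.

Lemma max_birkhoff_gt0P f n x : 0 < max_birkhoff f n x ->
  exists2 k, (k <= n)%N & 0 < birkhoff f k x.
Proof.
suff: exists2 k, (k <= n)%N & max_birkhoff f n x = birkhoff f k x.
  by move=> [k kn ->]; exists k.
elim: n x => [|n IH] x; first by exists 0%N => //; rewrite /birkhoff big_geq.
have [k kn E] := IH (T x); rewrite /= {}E -birkhoffS.
rewrite maxEle; case: ifPn => _; first by exists k.+1.
by exists 0%N => //; rewrite /birkhoff big_geq.
Qed.

Lemma integrable_max_birkhoff f n : mu.-integrable setT (EFin \o f) ->
  mu.-integrable setT (EFin \o max_birkhoff f n).
Proof.
move=> fi; elim: n => [|n IH]; first exact: integrable0.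
have h : mu.-integrable setT (EFin \o (fun x => f x + max_birkhoff f n (T x))).
  rewrite (_ : EFin \o _ = (EFin \o f) \+ (EFin \o (max_birkhoff f n \o T)))//.
  by apply: integrableD => //; exact: integrable_comp_preserving.
apply: (le_integrable _ _ _ h) => //.
  apply/measurable_EFinP; apply: measurable_maxr => //.
  by apply/measurable_EFinP; exact: measurable_int h.
move=> x _; rewrite /= lee_fin ger0_norm ?le_max ?lexx// ge_max normr_ge0.
exact: ler_norm.
Qed.

(* Garsia's proof: where [max_birkhoff f n.+1] is positive, [f] is
   [max_birkhoff f n.+1 - max_birkhoff f n \o T]. *)
Lemma maximal_ergodic f n : mu.-integrable setT (EFin \o f) ->
  0 <= \int[mu]_x (f x * \1_[set x | 0 < max_birkhoff f n x] x).
Proof.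
move=> fi; have Mi k := integrable_max_birkhoff k fi.
have mM k : measurable_fun setT (max_birkhoff f k).
  by apply/measurable_EFinP; exact: measurable_int (Mi k).
set A := [set x | _].
have mA : measurable A by exact: measurable_gt_set.
have fAi : mu.-integrable setT (EFin \o (fun x => f x * \1_A x)).
  exact: integrable_mul_indic.
case: n @A mA fAi => [|n] A mA fAi.
  rewrite (_ : (fun x => f x * _) = cst 0); last first.
    by apply/funext => x; rewrite indicE memNset ?mulr0//= /A/= ltxx.
  by rewrite Rintegral_cst// mul0r.
have MTi := integrable_comp_preserving (Mi n).
have Bi : mu.-integrable setT
    (EFin \o (fun x => max_birkhoff f n.+1 x - max_birkhoff f n (T x))).
  rewrite (_ : EFin \o _ =
    ((EFin \o max_birkhoff f n.+1) \- (EFin \o (max_birkhoff f n \o T)))%E)//.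
  exact: integrableB.
apply: (@le_trans _ _ (\int[mu]_x
    (max_birkhoff f n.+1 x - max_birkhoff f n (T x)))); last first.
  apply: le_Rintegral => // x _; rewrite indicE.
  have [/set_mem h|h] := boolP (x \in A).
    rewrite mulr1 lerBlDr; move: h; rewrite /A /=.
    by rewrite lt_max ltxx /= => h; rewrite max_r// ltW.
  rewrite mulr0 subr_le0; move: h; rewrite notin_setE /A => /negP.
  by rewrite -leNgt => /le_trans; apply; exact: max_birkhoff_ge0.
rewrite RintegralB// Rintegral_comp_preserving// subr_ge0.
by apply: le_Rintegral => // x _; exact: max_birkhoff_homo.
Qed.

(** The maximal ergodic inequality for [g - r] bounds [r] times the measure of [A n] by the integral
    of [g] over [A n], and the sets [A n] increase to the event. *)
Lemma maximal_inequality g r : 0 < r -> (forall x, 0 <= g x) ->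
  mu.-integrable setT (EFin \o g) ->
  (mu [set x | exists n, (r *+ n < birkhoff g n x)%R]
     <= (r^-1 * \int[mu]_x g x)%:E)%E.
Proof.
move=> r0 g0 gi.
pose f x := g x - r.
have fi : mu.-integrable setT (EFin \o f).
  rewrite (_ : EFin \o f = ((EFin \o g) \- (EFin \o cst r))%E)//.
  by apply: integrableB => //; exact: finite_measure_integrable_cst.
have bf n x : birkhoff f n x = birkhoff g n x - r *+ n.
  by rewrite /birkhoff /f sumrB sumr_const_nat subn0.
have mM k : measurable_fun setT (max_birkhoff f k).
  by apply/measurable_EFinP; exact: measurable_int (integrable_max_birkhoff k fi).
pose A n := [set x | 0 < max_birkhoff f n x].
have mA n : measurable (A n) by exact: measurable_gt_set.
rewrite (_ : [set x | _] = \bigcup_n A n); last first.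
  apply/seteqP; split=> x /= => [[n]|[n _]].
    rewrite -subr_gt0 -bf => h; exists n => //.
    by rewrite /A/=; apply: lt_le_trans h _; exact: max_birkhoff_ge.
  by move=> /max_birkhoff_gt0P[k _]; rewrite bf subr_gt0; exists k.
have bnd n : (mu (A n) <= (r^-1 * \int[mu]_x g x)%:E)%E.
  have Ai : mu.-integrable setT (EFin \o (\1_(A n) : S -> R)).
    exact: integrable_indic.
  have gAi : mu.-integrable setT (EFin \o (fun x => g x * \1_(A n) x)).
    exact: integrable_mul_indic.
  have := maximal_ergodic n fi; rewrite -/(A n).
  under eq_Rintegral do rewrite /f mulrBl.
  rewrite RintegralB//; last first.
    rewrite (_ : EFin \o _ = fun x => (r%:E * (EFin \o \1_(A n)) x)%E)//.
    exact: integrableZl.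
  rewrite RintegralZl// subr_ge0 {1}/Rintegral integral_indic// setIT => h.
  rewrite -(@fineK _ (mu (A n))) ?fin_num_measure// lee_fin.
  rewrite ler_pdivlMl//; apply: le_trans h _.
  apply: le_Rintegral => // x _; rewrite indicE.
  by case: (x \in A n); rewrite ?mulr1// mulr0.
have ndA : nondecreasing_seq A.
  apply/nondecreasing_seqP => n; apply/subsetPset => x; rewrite /A/= => h.
  exact: lt_le_trans h (max_birkhoff_homo _ _ _).
have cvA := @nondecreasing_cvg_mu _ _ _ mu _ mA (bigcupT_measurable _ mA) ndA.
rewrite -(cvg_lim _ cvA)//; apply: lime_le; first exact: cvgP cvA.
by apply: nearW => n; exact: bnd.
Qed.

Lemma measurable_iter n : measurable_fun setT (iter n T).
Proof.
by elim: n => [|n IH]; [exact: measurable_id|exact: measurableT_comp].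
Qed.

Lemma measurable_birkhoff f n : measurable_fun setT f ->
  measurable_fun setT (birkhoff f n).
Proof.
move=> mf; rewrite /birkhoff.
apply: (@measurable_sum _ _ _ _ _ _ (fun i x => f (iter i T x))) => i.
by apply: measurableT_comp => //; exact: measurable_iter.
Qed.

(** The sets where [max_birkhoff f n] is positive increase to a set of full measure, so dominated
    convergence passes to the limit in the maximal ergodic inequality. *)
Lemma Rintegral_ge0_birkhoff_pos f : mu.-integrable setT (EFin \o f) ->
  {ae mu, forall x, exists n, 0 < birkhoff f n x} ->
  0 <= \int[mu]_x f x.
Proof.
move=> fi fpos.
have mf : measurable_fun setT f by apply/measurable_EFinP; exact: measurable_int fi.
have mM k : measurable_fun setT (max_birkhoff f k).
  by apply/measurable_EFinP; exact: measurable_int (integrable_max_birkhoff k fi).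
pose A n := [set x | 0 < max_birkhoff f n x].
have mA n : measurable (A n) by exact: measurable_gt_set.
pose h n x := (f x * \1_(A n) x)%:E.
have [| | | | |_ _ cv] := @dominated_convergence _ _ _ mu setT measurableT h
    (EFin \o f) (fun x => `|f x|%:E).
- move=> n; apply/measurable_EFinP; apply: measurable_funM => //.
- exact/measurable_EFinP.
- apply: filterS fpos => x [k fk] _.
  apply: cvg_near_cst; exists k => // n /= kn.
  rewrite /h indicE mem_set ?mulr1//= /A/=.
  by apply: lt_le_trans fk _; exact: max_birkhoff_ge.
- exact: integrable_norm.
- apply: aeW => x n _; rewrite /h lee_fin normrM indicE.
  by case: (x \in A n); rewrite ?normr1 ?mulr1// normr0 mulr0.
rewrite /Rintegral fine_ge0//.
rewrite -(cvg_lim _ cv)//.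
apply: lime_ge; first exact: cvgP cv.
apply: nearW => n; have := maximal_ergodic n fi.
have hi := integrable_fin_num measurableT (integrable_mul_indic (mA n) fi).
by rewrite -lee_fin /Rintegral fineK.
Qed.

Hypothesis ergodic_T : forall A, measurable A -> T @^-1` A = A ->
  mu A = 0%E \/ mu A = 1%E.

(** The set [A] where the sums are unbounded above is invariant. Were it of full measure, the
    integral of [f] would be nonnegative, so ergodicity makes it null. *)
Lemma birkhoff_bounded f : mu.-integrable setT (EFin \o f) ->
  \int[mu]_x f x < 0 ->
  {ae mu, forall x, exists B, forall n, birkhoff f n x <= B}.
Proof.
move=> fi f_lt0.
have mf : measurable_fun setT f by apply/measurable_EFinP; exact: measurable_int fi.
pose A := [set x | forall k : nat, exists n, k%:R < birkhoff f n x].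
have mA : measurable A.
  rewrite (_ : A = \bigcap_k \bigcup_n [set x | k%:R < birkhoff f n x]).
    apply: bigcapT_measurable => k; apply: bigcupT_measurable => n.
    by apply: measurable_gt_set; exact: measurable_birkhoff.
  apply/seteqP; split=> x /= h k; first by move=> _; have [n hn] := h k; exists n.
  by have [n _ hn] := h k I; exists n.
(* Passing from [x] to [T x] changes a Birkhoff sum by [f x]; raising the level by an integer above
   [|f x|] makes up for it. *)
have TA : T @^-1` A = A.
  apply/seteqP; split=> x /= h k.
    have [n hn] := h (k + (Num.truncn `|f x|).+1)%N; exists n.+1.
    rewrite birkhoffS -ltrBlDl; apply: le_lt_trans hn.
    rewrite natrD lerD2l; apply: le_trans (ltW (truncnS_gt _)).
    by rewrite -normrN ler_norm.
  have [n hn] := h (k + (Num.truncn `|f x|).+1)%N.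
  case: n hn => [|n]; first by rewrite /birkhoff big_geq// ltrn0.
  rewrite birkhoffS -ltrBlDl => hn; exists n; apply: le_lt_trans hn.
  rewrite natrD -addrA lerDl subr_ge0; apply: le_trans (ltW (truncnS_gt _)).
  exact: ler_norm.
have [A0|A1] := ergodic_T mA TA.
  exists A; split => // x /= hx k; apply: contrapT => hk; apply: hx.
  exists k%:R => n; rewrite leNgt; apply/negP => hn; apply: hk; by exists n.
exfalso; suff : 0 <= \int[mu]_x f x by rewrite leNgt f_lt0.
apply: Rintegral_ge0_birkhoff_pos => //.
exists (~` A); split; first exact: measurableC.
  by rewrite probability_setC// A1 subee.
move=> x /=; apply: contra_not => /(_ 0%N)[n hn]; by exists n.
Qed.

(* The Birkhoff sums of [c * (g - m) - c ^ 2], which has a negative mean, are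
   bounded; [c] ranges over [1 / k] and [- 1 / k]. *)
Theorem birkhoff_cvg g : mu.-integrable setT (EFin \o g) ->
  {ae mu, forall x,
     n%:R^-1 * birkhoff g n x @[n --> \oo] --> \int[mu]_x g x}.
Proof.
move=> gi; set m := \int[mu]_x g x.
have bf c f : (forall x, f x = c * (g x - m) - c ^+ 2) ->
    forall n x, birkhoff f n x = c * (birkhoff g n x - m *+ n) - c ^+ 2 *+ n.
  move=> E n x; rewrite /birkhoff; under eq_bigr do rewrite E.
  by rewrite sumrB sumr_const_nat subn0 -mulr_sumr sumrB sumr_const_nat subn0.
have ub (c : R) : c != 0 -> {ae mu, forall x, exists B, forall n,
    c * (birkhoff g n x - m *+ n) - c ^+ 2 *+ n <= B}.
  move=> c0; pose k x := g x - m; pose h x := c * k x.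
  pose f x := h x - c ^+ 2.
  have ki : mu.-integrable setT (EFin \o k).
    rewrite (_ : EFin \o _ = ((EFin \o g) \- (EFin \o cst m))%E)//.
    by apply: integrableB => //; exact: finite_measure_integrable_cst.
  have hi : mu.-integrable setT (EFin \o h).
    rewrite (_ : EFin \o _ = fun x => (c%:E * (EFin \o k) x)%E)//.
    exact: integrableZl.
  have fi : mu.-integrable setT (EFin \o f).
    rewrite (_ : EFin \o _ = ((EFin \o h) \- (EFin \o cst (c ^+ 2)%R))%E)//.
    by apply: integrableB => //; exact: finite_measure_integrable_cst.
  have f0 : \int[mu]_x f x < 0.
    rewrite RintegralB//; last exact: finite_measure_integrable_cst.
    rewrite RintegralZl// RintegralB//; last exact: finite_measure_integrable_cst.
    rewrite !Rintegral_cst//.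
    have -> : fine (mu setT) = 1 by rewrite -[RHS]/(fine 1) -(@probability_setT _ _ _ mu).
    rewrite !mulr1 subrr mulr0 sub0r.
    by rewrite oppr_lt0 exprn_even_gt0.
  apply: filterS (birkhoff_bounded fi f0) => x [B hB]; exists B => n.
  by rewrite -(bf c f)//; exact: hB.
have : {ae mu, forall x, forall k : nat, exists B, forall n,
   k.+1%:R^-1 * (birkhoff g n x - m *+ n) - k.+1%:R^-1 ^+ 2 *+ n <= B /\
   - k.+1%:R^-1 * (birkhoff g n x - m *+ n) - k.+1%:R^-1 ^+ 2 *+ n <= B}.
  apply/ae_foralln => k.
  have c0 : k.+1%:R^-1 != 0 :> R by rewrite invr_eq0.
  apply: filterS2 (ub _ c0) (ub (- k.+1%:R^-1) _); last by rewrite oppr_eq0.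
  move=> x [B1 h1] [B2 h2]; exists (Num.max B1 B2) => n.
  by rewrite !le_max h1/= -[X in _ - X *+ _]sqrrN h2 orbT.
apply: filterS => x h; apply/cvgrPdist_le => /= e e0.
have [k ke] : exists k : nat, k.+1%:R^-1 < e / 2 :> R.
  exists (Num.truncn (e / 2)^-1); rewrite invf_plt ?posrE ?divr_gt0//.
  exact: truncnS_gt.
have [B hB] := h k; set c := k.+1%:R^-1 in hB ke.
have c0 : 0 < c by rewrite invr_gt0.
near=> n.
have n0 : 0 < n%:R :> R by rewrite ltr0n; near: n; exists 1%N.
(* Dividing the bound by [c * n] leaves [B / (c * n) + c]; each of the two terms is to be at most
   [e / 2]. *)
have nB : B / c / (e / 2) <= n%:R :> R.
  near: n; apply: nbhs_infty_ger.
have [] := hB n; rewrite -[m *+ n]mulr_natr -[c ^+ 2 *+ n]mulr_natr => h1 h2.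
have Bn : B <= n%:R * (e / 2) * c.
  by rewrite -!ler_pdivrMr// divr_gt0.
have cn : c * n%:R <= e / 2 * n%:R by rewrite ler_wpM2r// ltW.
have D1 : birkhoff g n x - m * n%:R <= e * n%:R.
  rewrite -(ler_pM2l c0); nra.
have D2 : - (birkhoff g n x - m * n%:R) <= e * n%:R.
  rewrite -(ler_pM2l c0); nra.
rewrite ler_norml lerNl opprB.
rewrite -(ler_pM2r n0) -[X in _ && X](ler_pM2r n0) !mulrBl.
rewrite mulrAC mulVf ?gt_eqF// mul1r; apply/andP; split; lra.
Unshelve. all: by end_near.
Qed.

End ergodic_theorem.

(** * Smooth norms and discrete Fourier transforms *)

Section smooth_norm.
Context {R : realType}.
Implicit Types a b x y : R.

(** With [A + D] and [A - D] for the two squares, a further factor mixes the even part of the powers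
    with the odd part. The induction therefore carries a bound on [D] times the odd part as well.
    The constant depends on [Q] only, so that it stays fixed while [q] grows. *)
Lemma exprD_exprB_le (Q : nat) a b : forall q, (q <= Q)%N ->
  (a + b) ^+ (2 * q) + (a - b) ^+ (2 * q)
    <= 2 * (a ^+ 2 + (4 * Q + 1)%:R * b ^+ 2) ^+ q.
Proof.
set K := (4 * Q + 1)%:R.
pose A := a ^+ 2 + b ^+ 2; pose D := 2 * a * b.
pose P := a ^+ 2 + K * b ^+ 2.
have sA : (a + b) ^+ 2 = A + D by rewrite /A /D; ring.
have sB : (a - b) ^+ 2 = A - D by rewrite /A /D; ring.
have K1 : 1 <= K by rewrite /K natrD lerDr.
have A0 : 0 <= A by rewrite addr_ge0 ?sqr_ge0.
have AP : A <= P by rewrite lerD2l ler_peMl ?sqr_ge0.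
have aP : a ^+ 2 <= P by rewrite lerDl mulr_ge0 ?sqr_ge0 ?(le_trans ler01).
suff main q : (q <= Q)%N ->
    (A + D) ^+ q + (A - D) ^+ q <= 2 * P ^+ q /\
    D * ((A + D) ^+ q - (A - D) ^+ q) <= 2 * (4 * q)%:R * b ^+ 2 * P ^+ q.
  by move=> q qQ; rewrite !exprM sA sB; have [] := main q qQ.
elim: q => [_|q IH qQ]; first by rewrite !expr0 subrr mulr0 muln0 mulr0 !mul0r; split => //; lra.
have {IH} := IH (ltnW qQ).
set u := (A + D) ^+ q; set v := (A - D) ^+ q; set p := P ^+ q => -[h1 h2].
have p0 : 0 <= p by rewrite exprn_ge0// (le_trans _ AP).
have b0 : 0 <= b ^+ 2 := sqr_ge0 b.
have qK : (4 * q)%:R + 1 <= K by rewrite natr1 ler_nat; lia.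
rewrite !exprS -/u -/v -/p; split.
  have -> : (A + D) * u + (A - D) * v = A * (u + v) + D * (u - v) by ring.
  have h3 : A * (u + v) <= A * (2 * p) by rewrite ler_wpM2l.
  have h4 : ((4 * q)%:R + 1) * (b ^+ 2 * p) <= K * (b ^+ 2 * p).
    by rewrite ler_wpM2r// mulr_ge0.
  apply: le_trans (lerD h3 h2) _; rewrite /A /P; nra.
have -> : D * ((A + D) * u - (A - D) * v)
   = A * (D * (u - v)) + D ^+ 2 * (u + v) by ring.
have h3 : A * (D * (u - v)) <= A * (2 * (4 * q)%:R * b ^+ 2 * p).
  by rewrite ler_wpM2l.
have h4 : D ^+ 2 * (u + v) <= D ^+ 2 * (2 * p) by rewrite ler_wpM2l ?sqr_ge0.
apply: le_trans (lerD h3 h4) _.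
have -> : D ^+ 2 = 4 * a ^+ 2 * b ^+ 2 by rewrite /D; ring.
have -> : (4 * q.+1)%:R = (4 * q)%:R + 4 :> R by rewrite mulnS natrD addrC.
have B0 : 0 <= b ^+ 2 * p by rewrite mulr_ge0.
have h5 : A * ((4 * q)%:R * (b ^+ 2 * p)) <= P * ((4 * q)%:R * (b ^+ 2 * p)).
  by rewrite ler_wpM2r// mulr_ge0.
have h6 : a ^+ 2 * (b ^+ 2 * p) <= P * (b ^+ 2 * p) by rewrite ler_wpM2r.
nra.
Qed.

(** The induction step loses [s * t * (x - y) * (x ^ q - y ^ q)], which is nonnegative because
    powers are monotone. *)
Lemma expr_convex (q : nat) (s t x y : R) : 0 <= s -> 0 <= t -> s + t = 1 ->
  0 <= x -> 0 <= y ->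
  (s * x + t * y) ^+ q <= s * x ^+ q + t * y ^+ q.
Proof.
move=> s0 t0 st x0 y0; elim: q => [|q IH]; first by rewrite !expr0 !mulr1 st.
have m0 : 0 <= s * x + t * y by rewrite addr_ge0 ?mulr_ge0.
rewrite exprS; apply: le_trans (ler_wpM2l m0 IH) _; rewrite !exprS.
have h : 0 <= (x - y) * (x ^+ q - y ^+ q).
  have [xy|/ltW xy] := leP x y.
    by rewrite mulr_le0// subr_le0// lerXn2r// nnegrE.
  by rewrite mulr_ge0// subr_ge0// lerXn2r// nnegrE.
have -> : t = 1 - s by rewrite -st addrAC subrr add0r.
have h' : 0 <= s * (1 - s) * ((x - y) * (x ^+ q - y ^+ q)).
  by rewrite mulr_ge0// mulr_ge0// subr_ge0 -st lerDl.
move: h'; set X := x ^+ q; set Y := y ^+ q => h'; nra.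
Qed.

Definition nroot (q : nat) x := x `^ q%:R^-1.

Lemma nroot_ge0 q x : 0 <= nroot q x.
Proof. exact: powR_ge0. Qed.

Lemma nrootK q x : 0 <= x -> nroot q.+1 x ^+ q.+1 = x.
Proof.
by move=> x0; rewrite -powR_mulrn ?powR_ge0// -powRrM mulVf ?powRr1.
Qed.

Lemma le_nroot q x y : 0 <= x -> 0 <= y -> (nroot q.+1 x <= y) = (x <= y ^+ q.+1).
Proof.
by move=> x0 y0; rewrite -(@ler_pXn2r _ q.+1)// ?nnegrE ?nroot_ge0// nrootK.
Qed.

Lemma nroot_exprn q x : 0 <= x -> nroot q.+1 (x ^+ q.+1) = x.
Proof.
move=> x0; apply/eqP; rewrite -(@eqrXn2 _ q.+1)// ?nroot_ge0//.
by rewrite nrootK ?exprn_ge0.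
Qed.

(** Both families are normalized by their norms [A] and [B]; convexity of the power with weights
    [A / (A + B)] and [B / (A + B)] then bounds each term. *)
Lemma nroot_minkowski (I : finType) q (f g : I -> R) :
  (forall i, 0 <= f i) -> (forall i, 0 <= g i) ->
  nroot q.+1 (\sum_i (f i + g i) ^+ q.+1) <=
  nroot q.+1 (\sum_i f i ^+ q.+1) + nroot q.+1 (\sum_i g i ^+ q.+1).
Proof.
move=> f0 g0.
have sf0 : 0 <= \sum_i f i ^+ q.+1 by apply: sumr_ge0 => i _; rewrite exprn_ge0.
have sg0 : 0 <= \sum_i g i ^+ q.+1 by apply: sumr_ge0 => i _; rewrite exprn_ge0.
have null (h : I -> R) : (forall i, 0 <= h i) -> nroot q.+1 (\sum_i h i ^+ q.+1) = 0 ->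
    forall i, h i = 0.
  move=> h0 e i; have : \sum_i h i ^+ q.+1 = 0.
    by rewrite -[LHS](nrootK q) ?e ?expr0n// sumr_ge0// => j _; rewrite exprn_ge0.
  move/psumr_eq0P => /(_ (fun j _ => exprn_ge0 _ (h0 j)) i isT) /eqP.
  by rewrite expf_eq0/= => /eqP.
set A := nroot q.+1 (\sum_i f i ^+ q.+1); set B := nroot q.+1 (\sum_i g i ^+ q.+1).
have [A0|A0] := eqVneq A 0.
  by rewrite A0 add0r; under eq_bigr do rewrite (null f)// add0r.
have [B0|B0] := eqVneq B 0.
  by rewrite B0 addr0; under eq_bigr do rewrite (null g)// addr0.
have {}A0 : 0 < A by rewrite lt_def A0 nroot_ge0.
have {}B0 : 0 < B by rewrite lt_def B0 nroot_ge0.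
have AB : 0 < A + B by rewrite addr_gt0.
rewrite le_nroot ?(ltW AB)//; last by apply: sumr_ge0 => i _; rewrite exprn_ge0// addr_ge0.
pose s := A / (A + B); pose t := B / (A + B).
have st : s + t = 1 by rewrite /s /t -mulrDl divff ?gt_eqF.
have step i : (f i + g i) ^+ q.+1 <=
    (A + B) ^+ q.+1 * (s * (f i / A) ^+ q.+1 + t * (g i / B) ^+ q.+1).
  have -> : f i + g i = (A + B) * (s * (f i / A) + t * (g i / B)).
    by rewrite /s /t; field; rewrite !gt_eqF.
  rewrite exprMn ler_wpM2l ?exprn_ge0 ?(ltW AB)//.
  by apply: expr_convex => //; rewrite divr_ge0 ?f0 ?g0// ltW.
apply: le_trans (ler_sum _ (fun i _ => step i)) _.
rewrite -mulr_sumr big_split/= -!mulr_sumr.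
under eq_bigr do rewrite expr_div_n.
rewrite -mulr_suml.
under [X in _ + _ * X]eq_bigr do rewrite expr_div_n.
rewrite -mulr_suml -[X in X / A ^+ _](nrootK q sf0) -[X in X / B ^+ _](nrootK q sg0).
by rewrite -/A -/B !divff ?expf_neq0 ?gt_eqF// !mulr1 st mulr1.
Qed.

(* Squared [l_(2q)] norm: a 2-smooth substitute for [max_i z_i ^ 2], off by a
   factor of at most [#|I| ^ (1/q)]. *)
Definition sqnorm (I : finType) (q : nat) (z : I -> R) : R :=
  nroot q (\sum_i z i ^+ (2 * q)).

Lemma sqnorm_ge0 (I : finType) q (z : I -> R) : 0 <= sqnorm q z.
Proof. exact: nroot_ge0. Qed.

Lemma sqnorm_ge (I : finType) q (z : I -> R) i : z i ^+ 2 <= sqnorm q.+1 z.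
Proof.
rewrite -(@ler_pXn2r _ q.+1)// ?nnegrE ?sqnorm_ge0 ?sqr_ge0//.
rewrite nrootK; last by apply: sumr_ge0 => j _; rewrite exprM exprn_ge0 ?sqr_ge0.
rewrite -exprM (bigD1 i)//= lerDl sumr_ge0// => j _.
by rewrite exprM exprn_ge0 ?sqr_ge0.
Qed.

Lemma sqnormZ (I : finType) q (c : R) (z : I -> R) :
  sqnorm q.+1 (fun i => c * z i) = c ^+ 2 * sqnorm q.+1 z.
Proof.
rewrite /sqnorm; under eq_bigr do rewrite exprMn.
have c0 : 0 <= (c ^+ 2) ^+ q.+1 by rewrite exprn_ge0// sqr_ge0.
rewrite -mulr_sumr {1}exprM /nroot powRM//; last first.
  by apply: sumr_ge0 => j _; rewrite exprM exprn_ge0 ?sqr_ge0.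
by rewrite -/(nroot q.+1 ((c ^+ 2) ^+ q.+1)) nroot_exprn ?sqr_ge0.
Qed.

Lemma sqnorm_le_card (I : finType) q (z : I -> R) : (forall i, `|z i| <= 1) ->
  sqnorm q.+1 z <= nroot q.+1 #|I|%:R.
Proof.
move=> z1; rewrite le_nroot ?nroot_ge0//; last first.
  by apply: sumr_ge0 => j _; rewrite exprM exprn_ge0 ?sqr_ge0.
rewrite nrootK// -sum1_card natr_sum; apply: ler_sum => i _.
rewrite exprM exprn_ile1 ?sqr_ge0// -real_normK ?num_real//.
by rewrite exprn_ile1.
Qed.

(** Convexity of the power [q + 1] reduces the average of the two squared norms to a sum over
    coordinates. There [exprD_exprB_le] applies, and Minkowski's inequality for the squares
    separates [x] from [y]. The smoothness constant is linear in [q]. *)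
Lemma sqnorm_smooth (I : finType) q (x y : I -> R) :
  sqnorm q.+1 (fun i => x i + y i) + sqnorm q.+1 (fun i => x i - y i) <=
  2 * (sqnorm q.+1 x + (4 * q.+1 + 1)%:R * sqnorm q.+1 y).
Proof.
set K := (4 * q.+1 + 1)%:R.
set u := sqnorm _ (fun i => x i + y i); set v := sqnorm _ (fun i => x i - y i).
have K0 : 0 <= K by rewrite ler0n.
suff h : (2^-1 * u + 2^-1 * v) <= sqnorm q.+1 x + K * sqnorm q.+1 y by lra.
have r0 : 0 <= sqnorm q.+1 x + K * sqnorm q.+1 y.
  by rewrite addr_ge0 ?mulr_ge0 ?sqnorm_ge0.
have l0 : 0 <= 2^-1 * u + 2^-1 * v by rewrite addr_ge0 ?mulr_ge0 ?sqnorm_ge0.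
rewrite -(@ler_pXn2r _ q.+1)// ?nnegrE//.
apply: le_trans (@expr_convex q.+1 2^-1 2^-1 u v _ _ _ _ _) _;
  rewrite ?sqnorm_ge0//; first by lra.
have E z : sqnorm q.+1 z ^+ q.+1 = \sum_(i : I) z i ^+ (2 * q.+1).
  by rewrite nrootK// sumr_ge0// => j _; rewrite exprM exprn_ge0 ?sqr_ge0.
rewrite /u /v !E -mulrDr -big_split/= mulr_sumr.
have step i : 2^-1 * ((x i + y i) ^+ (2 * q.+1) + (x i - y i) ^+ (2 * q.+1)) <=
    (x i ^+ 2 + K * y i ^+ 2) ^+ q.+1.
  have := @exprD_exprB_le q.+1 (x i) (y i) q.+1 (leqnn _); rewrite -/K.
  set U := (_ ^+ _ + _); set V := (_ ^+ q.+1); lra.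
apply: le_trans (ler_sum _ (fun i _ => step i)) _.
have Ky : K * sqnorm q.+1 y = nroot q.+1 (\sum_i (K * y i ^+ 2) ^+ q.+1).
  rewrite -[K in LHS](sqr_sqrtr K0) -sqnormZ /sqnorm; congr nroot.
  by apply: eq_bigr => i _; rewrite exprM; congr (_ ^+ _); rewrite exprMn sqr_sqrtr.
have Ex : sqnorm q.+1 x = nroot q.+1 (\sum_i (x i ^+ 2) ^+ q.+1).
  by congr nroot; apply: eq_bigr => i _; rewrite exprM.
rewrite Ky Ex -[X in X <= _](nrootK q).
  rewrite lerXn2r// ?nnegrE ?addr_ge0 ?nroot_ge0//.
  apply: nroot_minkowski => i; first exact: sqr_ge0.
  by rewrite mulr_ge0// sqr_ge0.
apply: sumr_ge0 => i _; rewrite exprn_ge0// addr_ge0 ?sqr_ge0//.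
by rewrite mulr_ge0// sqr_ge0.
Qed.

End smooth_norm.

(** * Discrete Fourier transforms and convolutions *)

Section fourier.
Context {R : realType}.
Variable N : nat.
Hypothesis N_gt0 : (0 < N)%N.
Let alpha : R := 2 * pi / N%:R.
Implicit Types x y c : nat -> R.

(** With [sin_sum], the two parts of the discrete Fourier transform of order [N]. The length [m] is
    separate from [N] to allow for padding by zeros. *)
Definition cos_sum m x (k : nat) := \sum_(i < m) x i * cos (i%:R * (k%:R * (2 * pi / N%:R))).
Definition sin_sum m x (k : nat) := \sum_(i < m) x i * sin (i%:R * (k%:R * (2 * pi / N%:R))).

(** Multiplication by [2 * sin (t / 2)] makes the sum telescope, and this sine is nonzero because
    [t / 2] lies strictly between 0 and [pi]. *)
Lemma sum_cos_eq0 r : (0 < r < N)%N -> \sum_(k < N) cos (k%:R * (r%:R * alpha)) = 0.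
Proof.
move=> /andP[r0 rN]; set t := r%:R * alpha.
have N0 : N%:R != 0 :> R by rewrite pnatr_eq0 -lt0n.
have th : t / 2 = r%:R / N%:R * pi by rewrite /t /alpha; field.
have s0 : sin (t / 2) != 0.
  rewrite gt_eqF// th; apply: sin_gt0_pi; apply/andP; split.
    by rewrite mulr_gt0 ?pi_gt0// divr_gt0 ?ltr0n.
  by rewrite gtr_pMl ?pi_gt0// ltr_pdivrMr ?ltr0n// mul1r ltr_nat.
suff H n : 2 * sin (t / 2) * (\sum_(k < n) cos (k%:R * t)) =
    sin (n%:R * t - t / 2) + sin (t / 2).
  have := H N.
  have -> : N%:R * t - t / 2 = - (t / 2) + (pi *+ 2) *+ r.
    rewrite -mulr_natl -[pi *+ 2]mulr_natl /t /alpha; field.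
    exact: N0.
  rewrite (periodicn (@sinD2pi R)) sinN addNr => /eqP.
  by rewrite mulf_eq0 mulf_eq0 pnatr_eq0/= (negPf s0) => /eqP.
elim: n => [|n IH]; first by rewrite big_ord0 mulr0 mul0r sub0r sinN addNr.
rewrite big_ord_recr/= mulrDr IH.
have -> : n.+1%:R * t - t / 2 = n%:R * t + t / 2 by rewrite -natr1; field.
rewrite !sinD sinN cosN; ring.
Qed.

Lemma sqr_cos_sin_sum m y k : cos_sum m y k ^+ 2 + sin_sum m y k ^+ 2 =
  \sum_(i < m) \sum_(j < m) y i * y j * cos (k%:R * ((i%:R - j%:R) * alpha)).
Proof.
rewrite !expr2 /cos_sum /sin_sum !mulr_suml -big_split; apply: eq_bigr => i _ /=.
rewrite !mulr_sumr -big_split; apply: eq_bigr => j _ /=.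
have -> : k%:R * ((i%:R - j%:R) * alpha) =
  i%:R * (k%:R * (2 * pi / N%:R)) - j%:R * (k%:R * (2 * pi / N%:R)).
  by rewrite /alpha; ring.
by rewrite cosB; ring.
Qed.

(** The squared moduli expand into double sums of cosines, and summation over the frequencies leaves
    only the diagonal. *)
Lemma parseval y : \sum_(k < N) (cos_sum N y k ^+ 2 + sin_sum N y k ^+ 2) =
  N%:R * \sum_(i < N) y i ^+ 2.
Proof.
under eq_bigr do rewrite sqr_cos_sin_sum.
rewrite exchange_big mulr_sumr; apply: eq_bigr => i _ /=.
rewrite exchange_big (bigD1 i)//= [X in _ + X]big1 => [|j ji].
  rewrite subrr mul0r addr0.
  under eq_bigr do rewrite mulr0 cos0 mulr1.
  by rewrite sumr_const card_ord expr2 mulr_natl.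
rewrite -mulr_sumr; apply/eqP; rewrite mulf_eq0; apply/orP; right; apply/eqP.
have [ij|ij] := ltnP i j.
  rewrite -[RHS](@sum_cos_eq0 (j - i)); last first.
    by rewrite subn_gt0 ij/= (leq_ltn_trans _ (ltn_ord j))// leq_subr.
  apply: eq_bigr => k _; rewrite natrB ?(ltnW ij)// -cosN; congr cos; ring.
rewrite -[RHS](@sum_cos_eq0 (i - j)); last first.
  rewrite subn_gt0 ltn_neqAle ij eq_sym (leq_ltn_trans _ (ltn_ord i)) ?leq_subr//.
  by rewrite andbT/= andbT; move: ji; rewrite eq_sym.
by apply: eq_bigr => k _; rewrite natrB.
Qed.

Definition convolution m c x (r : nat) :=
  \sum_(j < m) \sum_(i < m) (if (i + j == r)%N then c j * x i else 0).

(** The condition [2 * m <= N] keeps every index [i + j] below [N], so no term is lost. *)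
Lemma sum_convolution m c x (F : nat -> R) : (2 * m <= N)%N ->
  \sum_(r < N) convolution m c x r * F r =
  \sum_(j < m) \sum_(i < m) c j * x i * F (i + j)%N.
Proof.
move=> mN; under eq_bigr do rewrite /convolution mulr_suml.
rewrite exchange_big/=; apply: eq_bigr => j _.
under eq_bigr do rewrite mulr_suml.
rewrite exchange_big/=; apply: eq_bigr => i _.
have ijN : (i + j < N)%N by have := ltn_ord i; have := ltn_ord j; lia.
rewrite (bigD1 (Ordinal ijN))//= eqxx big1 ?addr0// => r rij.
rewrite ifF ?mul0r//; apply/negbTE; apply: contra rij => /eqP e.
by apply/eqP/val_inj; rewrite /= e.
Qed.

Lemma convolution_fourier m c x k : (2 * m <= N)%N ->
  cos_sum N (convolution m c x) k ^+ 2 + sin_sum N (convolution m c x) k ^+ 2 =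
  (cos_sum m c k ^+ 2 + sin_sum m c k ^+ 2) *
  (cos_sum m x k ^+ 2 + sin_sum m x k ^+ 2).
Proof.
move=> mN.
have -> : cos_sum N (convolution m c x) k =
    cos_sum m c k * cos_sum m x k - sin_sum m c k * sin_sum m x k.
  rewrite {1}/cos_sum (sum_convolution _ _ (fun r => cos (r%:R * _)))//.
  rewrite !mulr_suml -sumrB; apply: eq_bigr => j _.
  rewrite !mulr_sumr -sumrB; apply: eq_bigr => i _.
  by rewrite natrD mulrDl cosD; ring.
have -> : sin_sum N (convolution m c x) k =
    cos_sum m c k * sin_sum m x k + sin_sum m c k * cos_sum m x k.
  rewrite {1}/sin_sum (sum_convolution _ _ (fun r => sin (r%:R * _)))//.
  rewrite !mulr_suml -big_split; apply: eq_bigr => j _ /=.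
  rewrite !mulr_sumr -big_split; apply: eq_bigr => i _ /=.
  by rewrite natrD mulrDl sinD; ring.
ring.
Qed.

(** Parseval's identity is used twice, for the convolution and for [c]; in between, the transform of
    the convolution is the product of the transforms, and the factor of [x] is at most [B]. *)
Lemma convolution_le m c x (B : R) : (2 * m <= N)%N ->
  (forall k, (k < N)%N -> cos_sum m x k ^+ 2 + sin_sum m x k ^+ 2 <= B) ->
  \sum_(r < N) convolution m c x r ^+ 2 <= B * \sum_(j < m) c j ^+ 2.
Proof.
move=> mN xB; have N0 : 0 < N%:R :> R by rewrite ltr0n.
rewrite -(ler_pM2l N0) -parseval mulrCA.
(* Padding by zeros to length [N] makes Parseval's identity applicable to [c]. *)
pose c' j := if (j < m)%N then c j else 0.
have cut (F : nat -> R) : \sum_(j < N) (if (j < m)%N then F j else 0) = \sum_(j < m) F j.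
  by rewrite -big_mkcond/= -(@big_ord_widen _ _ _ m N F)//; lia.
have -> : \sum_(j < m) c j ^+ 2 = \sum_(j < N) c' j ^+ 2.
  by rewrite -(cut (fun j => c j ^+ 2));
    apply: eq_bigr => j _; rewrite /c'; case: ifP; rewrite ?expr0n.
rewrite -parseval mulr_sumr; apply: ler_sum => k _.
rewrite convolution_fourier// mulrC.
have -> : cos_sum N c' k = cos_sum m c k.
  by rewrite /cos_sum -(cut (fun j => c j * cos (j%:R * _))%R);
    apply: eq_bigr => j _; rewrite /c'; case: ifP; rewrite ?mul0r.
have -> : sin_sum N c' k = sin_sum m c k.
  by rewrite /sin_sum -(cut (fun j => c j * sin (j%:R * _))%R);
    apply: eq_bigr => j _; rewrite /c'; case: ifP; rewrite ?mul0r.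
by rewrite ler_wpM2r ?addr_ge0 ?sqr_ge0// xB.
Qed.

End fourier.

(** * Functions of the past innovations *)

Section path_space.
Context {R : realType} {I : Type}.

Definition cylinder : set (set (I -> R)) :=
  [set C | exists (i : I) (B : set R), measurable B /\ C = [set x | B (x i)]].

(** Measurability in this type is [path_measurable] up to conversion, so stationarity and ergodicity
    apply to its measurable sets directly. *)
Definition pathspace := g_sigma_algebraType cylinder.

HB.instance Definition _ := Measurable.on pathspace.

Lemma measurable_coord (i : I) : measurable_fun setT (fun x : pathspace => x i).
Proof.
move=> _ B mB; rewrite setTI; apply: sub_sigma_algebra; by exists i, B.
Qed.

Lemma measurable_path d (S : measurableType d) (Y : S -> pathspace) :
  (forall i, measurable_fun setT (fun w => Y w i)) -> measurable_fun setT Y.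
Proof.
move=> mY; apply: (@measurability _ _ S pathspace setT Y cylinder) => // _ [_ [i [B [mB ->]]] <-].
exact: (mY i).
Qed.

End path_space.
Arguments pathspace : clear implicits.

Section independence.
Context d (T : measurableType d) (R : realType) (P : probability T R).
Variable V : {RV P >-> R}.
Variable Y : {mfun T >-> pathspace R nat}.

(** Only finitely many coordinates are tested, as [mutually_independent] does; all measurable sets
    of paths are reached in [independent_of_pathP]. *)
Definition independent_of_path := forall (B : set R) (n : nat) (C : nat -> set R),
  measurable B -> (forall j, measurable (C j)) ->
  P (V @^-1` B `&` [set w | forall j, (j < n)%N -> C j (Y w j)]) =
  (P (V @^-1` B) * P [set w | forall j, (j < n)%N -> C j (Y w j)])%E.

Hypothesis VY : independent_of_path.

(** Both sides are finite measures in [A]. They agree on the family [G], which is stable under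
    intersection and generates the sigma-algebra. *)
Lemma independent_of_pathP (B : set R) (A : set (pathspace R nat)) :
  measurable B -> measurable A ->
  P (V @^-1` B `&` Y @^-1` A) = (P (V @^-1` B) * P (Y @^-1` A))%E.
Proof.
move=> mB mA.
pose G : set (set (pathspace R nat)) := [set A | exists n (C : nat -> set R),
  (forall j, measurable (C j)) /\ A = [set y | forall j, (j < n)%N -> C j (y j)]].
have mYG A' : G A' -> measurable A'.
  move=> [n [C [mC ->]]].
  rewrite (_ : [set y | _] = \bigcap_j [set y : pathspace R nat | (j < n)%N -> C j (y j)]).
    apply: bigcapT_measurable => j; have [jn|_] := boolP (j < n)%N.
      rewrite (_ : [set y | _] = setT `&` (fun y : pathspace R nat => y j) @^-1` C j).
        exact: measurable_coord.
      by rewrite setTI; apply/seteqP; split => y /=; [apply|].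
    by rewrite (_ : [set y | _] = setT)//; apply/seteqP; split.
  by apply/seteqP; split => y /= h j; [move=> _|]; apply: h.
have GE : measurable = <<s G >>.
  apply/seteqP; split => A'.
    apply: smallest_sub; first exact: smallest_sigma_algebra.
    move=> _ [i [B' [mB' ->]]]; apply: sub_sigma_algebra.
    exists i.+1, (fun j => if j == i then B' else setT); split=> [j|].
      by case: ifP.
    apply/seteqP; split=> y /= h; last by have := h i (ltnSn i); rewrite eqxx.
    by move=> j _; case: eqP => // ->.
  apply: smallest_sub; last exact: mYG.
  exact: (@sigma_algebra_measurable _ (pathspace R nat)).
have GI : setI_closed G.
  move=> _ _ [n [C [mC ->]]] [n' [C' [mC' ->]]].
  exists (maxn n n'), (fun j => (if (j < n)%N then C j else setT) `&`
    (if (j < n')%N then C' j else setT)); split=> [j|].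
    by apply: measurableI; case: ifP.
  apply/seteqP; split=> y /=.
    by move=> [h h'] j _; split; case: ifP => // /[dup] jn; [move/h|move/h'].
  move=> h; split=> j jn.
    by have := h j; rewrite leq_max jn => -[]//.
  by have := h j; rewrite leq_max jn orbT => -[]//.
have mVB : measurable (V @^-1` B).
  by rewrite -[_ @^-1` _]setTI; exact: measurable_funP.
have VBfin : P (V @^-1` B) \is a fin_num by rewrite fin_num_measure.
pose m1 : {measure set (pathspace R nat) -> \bar R} := pushforward (mrestr P mVB) Y.
have r0 : 0 <= fine (P (V @^-1` B)) by rewrite fine_ge0.
pose m2 : {measure set (pathspace R nat) -> \bar R} := mscale (NngNum r0) (pushforward P Y).
have mY : measurable_fun setT Y by [].
have m1E A' : m1 mY A' = P (V @^-1` B `&` Y @^-1` A') by rewrite setIC.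
have m2E A' : m2 mY A' = (P (V @^-1` B) * P (Y @^-1` A'))%E.
  by rewrite -[in RHS](fineK VBfin).
rewrite -m1E -m2E.
apply: (@measure_unique _ _ _ G (fun=> setT) GE GI) => //.
- by move=> _; exists 0%N, (fun=> setT); split => //; apply/seteqP; split.
- by rewrite bigcup_const//; exists 0%N.
- by move=> _ [n [C [mC ->]]]; rewrite m1E m2E; exact: VY.
- by move=> _; rewrite m1E preimage_setT setIT ltey_eq VBfin.
Qed.

(** Independence identifies the joint law with the product measure, and Tonelli's theorem
    applies. *)
Lemma independent_integral (h : R * pathspace R nat -> \bar R) :
  measurable_fun setT h -> (forall z, 0 <= h z)%E ->
  (\int[P]_w h (V w, Y w) =
   \int[distribution P Y]_y \int[distribution P V]_x h (x, y))%E.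
Proof.
move=> mh h0.
have mVY : measurable_fun setT (fun w => (V w, Y w)).
  exact: measurable_fun_pair.
transitivity (\int[pushforward P (fun w => (V w, Y w))]_z h z)%E.
  by rewrite ge0_integral_pushforward.
transitivity (\int[(distribution P V \x distribution P Y)%E]_z h z)%E; last first.
  by rewrite fubini_tonelli2.
apply: eq_measure_integral => A mA _; apply/esym.
apply: product_measure_unique => // B C mB mC.
by rewrite /= /pushforward -independent_of_pathP.
Qed.

End independence.

(** * Mean squares and almost sure convergence along subsequences *)

Section squares.
Context d (T : measurableType d) (R : realType) (P : probability T R).
Implicit Types f g : T -> R.

Definition msq f : \bar R := (\int[P]_w (f w ^+ 2)%:E)%E.

Lemma ge0_integral_EFinD f g : measurable_fun setT f -> measurable_fun setT g ->
  (forall w, 0 <= f w) -> (forall w, 0 <= g w) ->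
  (\int[P]_w (f w + g w)%:E = \int[P]_w (f w)%:E + \int[P]_w (g w)%:E)%E.
Proof.
move=> mf mg f0 g0; under eq_integral do rewrite EFinD.
by rewrite ge0_integralD// => [w _||w _|]; rewrite ?lee_fin//;
  exact/measurable_EFinP.
Qed.

Lemma ge0_integral_EFinZ c f : measurable_fun setT f -> (forall w, 0 <= f w) ->
  0 <= c -> (\int[P]_w (c * f w)%:E = c%:E * \int[P]_w (f w)%:E)%E.
Proof.
move=> mf f0 c0; under eq_integral do rewrite EFinM.
by rewrite ge0_integralZl// => [|w _]; rewrite ?lee_fin//;
  exact/measurable_EFinP.
Qed.

Lemma ge0_le_integral_EFin f g : measurable_fun setT f -> measurable_fun setT g ->
  (forall w, 0 <= f w) -> (forall w, f w <= g w) ->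
  (\int[P]_w (f w)%:E <= \int[P]_w (g w)%:E)%E.
Proof.
move=> mf mg f0 fg; apply: ge0_le_integral => //.
- by move=> w _; rewrite lee_fin.
- exact/measurable_EFinP.
- exact/measurable_EFinP.
- by move=> w _; rewrite lee_fin.
Qed.

Lemma msq_ge0 f : (0 <= msq f)%E.
Proof. by apply: integral_ge0 => w _; rewrite lee_fin sqr_ge0. Qed.

Lemma msq_le2D f g : measurable_fun setT f -> measurable_fun setT g ->
  (msq (fun w => f w + g w)%R <= 2%:E * msq f + 2%:E * msq g)%E.
Proof.
move=> mf mg.
have m2 (h : T -> R) : measurable_fun setT h -> measurable_fun setT (fun w => h w ^+ 2).
  by move=> mh; exact: measurable_funX.
rewrite /msq -!ge0_integral_EFinZ; do ?[exact: m2|by []|by move=> w; exact: sqr_ge0].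
have m22 (h : T -> R) : measurable_fun setT h -> measurable_fun setT (fun w => 2 * h w ^+ 2).
  by move=> mh; apply: measurable_funM => //; exact: m2.
have p2 (h : T -> R) w : 0 <= 2 * h w ^+ 2 by rewrite mulr_ge0 ?sqr_ge0.
rewrite -ge0_integral_EFinD; do ?[exact: m22|exact: p2].
apply: ge0_le_integral_EFin.
- by apply: m2; exact: measurable_funD.
- by apply: measurable_funD; exact: m22.
- by move=> w; exact: sqr_ge0.
- by move=> w; have := sqr_ge0 (f w - g w); nra.
Qed.

Lemma msqZ (c : R) f : measurable_fun setT f ->
  msq (fun w => c * f w) = ((c ^+ 2)%:E * msq f)%E.
Proof.
move=> mf; rewrite /msq -ge0_integralZl//.
- by apply: eq_integral => w _; rewrite exprMn EFinM.
- by apply/measurable_EFinP; exact: measurable_funX.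
- by move=> w _; rewrite lee_fin sqr_ge0.
- by rewrite lee_fin sqr_ge0.
Qed.

Lemma borel_cantelli (A : nat -> set T) (C rho : R) :
  (forall k, measurable (A k)) -> 0 <= rho < 1 -> 0 <= C ->
  (forall k, (P (A k) <= (C * rho ^+ k)%:E)%E) ->
  {ae P, forall w, exists K, forall k, (K <= k)%N -> ~ A k w}.
Proof.
move=> mA /andP[r0 r1] C0 PA.
exists (lim_sup_set A); split.
- by apply: bigcapT_measurable => n; apply: bigcup_measurable.
- apply: lim_sup_set_cvg0 => //.
  apply: (@le_lt_trans _ _ (C / (1 - rho))%:E); last exact: ltry.
  apply: lime_le; first exact: is_cvg_nneseries.
  apply: nearW => n; apply: (@le_trans _ _ (\sum_(0 <= k < n) (C * rho ^+ k)%:E)%E).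
    by apply: lee_sum => k _; exact: PA.
  rewrite sumEFin lee_fin -mulr_sumr ler_wpM2l//.
  have r10 : 0 < 1 - rho by rewrite subr_gt0.
  rewrite -[_^-1]mul1r ler_pdivlMr// mulrC.
  have -> : (1 - rho) * (\sum_(0 <= k < n) rho ^+ k) = 1 - rho ^+ n.
    by rewrite big_mkord -opprB mulNr -subrX1 opprB.
  by rewrite lerBlDr lerDl exprn_ge0.
- move=> w /= h n _; apply: contrapT => hn; apply: h; exists n => k nk Ak.
  by apply: hn; exists k.
Qed.

Lemma markov_ge0 f (c : R) : measurable_fun setT f -> (forall w, 0 <= f w) ->
  0 < c -> (P [set w | (c < f w)%R] <= (c^-1)%:E * \int[P]_w (f w)%:E)%E.
Proof.
move=> mf f0 c0; have mA := measurable_gt_set c mf.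
set A := [set w | _] in mA *.
have mI : measurable_fun setT (fun w => (\1_A w)%:E : \bar R).
  by apply/measurable_EFinP; exact: measurable_indic.
have cPA : (c%:E * P A = \int[P]_w (c%:E * (\1_A w)%:E))%E.
  rewrite ge0_integralZl//; last by rewrite lee_fin ltW.
  by rewrite integral_indic// setIT.
rewrite -[P A]mul1e -[1%E]/(1%:E) -(mulVf (lt0r_neq0 c0)) EFinM -muleA.
apply: lee_wpmul2l; first by rewrite lee_fin invr_ge0 ltW.
rewrite cPA; apply: ge0_le_integral => //.
- by move=> w _; rewrite mule_ge0// lee_fin// ltW.
- exact: measurable_funeM.
- exact/measurable_EFinP.
- move=> w _; rewrite -EFinM lee_fin indicE.
  by have [/set_mem/ltW|] := boolP (w \in A); rewrite ?mulr1// mulr0.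
Qed.

Lemma msq_near (u : nat -> T -> R) (e : R) : 0 < e ->
  msq (u n) @[n --> \oo] --> 0%E -> \forall n \near \oo, (msq (u n) <= e%:E)%E.
Proof.
move=> e0 u0; have e0' : (0 < e%:E)%E by rewrite lte_fin.
have [N _ h] : \forall n \near \oo, (msq (u n) < e%:E)%E := u0 _ (open_ereal_lt' e0').
by exists N => // n /h /ltW.
Qed.

(** Indices with mean square at most [4 ^ (- k)] are chosen; Markov's inequality at level
    [2 ^ (- k)] leaves probabilities [2 ^ (- k)], and Borel-Cantelli concludes. *)
Lemma msq_cvg_ae (u : nat -> T -> R) :
  (forall n, measurable_fun setT (u n)) -> msq (u n) @[n --> \oo] --> 0%E ->
  exists s : nat -> nat, {ae P, forall w, u (s k) w @[k --> \oo] --> 0}.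
Proof.
move=> mu u0.
have ex k : exists n, (msq (u n) <= (4^-1 ^+ k)%:E)%E.
  have e0 : 0 < 4^-1 ^+ k :> R by rewrite exprn_gt0.
  by have [n _ /(_ n (leqnn n)) h] := msq_near e0 u0; exists n.
have [s us] := choice ex; exists s.
pose A k := [set w | (2^-1 ^+ k < u (s k) w ^+ 2)%R].
have mA k : measurable (A k).
  by apply: measurable_gt_set; exact: measurable_funX.
have PA k : (P (A k) <= (1 * 2^-1 ^+ k)%:E)%E.
  apply: le_trans (@markov_ge0 _ (2^-1 ^+ k) _ _ _) _; rewrite ?exprn_gt0//.
  - exact: measurable_funX.
  - by move=> w; exact: sqr_ge0.
  - rewrite -/(msq (u (s k))).
    apply: le_trans (lee_wpmul2l _ (us k)) _.
      by rewrite lee_fin invr_ge0 exprn_ge0.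
    rewrite -EFinM lee_fin mul1r -exprVn invrK -exprMn.
    by rewrite (_ : 2 * 4^-1 = 2^-1)//; lra.
apply: filterS (borel_cantelli mA _ _ PA); rewrite ?ler01//; last first.
  by rewrite invr_ge0 ler0n/= invf_lt1// ltr1n.
move=> w [K hK]; apply/cvgr0Pnorm_le => /= e e0.
have e20 : 0 < e ^+ 2 by rewrite exprn_gt0.
have := @cvg_expr R 2^-1 _; rewrite ger0_norm ?invr_ge0// invf_lt1// ltr1n.
move=> /(_ isT) /cvgr0Pnorm_le /(_ _ e20) [K' _ hK'].
exists (maxn K K') => // k /=; rewrite geq_max => /andP[Kk K'k].
rewrite -(@ler_pXn2r _ 2)// ?nnegrE ?(ltW e0)// real_normK ?num_real//.
have := hK _ Kk; rewrite /A/= => /negP; rewrite -leNgt => /le_trans; apply.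
by apply: le_trans (hK' _ K'k); exact: ler_norm.
Qed.

End squares.

(** * Integrating out one innovation given its past *)

Section innovations.
Context d (T : measurableType d) (R : realType) (P : probability T R).
Variable xi : int -> {RV P >-> R}.
Hypothesis xi_iid : iid xi.

(** The past is strict: coordinate 0 is the innovation at time [u - 1]. *)
Definition past (u : int) (w : T) : pathspace R nat :=
  fun j => xi (u - 1 - j%:Z) w.

Lemma measurable_past u : measurable_fun setT (past u).
Proof. by apply: measurable_path => i; rewrite /past. Qed.

HB.instance Definition _ u :=
  isMeasurableFun.Build _ _ _ _ (past u) (measurable_past u).

Lemma independent_past u : independent_of_path (xi u) (past u : {mfun T >-> _}).
Proof.
move=> B n C mB mC.
(* A single family of sets over all times, so that mutual independence can be used both with and
   without the time [u]. *)
pose D (t : int) := if t == u then B else C (absz (u - 1 - t)%R).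
have mD t : measurable (D t) by rewrite /D; case: ifP.
pose s := [seq u - 1 - j%:Z | j <- iota 0 n].
have us : u \notin s by apply/mapP => -[j _]; lia.
have uniq_s : uniq s.
  by rewrite map_inj_uniq ?iota_uniq// => i j; lia.
have DC j : D (u - 1 - j%:Z) = C j.
  rewrite /D ifF; last by apply/eqP; lia.
  by congr C; lia.
have E : [set w | forall j, (j < n)%N -> C j (past u w j)] =
    \bigcap_(t in [set` s]) (xi t @^-1` D t).
  apply/seteqP; split=> w /= h.
    by move=> t /mapP[j]; rewrite mem_iota => /andP[_ jn] ->; rewrite DC; exact: h.
  move=> j jn; have := h (u - 1 - j%:Z); rewrite /= DC; apply.
  by apply/mapP; exists j; rewrite ?mem_iota.
have [ind _] := xi_iid.
rewrite E (ind s D uniq_s mD).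
have := ind (u :: s) D; rewrite /= us => /(_ uniq_s mD).
have Du : D u = B by rewrite /D eqxx.
rewrite big_cons Du => <-; congr (P _); apply/seteqP; split=> w /=.
  move=> [hB h] t; rewrite /= inE => /predU1P[->|ts]; last exact: h.
  by rewrite Du.
move=> h; split; first by rewrite -Du; apply: h; rewrite /= inE eqxx.
by move=> t ts; apply: h; rewrite /= inE ts orbT.
Qed.

Lemma distribution_xi u (B : set R) : measurable B ->
  distribution P (xi u) B = distribution P (xi 0) B.
Proof. by have [_] := xi_iid; exact. Qed.

(** This takes the place of conditional expectations: the innovation at time [u] is integrated out
    under the common law while its past is frozen. *)
Lemma past_integral u (h : R * pathspace R nat -> \bar R) :
  measurable_fun setT h -> (forall z, 0 <= h z)%E ->
  (\int[P]_w h (xi u w, past u w) =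
   \int[P]_w \int[distribution P (xi 0)]_x h (x, past u w))%E.
Proof.
move=> mh h0; rewrite (independent_integral (independent_past u))//.
under eq_integral => y _.
  rewrite (eq_measure_integral (distribution P (xi 0))); last first.
    by move=> A mA _; exact: distribution_xi.
  over.
rewrite ge0_integral_distribution//.
- exact: (measurable_fun_fubini_tonelli_G (m1 := distribution P (xi 0)) h).
- by move=> y; exact: integral_ge0.
Qed.

(** Predictability up to a null set, expressed by a factorization through the past. *)
Definition past_fun (u : int) (Z : T -> R) := exists g : pathspace R nat -> R,
  measurable_fun setT g /\ {ae P, forall w, Z w = g (past u w)}.

Lemma past_fun_cst u c : past_fun u (fun=> c).
Proof. by exists (fun=> c); split => //; exact: aeW. Qed.

Lemma past_funD u Z1 Z2 : past_fun u Z1 -> past_fun u Z2 ->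
  past_fun u (fun w => Z1 w + Z2 w).
Proof.
move=> [g1 [m1 e1]] [g2 [m2 e2]]; exists (fun y => g1 y + g2 y).
split; first exact: measurable_funD.
by apply: filterS2 e1 e2 => w -> ->.
Qed.

Lemma past_funM u Z1 Z2 : past_fun u Z1 -> past_fun u Z2 ->
  past_fun u (fun w => Z1 w * Z2 w).
Proof.
move=> [g1 [m1 e1]] [g2 [m2 e2]]; exists (fun y => g1 y * g2 y).
split; first exact: measurable_funM.
by apply: filterS2 e1 e2 => w -> ->.
Qed.

Lemma past_fun_norm u Z : past_fun u Z -> past_fun u (fun w => `|Z w|).
Proof.
move=> [g [mg e]]; exists (fun y => `|g y|).
split; first exact: measurableT_comp.
by apply: filterS e => w ->.
Qed.

Lemma past_fun_sum u (I : Type) (r : seq I) (Z : I -> T -> R) :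
  (forall i, past_fun u (Z i)) -> past_fun u (fun w => \sum_(i <- r) Z i w).
Proof.
move=> pZ; elim: r => [|i r IH].
  by under [X in past_fun _ X]eq_fun do rewrite big_nil; exact: past_fun_cst.
under [X in past_fun _ X]eq_fun do rewrite big_cons.
exact: past_funD.
Qed.

Lemma past_fun_msq u (Z : nat -> T -> R) (Y : T -> R) :
  (forall n, past_fun u (Z n)) -> (forall n, measurable_fun setT (Z n)) ->
  measurable_fun setT Y ->
  msq P (fun w => Z n w - Y w) @[n --> \oo] --> 0%E ->
  past_fun u Y.
Proof.
move=> pZ mZ mY /msq_cvg_ae[n|s sY]; first exact: measurable_funB.
have [g gP] := choice pZ.
(* The upper limit is measurable on the whole path space and equals the limit along almost every
   realized past; [fine] sends infinite values to 0. *)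
pose G (y : pathspace R nat) := fine (limn_esup (fun k => (g (s k) y)%:E)).
exists G; split.
  apply: measurableT_comp; first exact: fine_measurable.
  apply: measurable_fun_limn_esup => k; apply/measurable_EFinP.
  by have [] := gP (s k).
have : {ae P, forall w, forall n, Z n w = g n (past u w)}.
  by apply/ae_foralln => n; have [] := gP n.
apply: filterS2 sY => w sY ZE; rewrite /G.
have cv : (g (s k) (past u w))%:E @[k --> \oo] --> (Y w)%:E.
  apply: cvg_EFin; first exact: nearW.
  rewrite (_ : fine \o _ = fun k => Z (s k) w); last first.
    by apply/funext => k /=; rewrite ZE.
  by apply/subr_cvg0.
by rewrite is_cvg_limn_esupE ?(cvg_lim _ cv)//; apply: cvgP cv.
Qed.

(** For a frozen past, an affine function with coefficients not both zero has at most one root, and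
    the law of the innovation gives it no mass. *)
Lemma past_affine_eq0 u Y Z :
  (forall x, P (xi 0 @^-1` [set x]) = 0%E) ->
  past_fun u Y -> past_fun u Z ->
  {ae P, forall w, Y w + Z w * xi u w = 0 -> Y w = 0 /\ Z w = 0}.
Proof.
move=> noatom [g1 [m1 e1]] [g2 [m2 e2]].
pose A := [set z : R * pathspace R nat | g1 z.2 + g2 z.2 * z.1 = 0]
  `&` ([set z | g1 z.2 <> 0] `|` [set z | g2 z.2 <> 0]).
have mg1 : measurable_fun setT (fun z : R * pathspace R nat => g1 z.2).
  exact: measurableT_comp.
have mg2 : measurable_fun setT (fun z : R * pathspace R nat => g2 z.2).
  exact: measurableT_comp.
have mA : measurable A.
  apply: measurableI.
    apply: (@measurable_eq_set _ _ _ _ (cst 0)) => //.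
    by apply: measurable_funD => //; exact: measurable_funM.
  apply: measurableU.
    rewrite (_ : [set _ | _] = ~` [set z : R * pathspace R nat | g1 z.2 = cst 0 z])//.
    by apply: measurableC; exact: measurable_eq_set.
  rewrite (_ : [set _ | _] = ~` [set z : R * pathspace R nat | g2 z.2 = cst 0 z])//.
  by apply: measurableC; exact: measurable_eq_set.
have mzA : measurable_fun setT (fun z => (\1_A z)%:E : \bar R).
  by apply/measurable_EFinP; exact: measurable_indic.
have PA : P [set w | A (xi u w, past u w)] = 0%E.
  have mxp : measurable_fun setT (fun w => (xi u w, past u w)).
    by apply: measurable_fun_pair => //; exact: measurable_past.
  have mB : measurable [set w | A (xi u w, past u w)].
    by rewrite -[X in measurable X]setTI; exact: mxp.
  transitivity (\int[P]_w (\1_A (xi u w, past u w))%:E)%E.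
    rewrite (_ : (fun w => _) = EFin \o (\1_[set w | A (xi u w, past u w)])).
      by rewrite integral_indic// setIT.
    by apply/funext => w /=; rewrite !indicE; congr (_ %:R%:E); apply/idP/idP; rewrite !inE.
  rewrite (past_integral u mzA)//.
  apply: integral0_eq => w _; set y := past u w.
  have mAy : measurable [set x | A (x, y)].
    have mxy : measurable_fun setT (fun x : R => (x, y)).
      exact: measurable_fun_pair.
    by rewrite -[X in measurable X]setTI; exact: mxy.
  transitivity (distribution P (xi 0) [set x | A (x, y)]).
    rewrite (_ : (fun x => _) = EFin \o (\1_[set x | A (x, y)])).
      by rewrite integral_indic// setIT.
    by apply/funext => x /=; rewrite !indicE; congr (_ %:R%:E); apply/idP/idP; rewrite !inE.
  apply/eqP; rewrite eq_le measure_ge0 andbT.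
  (* If [g2 y] were zero, then [g1 y] would be too, which [A] excludes; so the section of [A] lies
     in the singleton of the root. *)
  apply: (@le_trans _ _ (distribution P (xi 0) [set - g1 y / g2 y])); last first.
    by rewrite /distribution/= /pushforward noatom.
  apply: le_measure; rewrite ?inE// => x [/= h1 h2].
  have g20 : g2 y != 0.
    apply/eqP => g20; case: h2 => //; apply.
    by move: h1; rewrite g20 mul0r addr0.
  apply/eqP; rewrite eq_sym -(inj_eq (mulfI g20)) mulrCA divff// mulr1.
  by rewrite eq_sym -subr_eq0 opprK addrC h1.
have nA : {ae P, forall w, ~ A (xi u w, past u w)}.
  exists [set w | A (xi u w, past u w)]; split => //.
    have mxp : measurable_fun setT (fun w => (xi u w, past u w)).
      by apply: measurable_fun_pair => //; exact: measurable_past.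
    by rewrite -[X in measurable X]setTI; exact: mxp.
  by move=> w /= /contrapT.
apply: filterS3 e1 e2 nA => w -> -> nA h.
apply: contrapT => /not_andP hn; apply: nA; split => //=.
Qed.

Lemma past_fun_ge0 u H : past_fun u H -> (forall w, 0 <= H w) ->
  exists g : pathspace R nat -> R, [/\ measurable_fun setT g,
    (forall y, 0 <= g y) & {ae P, forall w, H w = g (past u w)}].
Proof.
move=> [g [mg e]] H0; exists (fun y => `|g y|); split => //.
  exact: measurableT_comp.
by apply: filterS e => w e; rewrite -e ger0_norm.
Qed.

Lemma past_integral_ae u (Z : T -> R) (h : R * pathspace R nat -> R) :
  measurable_fun setT Z -> measurable_fun setT h ->
  (forall w, 0 <= Z w) -> (forall z, 0 <= h z) ->
  {ae P, forall w, Z w = h (xi u w, past u w)} ->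
  (\int[P]_w (Z w)%:E =
   \int[P]_w \int[distribution P (xi 0)]_x (h (x, past u w))%:E)%E.
Proof.
move=> mZ mh Z0 h0 e.
have mxp : measurable_fun setT (fun w => (xi u w, past u w)).
  by apply: measurable_fun_pair => //; exact: measurable_past.
rewrite -(past_integral u (h := EFin \o h)); last 2 first.
- exact/measurable_EFinP.
- by move=> z; rewrite lee_fin.
apply: ge0_ae_eq_integral => //.
- exact/measurable_EFinP.
- by apply/measurable_EFinP; exact: (measurableT_comp mh mxp).
- by move=> w _; rewrite lee_fin.
- by move=> w _; rewrite lee_fin.
- by apply: filterS e => w /= -> _.
Qed.

(** Given the past, [|xi u|] is a factor of mean one. *)
Lemma integral_abs_past u (H : T -> R) :
  (\int[P]_w (`|xi 0 w|)%:E = 1)%E ->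
  measurable_fun setT H -> past_fun u H -> (forall w, 0 <= H w) ->
  (\int[P]_w (`|xi u w| * H w)%:E = \int[P]_w (H w)%:E)%E.
Proof.
move=> xi1 mH pH H0; have [g [mg g0 e]] := past_fun_ge0 pH H0.
pose h (z : R * pathspace R nat) := `|z.1| * g z.2.
have mh : measurable_fun setT h.
  by apply: measurable_funM; apply: measurableT_comp.
have h0 z : 0 <= h z by rewrite mulr_ge0.
have mZ : measurable_fun setT (fun w => `|xi u w| * H w).
  by apply: measurable_funM => //; exact: measurableT_comp.
rewrite (past_integral_ae (u := u) mZ mh)//; last 2 first.
- by move=> w; rewrite mulr_ge0.
- by apply: filterS e => w ->.
have inner w : (\int[distribution P (xi 0)]_x (h (x, past u w))%:E)%E =
    (g (past u w))%:E.
  under eq_integral do rewrite /h/= EFinM muleC.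
  have mabs : measurable_fun setT (fun x : R => (`|x|)%:E : \bar R).
    by apply/measurable_EFinP; exact: normr_measurable.
  rewrite ge0_integralZl ?lee_fin//.
  by rewrite (ge0_integral_distribution (xi 0) mabs)//= xi1 mule1.
under eq_integral do rewrite inner.
apply: ge0_ae_eq_integral => //.
- by apply/measurable_EFinP; apply: measurableT_comp => //; exact: measurable_past.
- exact/measurable_EFinP.
- by move=> w _; rewrite lee_fin.
- by move=> w _; rewrite lee_fin.
- by apply: filterS e => w /= -> _.
Qed.

Lemma integral_opp_xi (f : R -> \bar R) : symmetric_rv (xi 0) ->
  measurable_fun setT f -> (forall x, 0 <= f x)%E ->
  (\int[distribution P (xi 0)]_x f (- x)%R =
   \int[distribution P (xi 0)]_x f x)%E.
Proof.
move=> sym mf f0.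
have mN : measurable_fun setT (fun x : R => - x) by exact: oppr_measurable.
have := @ge0_integral_pushforward _ _ _ _ _ _ mN (distribution P (xi 0)) setT f
  measurableT mf (fun y _ => f0 y).
rewrite preimage_setT => <-.
by apply: eq_measure_integral => A mA _; exact: sym.
Qed.

(** Changing the sign of the innovation at time [u] alone preserves its joint law with the past;
    this is the conditional symmetry behind [sqnorm_step]. *)
Lemma past_integral_sym u (Z1 Z2 : T -> R) (h : R * pathspace R nat -> R) :
  symmetric_rv (xi 0) ->
  measurable_fun setT Z1 -> measurable_fun setT Z2 -> measurable_fun setT h ->
  (forall w, 0 <= Z1 w) -> (forall w, 0 <= Z2 w) -> (forall z, 0 <= h z) ->
  {ae P, forall w, Z1 w = h (xi u w, past u w)} ->
  {ae P, forall w, Z2 w = h (- xi u w, past u w)} ->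
  (\int[P]_w (Z1 w)%:E = \int[P]_w (Z2 w)%:E)%E.
Proof.
move=> sym m1 m2 mh Z10 Z20 h0 e1 e2.
rewrite (past_integral_ae (u := u) m1 mh)//.
have mm : measurable_fun setT (fun z : R * pathspace R nat => (- z.1, z.2)).
  by apply: measurable_fun_pair => //; apply: measurableT_comp.
have mhN : measurable_fun setT (fun z : R * pathspace R nat => h (- z.1, z.2)).
  exact: (measurableT_comp mh mm).
rewrite (past_integral_ae (u := u) m2 mhN)//.
apply: eq_integral => w _; apply/esym.
apply: (@integral_opp_xi (fun x => (h (x, past u w))%:E)) => //.
- apply/measurable_EFinP; apply: (measurableT_comp mh).
  exact: measurable_fun_pair.
- by move=> x; rewrite lee_fin.
Qed.

End innovations.

(** * Linear functionals of the past and their identification *)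

Section linear_functionals.
Context d (T : measurableType d) (R : realType) (P : probability T R).
Implicit Types (X : int -> {RV P >-> R}) (Z : T -> R) (p q : nat -> R).

Definition linear_sum X p (t : int) (N : nat) (w : T) : R :=
  p 0%N + \sum_(1 <= k < N.+1) p k * X (t - k%:Z) w.

Definition linear_of X p t Z := L2_cvg P (linear_sum X p t) Z.

Lemma L2_cvg_msq (u : nat -> T -> R) Z :
  L2_cvg P u Z <-> msq P (fun w => u n w - Z w) @[n --> \oo] --> 0%E.
Proof. by rewrite /L2_cvg unlock. Qed.

Lemma measurable_linear_sum X p t N : measurable_fun setT (linear_sum X p t N).
Proof.
apply: measurable_funD => //; apply: measurable_sum => k.
exact: measurable_funM.
Qed.

(* [tail] removes the first [n] lags but keeps the constant term: it is the
   linear functional of the past of [t - n] with coefficients [tail_coef n p]. *)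
Definition tail_coef n p k := if k == 0%N then p 0%N else p (k + n)%N.

Definition tail X n p t Z (w : T) := Z w - \sum_(1 <= k < n.+1) p k * X (t - k%:Z) w.

Lemma tail_coef0 n p : tail_coef n p 0 = p 0%N. Proof. by []. Qed.

Lemma measurable_tail X n p t Z : measurable_fun setT Z ->
  measurable_fun setT (tail X n p t Z).
Proof.
move=> mZ; apply: measurable_funB => //; apply: measurable_sum => k.
exact: measurable_funM.
Qed.

Lemma tailS X n p t Z w :
  tail X n p t Z w = tail X n.+1 p t Z w + p n.+1 * X (t - n.+1%:Z) w.
Proof. by rewrite /tail (big_nat_recr n.+1)//=; ring. Qed.

Lemma linear_sumS X p t N w :
  linear_sum X p t N.+1 w = linear_sum X p t N w + p N.+1 * X (t - N.+1%:Z) w.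
Proof. by rewrite /linear_sum (big_nat_recr N.+1)//= addrA. Qed.

Lemma linear_sum_tail X n p t N w :
  linear_sum X (tail_coef n p) (t - n%:Z) N w =
  linear_sum X p t (N + n) w - \sum_(1 <= k < n.+1) p k * X (t - k%:Z) w.
Proof.
elim: N => [|N IH].
  by rewrite /linear_sum tail_coef0 big_geq// addr0 add0n addrK.
rewrite linear_sumS IH addSn linear_sumS /tail_coef/= addrAC addSn.
by congr (_ + _ - _); congr (_ * X _ w); lia.
Qed.

Lemma linear_tail X n p t Z : linear_of X p t Z ->
  linear_of X (tail_coef n p) (t - n%:Z) (tail X n p t Z).
Proof.
rewrite /linear_of !L2_cvg_msq => h; rewrite -(cvg_shiftn n) in h.
rewrite (_ : (fun N => _) = (fun N => msq P (fun w => linear_sum X p t (N + n) w - Z w)))//.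
apply/funext => N; congr (msq P _); apply/funext => w.
by rewrite linear_sum_tail /tail; ring.
Qed.

Lemma linear_ofD X p q (c : R) t (Y Z : T -> R) :
  measurable_fun setT Y -> measurable_fun setT Z ->
  linear_of X p t Y -> linear_of X q t Z ->
  linear_of X (fun k => p k + c * q k) t (fun w => Y w + c * Z w).
Proof.
move=> mY mZ /L2_cvg_msq lY /L2_cvg_msq lZ; apply/L2_cvg_msq.
have mD r (W : T -> R) N : measurable_fun setT W ->
    measurable_fun setT (fun w => linear_sum X r t N w - W w).
  by move=> mW; apply: measurable_funB => //; exact: measurable_linear_sum.
have cv : (2%:E * msq P (fun w => linear_sum X p t n w - Y w)%R +
    2%:E * ((c ^+ 2)%:E * msq P (fun w => linear_sum X q t n w - Z w)%R))%E
    @[n --> \oo] --> 0%E.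
  rewrite [X in _ --> X](_ : _ = 2%:E * 0 + 2%:E * ((c ^+ 2)%:E * 0))%E; last first.
    by rewrite !mule0 adde0.
  by apply: cvgeD => //; repeat apply: cvgeZl => //.
apply: (squeeze_cvge _ (cvg_cst 0%E) cv); apply: nearW => n.
rewrite msq_ge0/= -msqZ; last exact: mD.
have mc : measurable_fun setT (fun w => c * (linear_sum X q t n w - Z w)).
  by apply: measurable_funM => //; exact: mD.
apply: le_trans (msq_le2D P (mD p Y n mY) mc).
rewrite le_eqVlt; apply/orP; left; apply/eqP; congr (msq P _); apply/funext => w.
rewrite /linear_sum mulrBr mulrDr mulr_sumr.
under eq_bigr do rewrite mulrDl -mulrA.
by rewrite big_split/=; ring.
Qed.

(** Up to sign, a tail without its constant term is the truncation error of the series. *)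
Lemma msq_tail X p t Z : measurable_fun setT Z -> linear_of X p t Z ->
  msq P (fun w => tail X n p t Z w - p 0%N) @[n --> \oo] --> 0%E.
Proof.
move=> mZ; rewrite /linear_of L2_cvg_msq.
rewrite (_ : (fun n => msq P (fun w => tail X n p t Z w - p 0%N)) =
  (fun n => msq P (fun w => linear_sum X p t n w - Z w)))//.
apply/funext => n; apply: eq_integral => w _; congr EFin.
by rewrite /tail /linear_sum -sqrrN; congr (_ ^+ 2); ring.
Qed.

Section larch.
Variable xi : int -> {RV P >-> R}.
Hypothesis xi_iid : iid xi.
Hypothesis xi_noatom : forall x, P (xi 0 @^-1` [set x]) = 0%E.
Variable X : int -> {RV P >-> R}.
Hypothesis X_causal : causal xi X.

Lemma past_fun_X (i u : int) : i < u -> past_fun xi u (X i).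
Proof.
have [f [mf fX]] := X_causal => iu.
(* Since [i < u], this is the gap [u - 1 - i] itself; the innovations up to time [i] are the
   coordinates of [past u] from [s] on. *)
pose s := absz (u - 1 - i)%R.
exists (fun y => f (fun j => y (s + j)%N)); split.
  have m1 : measurable_fun setT (f : pathspace R nat -> R).
    by move=> _ B mB; rewrite setTI; exact: mf.
  have m2 : measurable_fun setT (fun y : pathspace R nat =>
      (fun j => y (s + j)%N) : pathspace R nat).
    by apply: measurable_path => j; exact: measurable_coord.
  exact: (measurableT_comp m1 m2).
apply: filterS (fX i) => w ->; congr f; apply/funext => j.
by rewrite /past; congr (xi _ w); rewrite /s; lia.
Qed.

Lemma past_fun_linear p t Z : measurable_fun setT Z -> linear_of X p t Z ->
  past_fun xi t Z.
Proof.
move=> mZ /L2_cvg_msq h; apply: (past_fun_msq _ _ mZ h) => n.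
  apply: past_funD; first exact: past_fun_cst.
  rewrite [X in past_fun _ _ X](_ : _ = fun w =>
    \sum_(k <- index_iota 0 n) p k.+1 * X (t - k.+1%:Z) w); last first.
    by apply/funext => w; rewrite big_add1.
  apply: past_fun_sum => k; apply: past_funM; first exact: past_fun_cst.
  by apply: past_fun_X; lia.
exact: measurable_linear_sum.
Qed.

Variables (ps : nat -> R) (M : int -> {RV P >-> R}).
Hypothesis ps0 : ps 0%N != 0.
Hypothesis M_linear : forall t, linear_of X ps t (M t).
Hypothesis X_eq : forall t, {ae P, forall w, X t w = xi t w * M t w}.

(** As [X] is [xi] times [M], a tail is affine in the innovation at its first lag, with both
    coefficients functions of the past of that innovation. *)
Lemma tail_eq0 n p t Z : measurable_fun setT Z -> linear_of X p t Z ->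
  {ae P, forall w, tail X n p t Z w = 0 ->
    tail X n.+1 p t Z w = 0 /\ p n.+1 * M (t - n.+1%:Z) w = 0}.
Proof.
move=> mZ lZ.
have pT : past_fun xi (t - n.+1%:Z) (tail X n.+1 p t Z).
  by apply: past_fun_linear (linear_tail _ lZ); exact: measurable_tail.
have pM : past_fun xi (t - n.+1%:Z) (fun w => p n.+1 * M (t - n.+1%:Z) w).
  apply: past_funM; first exact: past_fun_cst.
  by apply: past_fun_linear (M_linear _).
apply: filterS2 (past_affine_eq0 xi_iid xi_noatom pT pM) (X_eq (t - n.+1%:Z)).
by move=> w h E; rewrite tailS E => e0; apply: h; rewrite -e0; ring.
Qed.

(** Peeling off lags preserves the vanishing of the product, while the tails converge in mean square
    to the constants [p 0] and [q 0]. Two nonzero constants are then contradictory. *)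
Lemma linear_mul_eq0 p q t (Y Z : T -> R) :
  measurable_fun setT Y -> measurable_fun setT Z ->
  linear_of X p t Y -> linear_of X q t Z ->
  {ae P, forall w, Y w * Z w = 0} -> p 0%N = 0 \/ q 0%N = 0.
Proof.
move=> mY mZ lY lZ YZ.
have tl n : {ae P, forall w, tail X n p t Y w * tail X n q t Z w = 0}.
  elim: n => [|n IH].
    by apply: filterS YZ => w; rewrite /tail !big_geq// !subr0.
  apply: filterS3 IH (tail_eq0 n mY lY) (tail_eq0 n mZ lZ) => w /eqP.
  by rewrite mulf_eq0 => /orP[/eqP e /(_ e)[-> _] _|/eqP e _ /(_ e)[-> _]];
    rewrite ?mul0r ?mulr0.
apply: contrapT => /not_orP[/eqP p0 /eqP q0].
have e0 (r : R) : r != 0 -> 0 < r ^+ 2 / 4.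
  by move=> r0; rewrite divr_gt0// exprn_even_gt0.
have [N1 _ h1] := msq_near (e0 _ p0) (msq_tail mY lY).
have [N2 _ h2] := msq_near (e0 _ q0) (msq_tail mZ lZ).
pose n := maxn N1 N2.
have {h1} := h1 n (leq_maxl _ _); have {h2} := h2 n (leq_maxr _ _).
set U := fun w => tail X n q t Z w - q 0%N; set V := fun w => tail X n p t Y w - p 0%N.
move=> hU hV.
have mU : measurable_fun setT U.
  by apply: measurable_funB => //; exact: measurable_tail.
have mV : measurable_fun setT V.
  by apply: measurable_funB => //; exact: measurable_tail.
have mc (r : R) (W : T -> R) : measurable_fun setT W ->
    measurable_fun setT (fun w => ((r * W w) ^+ 2)%:E : \bar R).
  move=> mW; apply/measurable_EFinP; apply: measurable_funX.
  exact: measurable_funM.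
(* Almost everywhere one tail is zero, and its relative deviation from its constant is -1; yet each
   of the two mean squares is at most 1/4. *)
have : (1 <= msq P (fun w => (p 0%N)^-1 * V w)%R +
    msq P (fun w => (q 0%N)^-1 * U w)%R)%E.
  rewrite -(@probability_setT _ _ _ P) -[P setT]mul1e -integral_cst//.
  rewrite /msq -ge0_integralD//; last 4 first.
  - by move=> w _; rewrite lee_fin sqr_ge0.
  - exact: mc.
  - by move=> w _; rewrite lee_fin sqr_ge0.
  - exact: mc.
  apply: ae_ge0_le_integral => //.
  - by move=> w _; rewrite adde_ge0// lee_fin sqr_ge0.
  - by apply: emeasurable_funD; exact: mc.
  apply: filterS (tl n) => w /eqP + _; rewrite -EFinD lee_fin mulf_eq0.
  case/orP => /eqP e.
    have -> : V w = - p 0%N by rewrite /V e sub0r.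
    by rewrite mulrN mulVf// sqrrN expr1n lerDl sqr_ge0.
  have -> : U w = - q 0%N by rewrite /U e sub0r.
  by rewrite [X in _ + X ^+ 2]mulrN mulVf// sqrrN expr1n lerDr sqr_ge0.
rewrite !msqZ// !exprVn.
apply/negP; rewrite -ltNge.
have bd (r : R) W : r != 0 -> (msq P W <= (r ^+ 2 / 4)%:E)%E ->
    ((r ^+ 2)^-1%:E * msq P W <= (4^-1)%:E)%E.
  move=> r0 h; apply: le_trans (lee_wpmul2l _ h) _.
    by rewrite lee_fin invr_ge0 sqr_ge0.
  by rewrite -EFinM lee_fin mulrA mulVf ?expf_neq0// mul1r.
apply: le_lt_trans (leeD (bd _ _ p0 hV) (bd _ _ q0 hU)) _.
by rewrite -EFinD lte_fin; lra.
Qed.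

(** The product of the difference [U] and the sum [V] vanishes. The constant term of [V] is nonzero,
    so that of [U] is zero, and then each lag of [U] is excluded in turn. *)
Lemma linear_ident p q t (Y Z : T -> R) :
  measurable_fun setT Y -> measurable_fun setT Z ->
  linear_of X p t Y -> linear_of X q t Z ->
  p 0%N + q 0%N != 0 ->
  {ae P, forall w, `|Y w| = `|Z w|} -> forall k, p k = q k.
Proof.
move=> mY mZ lY lZ pq0 YZ.
pose U w := Y w - Z w; pose V w := Y w + Z w.
pose u k := p k - q k; pose v k := p k + q k.
have lU : linear_of X u t U.
  rewrite (_ : u = fun k => p k + -1 * q k); last by apply/funext => k; rewrite mulN1r.
  rewrite (_ : U = fun w => Y w + -1 * Z w); last by apply/funext => k; rewrite mulN1r.
  exact: linear_ofD.
have lV : linear_of X v t V.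
  rewrite (_ : v = fun k => p k + 1 * q k); last by apply/funext => k; rewrite mul1r.
  rewrite (_ : V = fun w => Y w + 1 * Z w); last by apply/funext => k; rewrite mul1r.
  exact: linear_ofD.
have mU : measurable_fun setT U by exact: measurable_funB.
have mV : measurable_fun setT V by exact: measurable_funD.
have UV : {ae P, forall w, U w * V w = 0}.
  apply: filterS YZ => w e; rewrite /U /V -subr_sqr.
  by rewrite -(real_normK (num_real (Y w))) e real_normK ?num_real ?subrr.
have u0 : u 0%N = 0.
  by have [//|v0] := linear_mul_eq0 mU mV lU lV UV; move: pq0; rewrite -/(v 0%N) v0 eqxx.
have tl n : {ae P, forall w, tail X n u t U w * tail X n v t V w = 0}.
  elim: n => [|n IH].
    by apply: filterS UV => w; rewrite /tail !big_geq// !subr0.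
  apply: filterS3 IH (tail_eq0 n mU lU) (tail_eq0 n mV lV) => w /eqP.
  by rewrite mulf_eq0 => /orP[/eqP e /(_ e)[-> _] _|/eqP e _ /(_ e)[-> _]];
    rewrite ?mul0r ?mulr0.
case=> [|k]; first by apply/eqP; rewrite -subr_eq0 -/(u 0%N) u0.
apply/eqP; rewrite -subr_eq0 -/(u k.+1); apply/negPn/negP => uk.
have mTV : measurable_fun setT (tail X k.+1 v t V) by exact: measurable_tail.
(* Where the tail of [U] after [k] lags vanishes, so does [M], because [u k.+1] is nonzero; where
   that of [V] vanishes, so does the next tail. The constant terms [ps 0] and [v 0] of the two
   factors are nonzero, against [linear_mul_eq0]. *)
have : {ae P, forall w, M (t - k.+1%:Z) w * tail X k.+1 v t V w = 0}.
  apply: filterS3 (tl k) (tail_eq0 k mU lU) (tail_eq0 k mV lV) => w /eqP.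
  rewrite mulf_eq0 => /orP[/eqP e /(_ e)[_ /eqP uM] _|/eqP e _ /(_ e)[-> _]];
    last by rewrite mulr0.
  by move: uM; rewrite mulf_eq0 (negPf uk)/= => /eqP ->; rewrite mul0r.
move=> /(linear_mul_eq0 _ mTV (M_linear _) (linear_tail _ lV))[//||].
  by move=> /eqP; rewrite (negPf ps0).
by rewrite tail_coef0 => v0; move: pq0; rewrite -/(v 0%N) v0 eqxx.
Qed.

End larch.
End linear_functionals.

(** * Uniform bound on the remote lags *)

Section martingale_bound.
Context d (T : measurableType d) (R : realType) (P : probability T R).
Variable xi : int -> {RV P >-> R}.
Hypothesis xi_iid : iid xi.
Hypothesis xi_sym : symmetric_rv (xi 0).
Variable X : int -> {RV P >-> R}.
Hypothesis X_causal : causal xi X.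
Variable M : int -> {RV P >-> R}.
Hypothesis M_past : forall t, past_fun xi t (M t).
Hypothesis X_eq : forall t, {ae P, forall w, X t w = xi t w * M t w}.
Variable s2 : R.
Hypothesis X_msq : forall t, (msq P (X t) <= s2%:E)%E.

Lemma measurable_sqnorm d' (S : measurableType d') (I : finType) q (f : I -> S -> R) :
  (forall i, measurable_fun setT (f i)) ->
  measurable_fun setT (fun x => sqnorm q (fun i => f i x)).
Proof.
move=> mf.
have ms : measurable_fun setT (fun x => \sum_i f i x ^+ (2 * q)).
  by apply: measurable_sum => i; exact: measurable_funX.
exact: (measurableT_comp (measurable_powR q%:R^-1) ms).
Qed.

(** The equality of the integrals of [f1] and [f2] turns a two-point smoothness inequality into a
    bound on one of the points. *)
Lemma integral_le_average (f1 f2 g h : T -> R) (k : R) :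
  measurable_fun setT f1 -> measurable_fun setT f2 ->
  measurable_fun setT g -> measurable_fun setT h ->
  (forall w, 0 <= f1 w) -> (forall w, 0 <= f2 w) ->
  (forall w, 0 <= g w) -> (forall w, 0 <= h w) -> 0 <= k ->
  (\int[P]_w (f1 w)%:E = \int[P]_w (f2 w)%:E)%E ->
  (forall w, f1 w + f2 w <= 2 * (g w + k * h w)) ->
  (\int[P]_w (f1 w)%:E <= \int[P]_w (g w)%:E + k%:E * \int[P]_w (h w)%:E)%E.
Proof.
move=> mf1 mf2 mg mh f10 f20 g0 h0 k0 E12 le12.
have mkh : measurable_fun setT (fun w => k * h w) by exact: measurable_funM.
have kh0 w : 0 <= k * h w by rewrite mulr_ge0.
have mgh : measurable_fun setT (fun w => g w + k * h w) by exact: measurable_funD.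
have gh0 w : 0 <= g w + k * h w by rewrite addr_ge0.
have m2gh : measurable_fun setT (fun w => 2 * (g w + k * h w)).
  exact: measurable_funM.
have m12 : measurable_fun setT (fun w => f1 w + f2 w) by exact: measurable_funD.
have two0 : (0 < 2%:E :> \bar R)%E by rewrite lte_fin.
rewrite -(ge0_integral_EFinZ P mh h0 k0) -(ge0_integral_EFinD P mg mkh g0 kh0).
rewrite -(@lee_pmul2l _ 2%:E)// -(ge0_integral_EFinZ P mgh gh0)//.
rewrite mule_natl mule2n {2}E12 -(ge0_integral_EFinD P mf1 mf2 f10 f20).
by apply: ge0_le_integral_EFin => // w; rewrite addr_ge0.
Qed.

(** Flipping the sign of the innovation exchanges [S + X u * e] and [S - X u * e], since [S] and
    [M u] depend on the past only. The two expected squared norms agree, and 2-smoothness leaves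
    only a second-order term. *)
Lemma sqnorm_step (I : finType) q u (S : I -> T -> R) (e : I -> R) :
  (forall i, measurable_fun setT (S i)) -> (forall i, past_fun xi u (S i)) ->
  (\int[P]_w (sqnorm q.+1 (fun i => S i w + X u w * e i))%:E <=
   \int[P]_w (sqnorm q.+1 (fun i => S i w))%:E +
   ((4 * q.+1 + 1)%:R * sqnorm q.+1 e * s2)%:E)%E.
Proof.
move=> mS pS; set K := (4 * q.+1 + 1)%:R.
have K0 : 0 <= K by rewrite ler0n.
have [G GP] := choice pS; have [gM [mgM eM]] := M_past u.
have mX : measurable_fun setT (X u) by [].
pose Z (c : R) w := sqnorm q.+1 (fun i => S i w + c * (X u w * e i)).
pose h (z : R * pathspace R nat) :=
  sqnorm q.+1 (fun i => G i z.2 + (z.1 * gM z.2) * e i).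
have mZ c : measurable_fun setT (Z c).
  apply: (@measurable_sqnorm _ _ _ _ (fun i w => S i w + c * (X u w * e i))) => i.
  by apply: measurable_funD => //; apply: measurable_funM => //; exact: measurable_funM.
have mh : measurable_fun setT h.
  apply: (@measurable_sqnorm _ _ _ _ (fun i (z : R * pathspace R nat) =>
    G i z.2 + (z.1 * gM z.2) * e i)) => i.
  have [mG _] := GP i.
  apply: measurable_funD; first exact: measurableT_comp.
  by apply: measurable_funM => //; apply: measurable_funM => //; exact: measurableT_comp.
have eG : {ae P, forall w, forall i, S i w = G i (past xi u w)}.
  by apply: filter_forall => i; have [] := GP i.
have E12 : (\int[P]_w (Z 1 w)%:E = \int[P]_w (Z (-1) w)%:E)%E.
  apply: (past_integral_sym (u := u) xi_iid xi_sym (mZ _) (mZ _) mh).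
  - by move=> w; exact: sqnorm_ge0.
  - by move=> w; exact: sqnorm_ge0.
  - by move=> w; exact: sqnorm_ge0.
  - apply: filterS3 eG eM (X_eq u) => w eS em ex; rewrite /Z /h /=.
    by congr sqnorm; apply/funext => i; rewrite eS ex em mul1r.
  - apply: filterS3 eG eM (X_eq u) => w eS em ex; rewrite /Z /h /=.
    by congr sqnorm; apply/funext => i; rewrite eS ex em mulN1r !mulNr.
have mSn : measurable_fun setT (fun w => sqnorm q.+1 (fun i => S i w)).
  exact: measurable_sqnorm.
have mX2 : measurable_fun setT (fun w => X u w ^+ 2) by exact: measurable_funX.
pose k := K * sqnorm q.+1 e.
have k0 : 0 <= k by rewrite mulr_ge0 ?sqnorm_ge0.
have Z0 c w : 0 <= Z c w by exact: sqnorm_ge0.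
have S0 w : 0 <= sqnorm q.+1 (fun i => S i w) by exact: sqnorm_ge0.
have X20 w : 0 <= X u w ^+ 2 by exact: sqr_ge0.
have Zle w : Z 1 w + Z (-1) w <= 2 * (sqnorm q.+1 (fun i => S i w) + k * X u w ^+ 2).
  have := sqnorm_smooth q (fun i => S i w) (fun i => X u w * e i).
  rewrite sqnormZ -/K [X u w ^+ 2 * _]mulrC [K * (_ * _)]mulrA -/k.
  apply: le_trans; rewrite le_eqVlt; apply/orP; left; apply/eqP.
  by congr (_ + _); congr sqnorm; apply/funext => i; rewrite ?mul1r ?mulN1r.
have := integral_le_average (mZ 1) (mZ (-1)) mSn mX2 (Z0 1) (Z0 (-1)) S0 X20 k0 E12 Zle.
rewrite (_ : (\int[P]_w (Z 1 w)%:E)%E =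
  (\int[P]_w (sqnorm q.+1 (fun i => S i w + X u w * e i)%R)%:E)%E); last first.
  apply: eq_integral => w _; rewrite /Z; congr (sqnorm _ _)%:E.
  by apply/funext => i; rewrite mul1r.
have k0' : (0 <= k%:E)%E by rewrite lee_fin.
rewrite EFinM -/k => /le_trans; apply.
exact: (leeD2l _ (lee_wpmul2l k0' (X_msq u))).
Qed.

(** By [sqnorm_step], each time costs at most the constant [C], so the bound is linear in [n], as
    for orthogonal increments. *)
Lemma sqnorm_sum_le (I : finType) q (s : int) n (e : nat -> I -> R) :
  (forall j i, `|e j i| <= 1) ->
  (\int[P]_w (sqnorm q.+1 (fun i => (\sum_(j < n) X (s + j%:Z) w * e j i)%R))%:E <=
   (n%:R * ((4 * q.+1 + 1)%:R * nroot q.+1 #|I|%:R * s2))%:E)%E.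
Proof.
move=> e1; set C := (_ * _ * s2).
have s20 : 0 <= s2.
  by rewrite -lee_fin; apply: le_trans (X_msq 0); exact: msq_ge0.
have mS k i : measurable_fun setT (fun w => \sum_(j < k) X (s + j%:Z) w * e j i).
  by apply: measurable_sum => j; exact: measurable_funM.
elim: n => [|n IH].
  rewrite mul0r integral0_eq// => w _; congr EFin.
  rewrite /sqnorm big1 => [|i _]; last by rewrite big_ord0 exprM expr0n/= expr0n.
  by rewrite /nroot powR0// invr_eq0.
under eq_integral => w _.
  rewrite (_ : (fun i => _) = fun i =>
    (\sum_(j < n) X (s + j%:Z) w * e j i) + X (s + n%:Z) w * e n i); last first.
    by apply/funext => i; rewrite big_ord_recr.
  over.
apply: le_trans (sqnorm_step _ _ (mS n) _) _ => [i|].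
  rewrite [X in past_fun _ _ X](_ : _ = fun w =>
      \sum_(j <- index_enum 'I_n) (if (j < n)%N then X (s + j%:Z) w * e j i else 0)).
    apply: past_fun_sum => j; rewrite ltn_ord.
    apply: past_funM; last exact: past_fun_cst.
    by apply: past_fun_X => //; have := ltn_ord j; lia.
  by apply/funext => w; apply: eq_bigr => j _; rewrite ltn_ord.
rewrite -natr1 mulrDl mul1r EFinD leeD// lee_fin /C.
by rewrite ler_wpM2r// ler_wpM2l// sqnorm_le_card.
Qed.

End martingale_bound.

(** * Deterministic bounds for dyadic blocks of lags *)

Section dyadic_blocks.
Context {R : realType}.
Implicit Types (x c : nat -> R).

(** The lags from [m] to [2 * m - 1]. Without the guard, the truncated subtraction would read [x 0]
    at every lag beyond [t]. *)
Definition block c x m t :=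
  \sum_(j < m) (if (m + j <= t)%N then c (m + j)%N * x (t - (m + j))%N else 0).

(* Dominates, at the frequencies [k / (2m)], the periodogram of the [v]-th
   segment of length [m] padded with [m] zeros; the boolean selects cosine or
   sine. *)
Definition segment_energy q m x v : R :=
  sqnorm q.+1 (fun i : 'I_(2 * m) * bool =>
    \sum_(j < m) x (v * m + j)%N *
      (if i.2 then cos (j%:R * (i.1%:R * (2 * pi / (2 * m)%:R)))
       else sin (j%:R * (i.1%:R * (2 * pi / (2 * m)%:R))))).

Lemma sum_segments (F : nat -> R) V m :
  \sum_(v < V) \sum_(i < m) F (v * m + i)%N = \sum_(l < V * m) F l.
Proof.
elim: V => [|V IH]; first by rewrite !big_ord0.
rewrite big_ord_recr/= IH -!(big_mkord xpredT F) mulSn addnC.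
rewrite (@big_cat_nat _ _ _ (V * m) 0 (V * m + m))//= ?leq_addr//.
congr +%R; rewrite -[X in \sum_(X <= _ < _) _]add0n big_addn addKn big_mkord.
by apply: eq_bigr => i _; rewrite addnC.
Qed.

(** Sorting the sample indices by segment turns the block into a sum of shifted convolutions. *)
Lemma block_segments c x m t n : (0 < m)%N -> (t < n)%N ->
  block c x m t = \sum_(v < n %/ m) (if (v * m + m <= t)%N then
    convolution m (fun j => c (m + j)%N) (fun i => x (v * m + i)%N) (t - (v * m + m)) else 0).
Proof.
move=> m0 tn; pose F j l := if (l + j + m == t)%N then c (m + j)%N * x l else 0.
transitivity (\sum_(v < n %/ m) \sum_(j < m) \sum_(i < m) F j (v * m + i)%N); last first.
  apply: eq_bigr => v _; case: ifPn => vt.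
    apply: eq_bigr => j _; apply: eq_bigr => i _; rewrite /F.
    by congr (if _ then _ else _); apply/eqP/eqP; lia.
  rewrite big1// => j _; rewrite big1// => i _; rewrite /F ifF//.
  by apply/negbTE/eqP; lia.
rewrite exchange_big; apply: eq_bigr => j _ /=.
rewrite (sum_segments (F j)); case: ifPn => jt.
  (* A lag of at least [m] never reaches into the incomplete last segment. *)
  have lV : (t - (m + j) < n %/ m * m)%N.
    by have := divn_eq n m; have := ltn_pmod n m0; lia.
  rewrite (bigD1 (Ordinal lV))//= big1 ?addr0 => [|l ll].
    by rewrite /F ifT//; apply/eqP; lia.
  rewrite /F ifF//; apply: contraNF ll => /eqP e; apply/eqP/val_inj => /=; lia.
rewrite big1// => l _; rewrite /F ifF//; apply/negbTE/eqP; lia.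
Qed.

(* A time [t] meets the convolutions of at most two consecutive segments. *)
Lemma sqr_sum_two V (z : nat -> R) a b :
  (forall v, (v < V)%N -> v != a -> v != b -> z v = 0) ->
  (\sum_(v < V) z v) ^+ 2 <= 2 * \sum_(v < V) z v ^+ 2.
Proof.
move=> z0.
have one (Q : pred nat) a' : (forall v, (v < V)%N -> Q v -> v != a' -> z v = 0) ->
    (\sum_(v < V | Q v) z v) ^+ 2 = \sum_(v < V | Q v) z v ^+ 2.
  move=> h; have [aV|aV] := ltnP a' V; last first.
    rewrite !big1 ?expr0n// => v Qv; rewrite (h v)// ?expr0n//.
      by apply: contraTneq (ltn_ord v) => ->; rewrite -leqNgt.
    by apply: contraTneq (ltn_ord v) => ->; rewrite -leqNgt.
  have [Qa|Qa] := boolP (Q a'); last first.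
    rewrite !big1 ?expr0n// => v Qv; rewrite (h v)// ?expr0n//.
      by apply: contraNneq Qa => <-.
    by apply: contraNneq Qa => <-.
  have s (f : nat -> R) : (forall v, (v < V)%N -> Q v -> v != a' -> f v = 0) ->
      \sum_(v < V | Q v) f v = f a'.
    move=> h'; rewrite (bigD1 (Ordinal aV))//= big1 ?addr0// => v /andP[Qv va].
    exact: h'.
  by rewrite (s z)// (s (fun v => z v ^+ 2))// => v vV Qv va; rewrite h ?expr0n.
rewrite (bigID (fun v : 'I_V => nat_of_ord v == a))/=.
rewrite [in X in _ <= X](bigID (fun v : 'I_V => nat_of_ord v == a))/=.
rewrite -(one (pred1 a) a) => [|v _ /= -> //].
rewrite -(one (fun v => v != a) b) => [|v vV va vb]; last exact: z0.
set p := \sum_(v < V | _) _; set r := \sum_(v < V | _) _.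
have := sqr_ge0 (p - r); nra.
Qed.

Lemma convolution_out m c x r : (2 * m <= r)%N -> convolution m c x r = 0.
Proof.
move=> mr; rewrite /convolution big1// => j _; rewrite big1// => i _.
by rewrite ifF//; apply/negbTE/eqP; have := ltn_ord i; have := ltn_ord j; lia.
Qed.

Lemma sum_shift_le (G : nat -> R) s n m : (forall r, 0 <= G r) ->
  (forall r, (m <= r)%N -> G r = 0) ->
  \sum_(t < n) (if (s <= t)%N then G (t - s)%N else 0) <= \sum_(r < m) G r.
Proof.
move=> G0 Gm.
have -> : \sum_(t < n) (if (s <= t)%N then G (t - s)%N else 0) = \sum_(r < n - s) G r.
  elim: n => [|n IH]; first by rewrite sub0n !big_ord0.
  rewrite big_ord_recr/= IH; case: leqP => sn; first by rewrite subSn// big_ord_recr.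
  have -> : (n.+1 - s = 0)%N by lia.
  have -> : (n - s = 0)%N by lia.
  by rewrite big_ord0 addr0.
have [nm|mn] := leqP (n - s) m.
  rewrite (@big_ord_widen _ _ _ (n - s) m G)// [X in X <= _]big_mkcond/=.
  by apply: ler_sum => r _; case: ifP.
rewrite [X in _ <= X](@big_ord_widen _ _ _ m (n - s) G) ?(ltnW mn)//.
rewrite [X in _ <= X]big_mkcond/=.
by apply: ler_sum => r _; case: ltnP => // /Gm ->.
Qed.

Lemma segment_energy_bound q m x v k : (k < 2 * m)%N ->
  cos_sum (2 * m) m (fun i => x (v * m + i)%N) k ^+ 2 +
  sin_sum (2 * m) m (fun i => x (v * m + i)%N) k ^+ 2 <= 2 * segment_energy q m x v.
Proof.
move=> km; rewrite mulr_natl mulr2n /segment_energy; apply: lerD.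
  exact: (sqnorm_ge q _ (Ordinal km, true)).
exact: (sqnorm_ge q _ (Ordinal km, false)).
Qed.

(** Each convolution is bounded by Parseval with [N = 2 * m]. In the constant 4, one factor 2 comes
    from the overlap of two segments and the other from adding cosine and sine. *)
Lemma sum_block_le q c x m n (b : R) : (0 < m)%N ->
  (forall j, (j < m)%N -> `|c (m + j)%N| <= b) ->
  \sum_(t < n) block c x m t ^+ 2 <=
  4 * m%:R * b ^+ 2 * \sum_(v < n %/ m) segment_energy q m x v.
Proof.
move=> m0 cb.
pose cv v := convolution m (fun j => c (m + j)%N) (fun i => x (v * m + i)%N).
pose Z v t := if (v * m + m <= t)%N then cv v (t - (v * m + m))%N else 0.
apply: (@le_trans _ _ (\sum_(t < n) 2 * \sum_(v < n %/ m) Z v t ^+ 2)).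
  apply: ler_sum => t _; rewrite (block_segments _ _ m0 (ltn_ord t)).
  (* A convolution lives on [2 * m] indices starting at time [v * m + m], so at time [t] only these
     two values of [v] can contribute. *)
  apply: (@sqr_sum_two _ (fun v => Z v t) (t %/ m - 1)%N (t %/ m - 2)%N) => v _ v1 v2.
  rewrite /Z; case: ifPn => // vt; apply: convolution_out.
  have := divn_eq t m; have := ltn_pmod t m0.
  move: v1 v2; set D := (t %/ m)%N; set r := (t %% m)%N => v1 v2 rm tE.
  have vD : (v.+1 <= D)%N by rewrite -ltnS; nia.
  have : (v.+3 <= D)%N by move/eqP: v1; move/eqP: v2; lia.
  by move=> h; nia.
rewrite -mulr_sumr exchange_big/=.
rewrite [X in _ <= X](_ : _ =
  2 * (\sum_(v < n %/ m) 2 * segment_energy q m x v * (m%:R * b ^+ 2))); last first.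
  by rewrite -mulr_suml -mulr_sumr; ring.
rewrite ler_wpM2l//; apply: ler_sum => v _.
apply: (@le_trans _ _ (\sum_(r < 2 * m) cv v r ^+ 2)).
  rewrite [X in X <= _](_ : _ = \sum_(t < n) (if (v * m + m <= t)%N then
      cv v (t - (v * m + m))%N ^+ 2 else 0)).
    apply: (@sum_shift_le (fun r => cv v r ^+ 2)) => r; first exact: sqr_ge0.
    by move=> h; rewrite /cv convolution_out// expr0n.
  by apply: eq_bigr => t _; rewrite /Z; case: ifP; rewrite ?expr0n.
have N0 : (0 < 2 * m)%N by rewrite muln_gt0.
have := convolution_le N0 (fun j => c (m + j)%N) (leqnn _)
  (@segment_energy_bound q m x v).
move=> /le_trans; apply.
rewrite ler_wpM2l ?mulr_ge0 ?sqnorm_ge0// mulr_natl -[X in _ *+ X](card_ord m) -sumr_const.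
apply: ler_sum => j _; rewrite -real_normK ?num_real// lerXn2r ?nnegrE//.
  exact: le_trans (normr_ge0 _) (cb j (ltn_ord j)).
exact: cb.
Qed.

(** Cauchy-Schwarz with weights, from the squares [(w k * y l - w l * y k) ^ 2 / (w k * w l)] summed
    over all pairs. *)
Lemma sqr_sum_weight n (y w : nat -> R) : (forall k, 0 < w k) ->
  (\sum_(k < n) y k) ^+ 2 <= (\sum_(k < n) w k) * (\sum_(k < n) y k ^+ 2 / w k).
Proof.
move=> w0.
have A : (\sum_(k < n) y k) ^+ 2 = \sum_(k < n) \sum_(l < n) y k * y l.
  by rewrite expr2 mulr_suml; apply: eq_bigr => k _; rewrite mulr_sumr.
have B : (\sum_(k < n) w k) * (\sum_(k < n) y k ^+ 2 / w k) =
    \sum_(k < n) \sum_(l < n) w k * (y l ^+ 2 / w l).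
  by rewrite mulr_suml; apply: eq_bigr => k _; rewrite mulr_sumr.
have B' : (\sum_(k < n) w k) * (\sum_(k < n) y k ^+ 2 / w k) =
    \sum_(k < n) \sum_(l < n) w l * (y k ^+ 2 / w k) by rewrite B exchange_big.
suff : 2 * (\sum_(k < n) \sum_(l < n) y k * y l) <=
    (\sum_(k < n) \sum_(l < n) w k * (y l ^+ 2 / w l)) +
    (\sum_(k < n) \sum_(l < n) w l * (y k ^+ 2 / w k)).
  by rewrite -B -B' -A; lra.
rewrite mulr_sumr -big_split; apply: ler_sum => k _ /=.
rewrite mulr_sumr -big_split; apply: ler_sum => l _ /=.
have h : 0 <= (w k * y l - w l * y k) ^+ 2 / (w k * w l).
  by rewrite divr_ge0 ?sqr_ge0// mulr_ge0 ?ltW.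
rewrite -subr_ge0; apply: le_trans h _; rewrite le_eqVlt; apply/orP; left; apply/eqP.
by field; rewrite !gt_eqF.
Qed.

Lemma tail_blocks c x K t : \sum_(2 ^ K <= j < t.+1) c j * x (t - j)%N =
  \sum_(k < t.+1) block c x (2 ^ (K + k)) t.
Proof.
have H n : \sum_(k < n) block c x (2 ^ (K + k)) t =
    \sum_(2 ^ K <= j < 2 ^ (K + n)) (if (j <= t)%N then c j * x (t - j)%N else 0).
  elim: n => [|n IH]; first by rewrite big_ord0 addn0 big_geq.
  rewrite big_ord_recr/= IH (@big_cat_nat _ _ _ (2 ^ (K + n)) (2 ^ K) (2 ^ (K + n.+1)))/=.
  - congr +%R; rewrite /block -[X in \sum_(X <= _ < _) _]add0n big_addn.
    rewrite addnS expnS mul2n -addnn addnK big_mkord.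
    by apply: eq_bigr => j _; rewrite addnC.
  - by rewrite leq_exp2l// leq_addr.
  - by rewrite leq_exp2l// leq_add2l.
rewrite H; set f := fun j => c j * x (t - j)%N.
(* So [t + 1] blocks are enough to reach every lag up to [t]. *)
have tle : (t.+1 <= 2 ^ (K + t.+1))%N.
  by apply: leq_trans (ltnW (ltn_expl _ (ltnSn 1))) _; rewrite leq_exp2l// leq_addl.
have z (a b : nat) : (t < a)%N -> \sum_(a <= j < b) (if (j <= t)%N then f j else 0) = 0.
  move=> ta; rewrite big_nat_cond big1// => j /andP[/andP[aj _] _].
  by rewrite ifF//; apply/negbTE; rewrite -ltnNge (leq_trans ta).
have [Kt|tK] := leqP (2 ^ K) t.+1; last first.
  by rewrite (z (2 ^ K)%N) ?big_geq// ltnW// ltnW.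
rewrite [RHS](@big_cat_nat _ _ _ t.+1)//= (z _ _ (ltnSn t)) addr0.
by apply: eq_big_nat => j /andP[_]; rewrite ltnS => ->.
Qed.

(** Cauchy-Schwarz over the blocks with weights [rho ^ (K + k)], the decay rate of the block norms,
    leaves the same geometric series in both factors. *)
Lemma sum_tail_le c x K n (A rho : R) : 0 < rho < 1 -> 0 <= A ->
  (forall k, (K <= k)%N ->
     \sum_(t < n) block c x (2 ^ k) t ^+ 2 <= n%:R * A * (rho ^+ k) ^+ 2) ->
  \sum_(t < n) (\sum_(2 ^ K <= j < t.+1) c j * x (t - j)%N) ^+ 2 <=
  n%:R * A * (rho ^+ K / (1 - rho)) ^+ 2.
Proof.
move=> /andP[r0 r1] A0 hK.
have r10 : 0 < 1 - rho by rewrite subr_gt0.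
pose w k := rho ^+ (K + k).
have w0 k : 0 < w k by rewrite exprn_gt0.
have W : \sum_(k < n) w k <= rho ^+ K / (1 - rho).
  rewrite ler_pdivlMr// /w; under eq_bigr do rewrite exprD.
  rewrite -mulr_sumr -mulrA; apply: ler_piMr; first by rewrite exprn_ge0// ltW.
  rewrite mulrC -opprB mulNr -subrX1 opprB.
  by rewrite lerBlDr lerDl exprn_ge0// ltW.
have W0 : 0 <= \sum_(k < n) w k by apply: sumr_ge0 => k _; exact: ltW.
apply: (@le_trans _ _ (\sum_(t < n) (\sum_(k < n) w k) *
    (\sum_(k < n) block c x (2 ^ (K + k)) t ^+ 2 / w k))).
  apply: ler_sum => t _.
  apply: (le_trans _ (@sqr_sum_weight n (fun k => block c x (2 ^ (K + k)) t) w w0)).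
  (* A common range of [n] blocks serves every [t < n]: the added blocks begin beyond lag [t] and
     vanish. *)
  rewrite tail_blocks (@big_ord_widen _ _ _ t.+1 n (fun k => block c x (2 ^ (K + k)) t))//.
  rewrite big_mkcond/= le_eqVlt; apply/orP; left; apply/eqP; congr (_ ^+ 2).
  apply: eq_bigr => k _; case: ltnP => // tk.
  rewrite /block big1// => j _; rewrite ifF//; apply/negbTE; rewrite -ltnNge.
  have := ltn_expl k (ltnSn 1); have : (2 ^ k <= 2 ^ (K + k))%N.
    by rewrite leq_exp2l// leq_addl.
  by move: tk; lia.
rewrite -mulr_sumr exchange_big/=.
have step k : \sum_(t < n) block c x (2 ^ (K + k)) t ^+ 2 / w k <= n%:R * A * w k.
  rewrite -mulr_suml ler_pdivrMr//.
  by apply: le_trans (hK _ (leq_addr _ _)) _; rewrite -/(w k) expr2 mulrA.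
apply: (@le_trans _ _ ((\sum_(k < n) w k) * \sum_(k < n) n%:R * A * w k)).
  by rewrite ler_wpM2l//; apply: ler_sum => k _; exact: step.
rewrite -mulr_sumr mulrCA expr2; apply: ler_wpM2l; first by rewrite mulr_ge0.
by apply: ler_pM.
Qed.

End dyadic_blocks.

(** * The law of the trajectory and its shifts *)

Section process_law.
Context d (T : measurableType d) (R : realType) (P : probability T R).
Variable X : int -> {RV P >-> R}.

Definition trajectory (w : T) : pathspace R int := fun t => X t w.

Lemma measurable_trajectory : measurable_fun setT trajectory.
Proof. by apply: measurable_path => t; rewrite /trajectory. Qed.

HB.instance Definition _ :=
  isMeasurableFun.Build _ _ _ _ trajectory measurable_trajectory.

Definition shift (h : int) (x : pathspace R int) : pathspace R int :=
  fun t => x (t + h).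

Lemma measurable_shift h : measurable_fun setT (shift h).
Proof. by apply: measurable_path => t; exact: measurable_coord. Qed.

Lemma iter_shift (h : int) n x : iter n (shift h) x = fun t => x (t + h *+ n).
Proof.
elim: n => [|n IH] /=; first by apply/funext => t; rewrite mulr0n addr0.
by rewrite IH; apply/funext => t; rewrite /shift; congr x; rewrite mulrSr; ring.
Qed.

Definition law : probability (pathspace R int) R := distribution P trajectory.

Lemma integral_law (g : pathspace R int -> \bar R) :
  measurable_fun setT g -> (forall x, 0 <= g x)%E ->
  (\int[law]_x g x = \int[P]_w g (trajectory w))%E.
Proof. by move=> mg g0; rewrite ge0_integral_distribution. Qed.

Hypothesis X_stat : strictly_stationary X.

Lemma law_shift h A : measurable A -> law (shift h @^-1` A) = law A.
Proof. by move=> mA; have := X_stat h mA. Qed.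

Lemma msq_stationary t : msq P (X t) = msq P (X 0).
Proof.
pose g (x : pathspace R int) : \bar R := (x 0 ^+ 2)%:E.
have mg : measurable_fun setT g.
  by apply/measurable_EFinP; apply: measurable_funX; exact: measurable_coord.
have g0 x : (0 <= g x)%E by rewrite lee_fin sqr_ge0.
rewrite -[RHS](integral_law mg g0).
have mgt : measurable_fun setT (g \o shift t).
  by apply: measurableT_comp => //; exact: measurable_shift.
have E : msq P (X t) = (\int[law]_x (g \o shift t) x)%E.
  rewrite (integral_law mgt (fun x => g0 _)); apply: eq_integral => w _.
  by rewrite /g /= /shift /trajectory add0r.
have mS := measurable_shift t.
have := @ge0_integral_pushforward _ _ _ _ _ _ mS law setT g
  measurableT mg (fun y _ => g0 y).
rewrite preimage_setT E => <-; apply: eq_measure_integral => // A mA _.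
exact: law_shift.
Qed.

Lemma ae_law (Q : pathspace R int -> Prop) :
  {ae law, forall x, Q x} -> {ae P, forall w, Q (trajectory w)}.
Proof.
move=> [N [mN N0 QN]]; exists (trajectory @^-1` N); split => //.
  by rewrite -[_ @^-1` _]setTI; exact: measurable_trajectory.
by move=> w /= hw; apply: QN.
Qed.

End process_law.

(** * Almost sure smallness of the remote lags *)

Section tail_bound.
Context d (T : measurableType d) (R : realType) (P : probability T R).
Variable xi : int -> {RV P >-> R}.
Hypothesis xi_iid : iid xi.
Hypothesis xi_sym : symmetric_rv (xi 0).
Variable X : int -> {RV P >-> R}.
Hypothesis X_stat : strictly_stationary X.
Hypothesis X_causal : causal xi X.
Variable M : int -> {RV P >-> R}.
Hypothesis M_past : forall t, past_fun xi t (M t).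
Hypothesis X_eq : forall t, {ae P, forall w, X t w = xi t w * M t w}.
Variable s2 : R.
Hypothesis X_msq : forall t, (msq P (X t) <= s2%:E)%E.

Let sample (w : T) (i : nat) : R := X i.+1%:Z w.

(** The energies of successive segments are the values of one functional along the shift by [m],
    which preserves the law. The maximal inequality thus needs only the expected energy of one
    segment. *)
Lemma segment_energy_maximal q m (r : R) : 0 < r ->
  (P [set w | exists n, (r *+ n < \sum_(v < n) segment_energy q m (sample w) v)%R] <=
   (r^-1 * (m%:R * ((4 * q.+1 + 1)%:R * nroot q.+1 (4 * m)%:R * s2)))%:E)%E.
Proof.
move=> r0.
pose e (j : nat) (i : 'I_(2 * m) * bool) : R :=
  if i.2 then cos (j%:R * (i.1%:R * (2 * pi / (2 * m)%:R)))
  else sin (j%:R * (i.1%:R * (2 * pi / (2 * m)%:R))).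
pose g (x : pathspace R int) : R :=
  sqnorm q.+1 (fun i => \sum_(j < m) x (1 + j%:Z) * e j i).
have mg : measurable_fun setT g.
  apply: (@measurable_sqnorm _ _ _ _ _ (fun i (x : pathspace R int) =>
    \sum_(j < m) x (1 + j%:Z) * e j i)) => i.
  apply: measurable_sum => j; apply: measurable_funM => //.
  exact: measurable_coord.
have g0 x : 0 <= g x by exact: sqnorm_ge0.
have Eg : (\int[law X]_x (g x)%:E <=
    (m%:R * ((4 * q.+1 + 1)%:R * nroot q.+1 (4 * m)%:R * s2))%:E)%E.
  rewrite integral_law; last 2 first.
  - exact/measurable_EFinP.
  - by move=> x; rewrite lee_fin.
  have e1 j i : `|e j i| <= 1.
    by rewrite /e; case: ifP => _; [exact: cos_max|exact: sin_max].
  have := sqnorm_sum_le xi_iid xi_sym X_causal M_past X_eq X_msq q 1 m e1.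
  (* There are [2 * m] frequencies, each with a cosine and a sine. *)
  by rewrite card_prod card_ord card_bool (_ : (2 * m * 2 = 4 * m)%N); last lia.
have gi : (law X).-integrable setT (EFin \o g).
  apply/integrableP; split; first exact/measurable_EFinP.
  under eq_integral do rewrite gee0_abs ?lee_fin//.
  exact: le_lt_trans Eg (ltry _).
have mT := @measurable_shift R (m%:Z).
have Tmu := law_shift X_stat (m%:Z).
have max := maximal_inequality mT Tmu r0 g0 gi.
have bE n w : birkhoff (shift (m%:Z)) g n (trajectory X w) =
    \sum_(v < n) segment_energy q m (sample w) v.
  rewrite /birkhoff big_mkord; apply: eq_bigr => v _; rewrite iter_shift.
  congr sqnorm; apply/funext => i; apply: eq_bigr => j _.
  by congr (X _ w * _); lia.
have -> : [set w | exists n, r *+ n < \sum_(v < n) segment_energy q m (sample w) v] =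
    trajectory X @^-1` [set x | exists n, r *+ n < birkhoff (shift (m%:Z)) g n x].
  by apply/seteqP; split=> w /= [n]; rewrite ?bE => h; exists n; rewrite ?bE.
apply: le_trans max _.
rewrite lee_fin ler_wpM2l ?invr_ge0 ?(ltW r0)// -lee_fin /Rintegral fineK//.
exact: (integrable_fin_num measurableT gi).
Qed.

Lemma measurable_segment_energy q m v :
  measurable_fun setT (fun w => segment_energy q m (sample w) v).
Proof.
apply: (@measurable_sqnorm _ _ _ _ _ (fun (i : 'I_(2 * m) * bool) w =>
  \sum_(j < m) X (v * m + j).+1%:Z w * _)) => i.
by apply: measurable_sum => j; exact: measurable_funM.
Qed.

(** Randomness enters only through the segment energies, so one null set and one [K0] serve all [n]
    and all [c] in the box. *)
Lemma tail_ae (Ca dbar : R) : 0 < Ca -> dbar < 1 / 2 ->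
  {ae P, forall w, forall eta : R, 0 < eta -> exists K0, forall K, (K0 <= K)%N ->
    forall n (c : nat -> R),
      (forall j, (1 <= j)%N -> `|c j| <= Ca * j%:R `^ (dbar - 1)) ->
      \sum_(t < n) (\sum_(2 ^ K <= j < t.+1) c j * sample w (t - j)%N) ^+ 2 <=
      n%:R * eta}.
Proof.
move=> Ca0 dbar12.
have s20 : 0 <= s2.
  by rewrite -lee_fin; apply: le_trans (X_msq 0); exact: msq_ge0.
(* A block of length [m] loses a factor [m ^ (1 / (q + 1))] twice: once through the substitute for
   the maximum, once in the maximal inequality. This [q] keeps the total exponent negative. *)
have [q qd] : exists q : nat, q.+1%:R^-1 < 1 / 2 - dbar.
  exists (Num.truncn (1 / 2 - dbar)^-1).
  rewrite invf_plt ?posrE ?subr_gt0//; exact: truncnS_gt.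
pose tau : R := 2 `^ q.+1%:R^-1.
have tau1 : 1 < tau.
  by rewrite /tau /powR pnatr_eq0/= expR_gt1 mulr_gt0 ?ln_gt0 ?ltr1n// invr_gt0.
have tau0 : 0 < tau by exact: lt_trans tau1.
pose D : R := nroot q.+1 4.
have D0 : 0 < D by rewrite powR_gt0.
have nr k : nroot q.+1 (4 * 2 ^ k)%:R = D * tau ^+ k.
  rewrite natrM natrX /nroot powRM ?exprn_ge0 ?ler0n//; congr (_ * _).
  by rewrite -(powR_mulrn k (ler0n _ 2)) -powRrM mulrC powRrM powR_mulrn.
pose C := (4 * q.+1 + 1)%:R * s2.
have C0 : 0 <= C by rewrite mulr_ge0.
(* The expected energy, of order [2 ^ k * D * tau ^ k], with an extra factor [tau ^ k] that makes
   the exceptional probabilities summable. *)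
pose r k := (2 ^ k)%:R * D * tau ^+ k ^+ 2.
have r0 k : 0 < r k by rewrite !mulr_gt0 ?exprn_gt0// ltr0n expn_gt0.
pose A k := [set w | exists n, r k *+ n < \sum_(v < n) segment_energy q (2 ^ k) (sample w) v].
have mA k : measurable (A k).
  rewrite (_ : A k = \bigcup_n [set w | r k *+ n <
      \sum_(v < n) segment_energy q (2 ^ k) (sample w) v]).
    apply: bigcupT_measurable => n; apply: measurable_gt_set.
    by apply: measurable_sum => v; exact: measurable_segment_energy.
  by apply/seteqP; split=> w /= [n]; [exists n|exists n].
have PA k : (P (A k) <= (C * tau^-1 ^+ k)%:E)%E.
  apply: le_trans (segment_energy_maximal q (2 ^ k) (r0 k)) _.
  rewrite lee_fin le_eqVlt; apply/orP; left; apply/eqP.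
  rewrite nr /r /C exprVn; field.
  by rewrite !gt_eqF ?exprn_gt0// ltr0n expn_gt0.
(* Its power [2 * k] gathers [2 ^ (k * (2 * dbar - 1))] from the coefficients and the two factors
   [tau ^ k]. *)
pose rho : R := 2 `^ (dbar - 1 / 2 + q.+1%:R^-1).
have rho0 : 0 < rho by rewrite powR_gt0.
have rho1 : rho < 1.
  have neg : dbar - 1 / 2 + q.+1%:R^-1 < 0.
    by move: qd; set z := q.+1%:R^-1; lra.
  by rewrite /rho /powR pnatr_eq0/= expR_lt1 nmulr_rlt0// ln_gt0// ltr1n.
pose theta : R := 2 `^ (dbar - 1).
have rhoE : rho ^+ 2 = 2 * theta ^+ 2 * tau ^+ 2.
  have -> : rho = 2 `^ 2^-1 * theta * tau.
    rewrite /theta /tau -!powRD ?pnatr_eq0 ?implybT// /rho.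
    by congr (2 `^ _); set z := q.+1%:R^-1; lra.
  by rewrite powR12_sqrt// !exprMn sqr_sqrtr.
have theta0 : 0 < theta by rewrite powR_gt0.
have dec (x y : R) : 0 < x -> x <= y -> y `^ (dbar - 1) <= x `^ (dbar - 1).
  move=> x0 xy; have y0 : 0 < y by exact: lt_le_trans xy.
  rewrite -[dbar - 1]opprB !powRN lef_pV2 ?posrE ?powR_gt0//.
  by apply: ge0_ler_powR; rewrite ?nnegrE ?(ltW x0) ?(ltW y0)//; move: dbar12; lra.
pose B := 4 * Ca ^+ 2 * D.
have B0 : 0 < B by rewrite !mulr_gt0// exprn_gt0.
have tau1_lt1 : 0 <= tau^-1 < 1 by rewrite invr_ge0 (ltW tau0)/= invf_lt1.
apply: filterS (borel_cantelli mA tau1_lt1 C0 PA) => w [K0 hK0] eta eta0.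
have r10 : 0 < 1 - rho by rewrite subr_gt0.
(* Since [rho ^ K] is at most 1 and bounds its own square, it is enough to bring [rho ^ K] below
   this value. *)
have e0 : 0 < eta * (1 - rho) ^+ 2 / B by rewrite divr_gt0// mulr_gt0// exprn_gt0.
have := @cvg_expr R rho _; rewrite ger0_norm ?(ltW rho0)// => /(_ rho1).
move=> /cvgr0Pnorm_le /(_ _ e0) [K1 _ hK1].
exists (maxn K0 K1) => K; rewrite geq_max => /andP[K0K K1K] n c cb.
have small : B * (rho ^+ K / (1 - rho)) ^+ 2 <= eta.
  have := hK1 _ K1K; rewrite /= ger0_norm ?exprn_ge0 ?(ltW rho0)// => h.
  rewrite expr_div_n mulrA ler_pdivrMr ?exprn_gt0// mulrC -ler_pdivlMr//.
  apply: le_trans h; rewrite expr2 ler_piMr ?exprn_ge0 ?(ltW rho0)//.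
  by rewrite exprn_ile1 ?(ltW rho0) ?(ltW rho1).
apply: (@le_trans _ _ (n%:R * B * (rho ^+ K / (1 - rho)) ^+ 2)); last first.
  by rewrite -mulrA ler_wpM2l.
apply: sum_tail_le; rewrite ?rho0 ?rho1 ?(ltW B0)// => k Kk.
have h2k : (0 < 2 ^ k)%N by rewrite expn_gt0.
have cm j : (j < 2 ^ k)%N -> `|c (2 ^ k + j)%N| <= Ca * theta ^+ k.
  move=> _; apply: le_trans (cb _ _) _; first by rewrite (leq_trans h2k)// leq_addr.
  have -> : theta ^+ k = (2 ^ k)%:R `^ (dbar - 1).
    rewrite natrX -(powR_mulrn k (ler0n _ 2)) -powRrM mulrC powRrM.
    by rewrite powR_mulrn.
  by rewrite ler_wpM2l ?(ltW Ca0)// dec ?ltr0n// ler_nat leq_addr.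
apply: le_trans (sum_block_le q (sample w) n h2k cm) _.
have := hK0 k (leq_trans K0K Kk); rewrite /A /= => /forallNP /(_ (n %/ 2 ^ k)%N) /negP.
rewrite -leNgt => hen.
have c0 : 0 <= 4 * (2 ^ k)%:R * (Ca * theta ^+ k) ^+ 2.
  by apply: mulr_ge0; [rewrite mulr_ge0 ?ler0n|exact: sqr_ge0].
apply: le_trans (ler_wpM2l c0 hen) _.
have hn : ((n %/ 2 ^ k) * 2 ^ k)%:R <= n%:R :> R by rewrite ler_nat leq_divM.
have -> : (rho ^+ k) ^+ 2 = (2 ^ k)%:R * (theta ^+ k) ^+ 2 * (tau ^+ k) ^+ 2.
  by rewrite natrX -!exprM ![(k * 2)%N]mulnC !exprM rhoE !exprMn.
rewrite -[X in _ * X]mulr_natr; move: hn; rewrite natrM.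
set V := (n %/ 2 ^ k)%:R; set m := (2 ^ k)%:R => hn.
have -> : 4 * m * (Ca * theta ^+ k) ^+ 2 * (r k * V) =
    (V * m) * (B * (m * (theta ^+ k) ^+ 2 * (tau ^+ k) ^+ 2)).
  by rewrite /r -/m /B; ring.
rewrite -[X in _ <= X]mulrA; apply: ler_wpM2r => //.
apply: mulr_ge0; first exact: ltW.
by apply: mulr_ge0; [apply: mulr_ge0; [exact: ler0n|]|]; exact: sqr_ge0.
Qed.

End tail_bound.

(** * Comparison of contrasts *)

Section truncation.
Context {R : realType}.
Implicit Types (x : int -> R) (c p : nat -> R).

(* Index [i] stands for the time [i + 1] of the statement. *)
Definition predictor x c (i : nat) : R :=
  c 0%N + \sum_(1 <= j < i.+1) c j * x (i.+1%:Z - j%:Z).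

(** In contrast to [predictor], the number of lags is fixed and the path is read before time 1 too;
    this is one functional of the shifted path, as Birkhoff's theorem requires. *)
Definition linear_predictor x p (J : nat) (i : nat) : R :=
  p 0%N + \sum_(1 <= k < J) p k * x (i.+1%:Z - k%:Z).

Lemma sqr_sum_le n (y : nat -> R) :
  (\sum_(k < n) y k) ^+ 2 <= n%:R * \sum_(k < n) y k ^+ 2.
Proof.
have := @sqr_sum_weight R n y (fun=> 1) (fun=> ltr01).
rewrite sumr_const card_ord => /le_trans; apply.
by under eq_bigr do rewrite divr1.
Qed.

Lemma sum_nat_cut (G : nat -> R) i J : (0 < J)%N ->
  \sum_(1 <= j < i.+1) G j =
  \sum_(1 <= j < J) (if (j <= i)%N then G j else 0) + \sum_(J <= j < i.+1) G j.
Proof.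
move=> J0; have [Ji|iJ] := leqP J i.+1.
  rewrite (@big_cat_nat _ _ _ J)//=; congr +%R.
  by apply: eq_big_nat => j /andP[_ jJ]; rewrite ifT// -ltnS (leq_trans jJ).
rewrite [X in _ + X]big_geq ?(ltnW iJ)// addr0.
rewrite [RHS](@big_cat_nat _ _ _ i.+1)//= ?(ltnW iJ)//.
rewrite [X in _ + X]big_nat_cond [X in _ + X]big1 ?addr0 => [|j]; last first.
  by move=> /andP[/andP[ij _] _]; rewrite ifF//; apply/negbTE; rewrite -ltnNge.
by apply: eq_big_nat => j /andP[_]; rewrite ltnS => ->.
Qed.

(** The error splits into the constant term, the change of coefficients below [J], the start-up
    error [E] and the remote lags. The threshold on [n] depends on [p] but not on [c], so [c] may
    later vary with [n]. *)
Lemma predictor_approx x (A : R) : 0 < A ->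
  (\forall n \near \oo, \sum_(i < n) x i.+1%:Z ^+ 2 <= n%:R * A) ->
  forall (J : nat) (eta : R), (0 < J)%N -> 0 < eta -> exists2 tau, 0 < tau &
  forall p, \forall n \near \oo, forall c, (forall j, (j < J)%N -> `|c j - p j| <= tau) ->
    \sum_(i < n) (\sum_(J <= j < i.+1) c j * x (i - j)%N.+1%:Z) ^+ 2 <= n%:R * eta ->
    \sum_(i < n) (linear_predictor x p J i - predictor x c i) ^+ 2 <= n%:R * (16 * eta).
Proof.
move=> A0 hA J eta J0 eta0.
have J2A : 0 < 1 + J%:R ^+ 2 * A by rewrite ltr_wpDr// mulr_ge0 ?sqr_ge0// ltW.
(* The constant term and the lags below [J] together then contribute at most [eta] on average. *)
pose tau := Num.sqrt (eta / (1 + J%:R ^+ 2 * A)).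
have tauE : tau ^+ 2 * (1 + J%:R ^+ 2 * A) = eta.
  by rewrite sqr_sqrtr ?divr_ge0 ?ltW// divfK ?gt_eqF.
exists tau; first by rewrite sqrtr_gt0 divr_gt0.
move=> p.
(* Lags reaching before the sample. They occur only for [i < J], so their total [B] is fixed and is
   eventually below [n * eta]. *)
pose E i := \sum_(1 <= k < J) (if (i < k)%N then p k * x (i.+1%:Z - k%:Z) else 0).
pose B := \sum_(i < J) E i ^+ 2.
have B0 : 0 <= B by apply: sumr_ge0 => i _; exact: sqr_ge0.
near=> n => c cp tl.
have EB : \sum_(i < n) E i ^+ 2 <= n%:R * eta.
  apply: (@le_trans _ _ B).
    have Ez i : (J <= i)%N -> E i = 0.
      move=> Ji; rewrite /E big_nat_cond big1// => k /andP[/andP[_ kJ] _].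
      by rewrite ifF//; apply/negbTE; rewrite -leqNgt (leq_trans (ltnW kJ)).
    have Ez2 r : (J <= r)%N -> E r ^+ 2 = 0 by move=> /Ez ->; rewrite expr0n.
    apply: le_trans (@sum_shift_le R (fun i => E i ^+ 2) 0 n J (fun=> sqr_ge0 _) Ez2).
    by apply: ler_sum => i _ /=; rewrite subn0.
  rewrite -ler_pdivrMr//; near: n; exact: nbhs_infty_ger.
have EA : \sum_(i < n) x i.+1%:Z ^+ 2 <= n%:R * A by near: n.
pose F i j := if (0 < j <= i)%N then (c j - p j) * x (i - j)%N.+1%:Z else 0.
have tau0 : 0 <= tau by exact: sqrtr_ge0.
have FB : \sum_(i < n) (\sum_(j < J) F i j) ^+ 2 <= n%:R * (tau ^+ 2 * (J%:R ^+ 2 * A)).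
  apply: (@le_trans _ _ (\sum_(i < n) J%:R * \sum_(j < J) F i j ^+ 2)).
    by apply: ler_sum => i _; exact: sqr_sum_le.
  rewrite -mulr_sumr exchange_big/=.
  have Fj (j : 'I_J) : \sum_(i < n) F i j ^+ 2 <= tau ^+ 2 * (n%:R * A).
    apply: le_trans (ler_wpM2l (sqr_ge0 tau) EA).
    rewrite mulr_sumr.
    pose G r := if (r < n)%N then tau ^+ 2 * x r.+1%:Z ^+ 2 else 0.
    have G0 r : 0 <= G r by rewrite /G; case: ifP => // _; rewrite mulr_ge0 ?sqr_ge0.
    have Gn r : (n <= r)%N -> G r = 0 by move=> nr; rewrite /G ltnNge nr.
    have -> : \sum_(r < n) tau ^+ 2 * x r.+1%:Z ^+ 2 = \sum_(r < n) G r.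
      by apply: eq_bigr => r _; rewrite /G ltn_ord.
    apply: le_trans (@sum_shift_le R G j n n G0 Gn); apply: ler_sum => i _.
    rewrite /F; case: ifP => [/andP[j0 ji]|_]; last by rewrite expr0n/=; case: ifP.
    rewrite ji /G (leq_ltn_trans (leq_subr _ _) (ltn_ord i)) exprMn.
    rewrite ler_wpM2r ?sqr_ge0// -(real_normK (num_real (c j - p j))).
    by rewrite lerXn2r ?nnegrE ?normr_ge0// cp.
  apply: (@le_trans _ _ (J%:R * \sum_(j < J) tau ^+ 2 * (n%:R * A))).
    by rewrite ler_wpM2l//; apply: ler_sum => j _; exact: Fj.
  rewrite sumr_const card_ord -[X in J%:R * X]mulr_natl.
  by rewrite le_eqVlt; apply/orP; left; apply/eqP; ring.
have dec i : linear_predictor x p J i - predictor x c i =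
    (p 0%N - c 0%N) - (\sum_(j < J) F i j) + E i
    - \sum_(J <= j < i.+1) c j * x (i - j)%N.+1%:Z.
  have Fsum : \sum_(j < J) F i j =
      \sum_(1 <= j < J) (if (j <= i)%N then (c j - p j) * x (i - j)%N.+1%:Z else 0).
    rewrite -(big_mkord xpredT (F i)) (@big_cat_nat _ _ _ 1)//= big_nat1 add0r.
    by apply: eq_big_nat => j /andP[j0 _]; rewrite /F j0.
  have xE j : (j <= i)%N -> x (i.+1%:Z - j%:Z) = x (i - j)%N.+1%:Z.
    by move=> ji; congr x; lia.
  have tailE : \sum_(J <= j < i.+1) c j * x (i.+1%:Z - j%:Z) =
      \sum_(J <= j < i.+1) c j * x (i - j)%N.+1%:Z.
    by apply: eq_big_nat => j /andP[_ ji]; rewrite xE.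
  rewrite /predictor (sum_nat_cut _ _ J0) tailE.
  have -> : linear_predictor x p J i = p 0%N + (\sum_(1 <= j < J)
      (if (j <= i)%N then p j * x (i.+1%:Z - j%:Z) else 0) + E i).
    rewrite /linear_predictor /E -big_split/=; congr +%R; apply: eq_bigr => k _.
    by case: leqP => _; rewrite ?addr0 ?add0r.
  have -> : \sum_(1 <= j < J) (if (j <= i)%N then p j * x (i.+1%:Z - j%:Z) else 0) =
    \sum_(1 <= j < J) (if (j <= i)%N then c j * x (i.+1%:Z - j%:Z) else 0)
      - \sum_(j < J) F i j.
    rewrite Fsum -sumrB; apply: eq_bigr => j _; case: ifP => ji; last by rewrite subr0.
    by rewrite xE//; ring.
  by ring.
apply: (@le_trans _ _ (\sum_(i < n) (4 * tau ^+ 2 + 4 * (\sum_(j < J) F i j) ^+ 2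
   + 4 * E i ^+ 2 + 4 * (\sum_(J <= j < i.+1) c j * x (i - j)%N.+1%:Z) ^+ 2))).
  apply: ler_sum => i _; rewrite dec.
  set u := \sum_(j < J) _; set v := \sum_(J <= j < i.+1) _; set z := E i.
  have y2 : (p 0%N - c 0%N) ^+ 2 <= tau ^+ 2.
    rewrite -(real_normK (num_real _)) lerXn2r ?nnegrE ?normr_ge0//.
    by rewrite distrC cp.
  move: y2; set y := p 0%N - c 0%N => y2.
  have h1 := sqr_ge0 (y + u); have h2 := sqr_ge0 (y - z); have h3 := sqr_ge0 (y + v).
  have h4 := sqr_ge0 (u + z); have h5 := sqr_ge0 (u - v); have h6 := sqr_ge0 (z + v).
  nra.
rewrite !big_split/= -!mulr_sumr sumr_const card_ord -mulr_natl.
have N0 : 0 <= n%:R :> R by [].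
rewrite -tauE in EB tl *; nra.
Unshelve. all: by end_near.
Qed.

End truncation.

(** * Ergodic averages of finite predictors *)

Section averages.
Context d (T : measurableType d) (R : realType) (P : probability T R).
Implicit Types f g : T -> R.

Lemma msq_ltyD f g : measurable_fun setT f -> measurable_fun setT g ->
  (msq P f < +oo)%E -> (msq P g < +oo)%E -> (msq P (fun w => f w + g w)%R < +oo)%E.
Proof.
move=> mf mg f2 g2; apply: le_lt_trans (msq_le2D P mf mg) _.
by rewrite lte_add_pinfty// lte_mul_pinfty// ?lee_fin.
Qed.

Lemma msq_ltyZ (c : R) f : measurable_fun setT f ->
  (msq P f < +oo)%E -> (msq P (fun w => c * f w)%R < +oo)%E.
Proof.
by move=> mf f2; rewrite msqZ// lte_mul_pinfty// lee_fin sqr_ge0.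
Qed.

Lemma msq_norm f : msq P (fun w => `|f w|) = msq P f.
Proof.
by apply: eq_integral => w _; rewrite real_normK ?num_real.
Qed.

Lemma msqN f : msq P (fun w => - f w) = msq P f.
Proof. by apply: eq_integral => w _; rewrite sqrrN. Qed.

Lemma msq_cst c : msq P (fun=> c) = (c ^+ 2)%:E.
Proof.
rewrite /msq (integral_cst P measurableT (c ^+ 2)%:E).
by rewrite -[RHS]mule1; congr (_ * _)%E; exact: probability_setT.
Qed.

Lemma measurable_norm f : measurable_fun setT f -> measurable_fun setT (fun w => `|f w|).
Proof. by move=> mf; exact: measurableT_comp. Qed.

Lemma msq_lty_sub_norm f g :
  measurable_fun setT f -> measurable_fun setT g ->
  (msq P f < +oo)%E -> (msq P g < +oo)%E ->
  (msq P (fun w => `|f w| - `|g w|)%R < +oo)%E.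
Proof.
move=> mf mg f2 g2; have mf' := measurable_norm mf; have mg' := measurable_norm mg.
apply: (@msq_ltyD _ (fun w => - `|g w|)) => //.
- exact: measurable_funN.
- by rewrite msq_norm.
- by rewrite msqN msq_norm.
Qed.

Variable X : int -> {RV P >-> R}.
Hypothesis X_msq : forall t, (msq P (X t) < +oo)%E.

Lemma measurable_linear_predictor p J i :
  measurable_fun setT (fun w => linear_predictor (X^~ w) p J i).
Proof.
by apply: measurable_funD => //; apply: measurable_sum => k; exact: measurable_funM.
Qed.

Lemma msq_linear_predictor p J i :
  (msq P (fun w => linear_predictor (X^~ w) p J i)%R < +oo)%E.
Proof.
apply: msq_ltyD => //.
- by apply: measurable_sum => k; exact: measurable_funM.
- by rewrite msq_cst ltry.
elim: (index_iota 1 J) => [|k s IH].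
  by rewrite (_ : (fun w => _) = cst 0) ?msq_cst ?ltry//; apply/funext => w; rewrite big_nil.
rewrite (_ : (fun w => _) = fun w => p k * X (i.+1%:Z - k%:Z) w +
    \sum_(k <- s) p k * X (i.+1%:Z - k%:Z) w); last first.
  by apply/funext => w; rewrite big_cons.
apply: msq_ltyD => //; first exact: measurable_funM.
- by apply: measurable_sum => j; exact: measurable_funM.
- exact: msq_ltyZ.
Qed.

Definition residual (x : int -> R) p J i := `|x i.+1%:Z| - `|linear_predictor x p J i|.

Lemma measurable_residual p J i : measurable_fun setT (fun w => residual (X^~ w) p J i).
Proof.
apply: measurable_funB; first exact: measurable_norm.
exact: measurable_norm (measurable_linear_predictor _ _ _).
Qed.

Lemma msq_residual p J i : (msq P (fun w => residual (X^~ w) p J i)%R < +oo)%E.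
Proof.
apply: msq_lty_sub_norm => //; last exact: msq_linear_predictor.
exact: measurable_linear_predictor.
Qed.

Hypothesis X_stat : strictly_stationary X.
Hypothesis X_ergodic : ergodic X.

(** Birkhoff's theorem for the unit shift under the law of the path, transported back to the
    underlying space. *)
Lemma residual_average p J : {ae P, forall w,
  n%:R^-1 * (\sum_(i < n) residual (X^~ w) p J i ^+ 2) @[n --> \oo] -->
  fine (msq P (fun w => residual (X^~ w) p J 0))}.
Proof.
pose g (x : pathspace R int) : R := residual x p J 0 ^+ 2.
have mg : measurable_fun setT g.
  have mL : measurable_fun setT (fun x : pathspace R int => linear_predictor x p J 0).
    apply: measurable_funD => //; apply: measurable_sum => k.
    by apply: measurable_funM => //; exact: measurable_coord.
  apply: measurable_funX; apply: measurable_funB.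
    by apply: measurableT_comp => //; exact: measurable_coord.
  exact: measurableT_comp.
have Eg : (\int[law X]_x (g x)%:E = msq P (fun w => residual (X^~ w) p J 0)%R)%E.
  rewrite integral_law//; first exact/measurable_EFinP.
  by move=> x; rewrite lee_fin sqr_ge0.
have gi : (law X).-integrable setT (EFin \o g).
  apply/integrableP; split; first exact/measurable_EFinP.
  under eq_integral do rewrite gee0_abs ?lee_fin ?sqr_ge0//.
  by rewrite Eg msq_residual.
have erg A : measurable A -> shift 1 @^-1` A = A -> law X A = 0%E \/ law X A = 1%E.
  by move=> mA sA; exact: X_ergodic mA sA.
have := birkhoff_cvg (@measurable_shift R 1) (law_shift X_stat 1) erg gi.
move=> /ae_law; apply: filterS => w.
rewrite /Rintegral Eg.
rewrite (_ : (fun n => _) = (fun n => n%:R^-1 * \sum_(i < n) residual (X^~ w) p J i ^+ 2))//.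
apply/funext => n; congr (_ * _); rewrite /birkhoff big_mkord.
apply: eq_bigr => i _; rewrite iter_shift /g /residual /linear_predictor.
have E k : trajectory X w (1%:Z - k%:Z + 1 *+ i) = X (i.+1%:Z - k%:Z) w.
  by congr (X _ w); lia.
by have := E 0%N; rewrite !subr0 => ->; under eq_bigr do rewrite E.
Qed.

End averages.

Section weighted_triangle.
Context {R : realType}.

(** Young's inequality for the cross term [2 * v * (u - v)]. The factor of [v ^ 2] stays close to 1,
    so no constant is lost in the comparison of contrasts. *)
Lemma sqr_le_eps (e u v z : R) : 0 < e -> `|u - v| <= `|z| ->
  u ^+ 2 <= (1 + e) * v ^+ 2 + (1 + e^-1) * z ^+ 2.
Proof.
move=> e0 uv.
have h1 : (u - v) ^+ 2 <= z ^+ 2.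
  by rewrite -(real_normK (num_real (u - v))) -(real_normK (num_real z)) lerXn2r ?nnegrE.
have h2 : 0 <= e^-1 * (e * v - (u - v)) ^+ 2 by rewrite mulr_ge0 ?sqr_ge0// invr_ge0 ltW.
have h3 : e^-1 * (e * v - (u - v)) ^+ 2 = e * v ^+ 2 - 2 * v * (u - v) + e^-1 * (u - v) ^+ 2.
  by field; rewrite gt_eqF.
have h4 : e^-1 * (u - v) ^+ 2 <= e^-1 * z ^+ 2 by rewrite ler_wpM2l// invr_ge0 ltW.
rewrite h3 in h2; rewrite mulrDl mul1r [(1 + e^-1) * _]mulrDl mul1r.
have -> : u ^+ 2 = v ^+ 2 + 2 * v * (u - v) + (u - v) ^+ 2 by ring.
lra.
Qed.

Lemma sum_sqr_le_eps (e : R) n (u v z : nat -> R) : 0 < e ->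
  (forall i, (i < n)%N -> `|u i - v i| <= `|z i|) ->
  \sum_(i < n) u i ^+ 2 <=
  (1 + e) * (\sum_(i < n) v i ^+ 2) + (1 + e^-1) * (\sum_(i < n) z i ^+ 2).
Proof.
move=> e0 h; rewrite !mulr_sumr -big_split/=; apply: ler_sum => i _.
by apply: sqr_le_eps => //; exact: h.
Qed.

(** First [eta] and then [e] tends to 0, as [C] may depend on [e]. The fourth power matches the four
    approximations chained in [cluster_le]. *)
Lemma le_of_le_eps (A B : R) : 0 <= B ->
  (forall e, 0 < e -> exists C, forall eta, 0 < eta -> A <= (1 + e) ^+ 4 * B + C * eta) ->
  A <= B.
Proof.
move=> B0 h; apply/ler_addgt0Pr => d d0.
(* For [e <= 1] the fourth power is at most [1 + 15 * e], so the excess over [B] is at most [d / 2];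
   [eta] below takes care of the other half. *)
pose e := Num.min 1 (d / (30 * (B + 1))).
have B1 : 0 < 30 * (B + 1) by rewrite mulr_gt0// ltr_wpDl.
have e0 : 0 < e by rewrite lt_min ltr01 divr_gt0.
have e1 : e <= 1 by rewrite ge_min lexx.
have eB : e * (30 * (B + 1)) <= d.
  by rewrite -ler_pdivlMr// ge_min lexx orbT.
have [C hC] := h e e0.
pose eta := d / (2 * (1 + `|C|)).
have C1 : 0 < 1 + `|C| by rewrite ltr_wpDr.
have eta0 : 0 < eta by rewrite divr_gt0// mulr_gt0.
have h1 := hC eta eta0.
have h2 : C * eta <= d / 2.
  apply: (@le_trans _ _ ((1 + `|C|) * eta)).
    rewrite ler_wpM2r ?(ltW eta0)//; have := ler_norm C; lra.
  by rewrite /eta le_eqVlt; apply/orP; left; apply/eqP; field; rewrite gt_eqF.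
have h3 : (1 + e) ^+ 4 <= 1 + 15 * e.
  have : e ^+ 2 <= e by rewrite expr2 ler_piMl// ltW.
  move=> e2; have e3 : e ^+ 3 <= e by rewrite exprSr; nra.
  have e4 : e ^+ 4 <= e by rewrite exprSr; nra.
  have -> : (1 + e) ^+ 4 = 1 + 4 * e + 6 * e ^+ 2 + 4 * e ^+ 3 + e ^+ 4 by ring.
  lra.
have h4 : (1 + e) ^+ 4 * B <= (1 + 15 * e) * B by rewrite ler_wpM2r.
nra.
Qed.

(** Finite rational sequences are countable, which allows a single null set for all the predictors
    used. *)
Lemma rat_approx (p : nat -> R) J (e : R) : 0 < e ->
  exists2 s : seq rat, size s = J &
    forall j, (j < J)%N -> `|p j - ratr (nth 0 s j)| <= e.
Proof.
move=> e0.
have ex j : exists q : rat, `|p j - ratr q| <= e.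
  have : p j - e < p j + e by lra.
  move=> /rat_in_itvoo[q]; rewrite in_itv/= => /andP[h1 h2]; exists q.
  by rewrite ler_norml; apply/andP; split; lra.
have [f hf] := choice ex; exists (mkseq f J); first exact: size_mkseq.
by move=> j jJ; rewrite nth_mkseq.
Qed.

End weighted_triangle.

(** * The minimizer of the limiting contrast *)

Section population.
Context d (T : measurableType d) (R : realType) (P : probability T R).
Implicit Types f g h : T -> R.

Lemma msq_le_eps (e : R) f g h : 0 < e ->
  measurable_fun setT f -> measurable_fun setT g -> measurable_fun setT h ->
  (forall w, `|f w - g w| <= `|h w|) ->
  (msq P f <= (1 + e)%:E * msq P g + (1 + e^-1)%:E * msq P h)%E.
Proof.
move=> e0 mf mg mh fgh.
have m2 (k : T -> R) : measurable_fun setT k -> measurable_fun setT (fun w => k w ^+ 2).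
  by move=> mk; exact: measurable_funX.
have c1 : 0 <= 1 + e by rewrite addr_ge0// ltW.
have c2 : 0 <= 1 + e^-1 by rewrite addr_ge0// invr_ge0 ltW.
have mc (c : R) (k : T -> R) : measurable_fun setT k ->
    measurable_fun setT (fun w => c * k w ^+ 2).
  by move=> mk; apply: measurable_funM => //; exact: m2.
rewrite /msq -(ge0_integral_EFinZ P (m2 _ mg) (fun w => sqr_ge0 _) c1).
rewrite -(ge0_integral_EFinZ P (m2 _ mh) (fun w => sqr_ge0 _) c2).
rewrite -(ge0_integral_EFinD P (mc _ _ mg) (mc _ _ mh)); last 2 first.
- by move=> w; rewrite mulr_ge0 ?sqr_ge0.
- by move=> w; rewrite mulr_ge0 ?sqr_ge0.
apply: ge0_le_integral_EFin.
- exact: m2.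
- by apply: measurable_funD; exact: mc.
- by move=> w; exact: sqr_ge0.
- by move=> w; apply: sqr_le_eps.
Qed.

(** The cross term stands on the left, which avoids subtraction of extended reals. *)
Lemma msq_sub_norm f g : measurable_fun setT f -> measurable_fun setT g ->
  (msq P (fun w => `|f w| - `|g w|)%R + 2%:E * \int[P]_w (`|f w| * `|g w|)%:E =
   msq P f + msq P g)%E.
Proof.
move=> mf mg; have mf' := measurable_norm mf; have mg' := measurable_norm mg.
have mfg : measurable_fun setT (fun w => `|f w| * `|g w|) by exact: measurable_funM.
rewrite -(ge0_integral_EFinZ P mfg) => [|w|]; rewrite ?mulr_ge0//.
rewrite /msq -ge0_integral_EFinD; last 4 first.
- by apply: measurable_funX; exact: measurable_funB.
- exact: measurable_funM.
- by move=> w; exact: sqr_ge0.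
- by move=> w; rewrite !mulr_ge0.
rewrite -ge0_integral_EFinD; last 4 first.
- exact: measurable_funX.
- exact: measurable_funX.
- by move=> w; exact: sqr_ge0.
- by move=> w; exact: sqr_ge0.
apply: eq_integral => w _; congr EFin.
rewrite -(real_normK (num_real (f w))) -(real_normK (num_real (g w))); ring.
Qed.

Lemma msq_eq0 f : measurable_fun setT f -> msq P f = 0%E -> {ae P, forall w, f w = 0}.
Proof.
move=> mf f0.
have mf2 : measurable_fun setT (fun w => (f w ^+ 2)%:E : \bar R).
  by apply/measurable_EFinP; exact: measurable_funX.
have := (ae_eq_integral_abs P measurableT mf2).1.
rewrite (_ : (\int[P]_(x in setT) _)%E = msq P f); last first.
  by apply: eq_integral => w _; rewrite gee0_abs// lee_fin sqr_ge0.
move=> /(_ f0); apply: filterS => w /(_ I) /= -[] /eqP.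
by rewrite sqrf_eq0 => /eqP.
Qed.

Variable xi : int -> {RV P >-> R}.
Hypothesis xi_iid : iid xi.
Hypothesis xi_abs : (\int[P]_w (`|xi 0 w|)%:E = 1)%E.

Lemma integral_abs_innovation u (Z V Y : T -> R) :
  measurable_fun setT Z -> measurable_fun setT V -> measurable_fun setT Y ->
  past_fun xi u V -> past_fun xi u Y ->
  {ae P, forall w, Z w = xi u w * V w} ->
  (\int[P]_w (`|Z w| * `|Y w|)%:E = \int[P]_w (`|V w| * `|Y w|)%:E)%E.
Proof.
move=> mZ mV mY pV pY ZE.
have mVY : measurable_fun setT (fun w => `|V w| * `|Y w|).
  by apply: measurable_funM; exact: measurable_norm.
have mx : measurable_fun setT (fun w => `|xi u w|) by exact: measurable_norm.
rewrite -(integral_abs_past xi_iid xi_abs mVY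
  (past_funM (past_fun_norm pV) (past_fun_norm pY))); last first.
  by move=> w; rewrite mulr_ge0.
apply: ge0_ae_eq_integral => //.
- by apply/measurable_EFinP; apply: measurable_funM; exact: measurable_norm.
- by apply/measurable_EFinP; exact: measurable_funM.
- by apply: filterS ZE => w -> _ /=; rewrite normrM mulrA.
Qed.

(** In both cross terms [|Z|] may be replaced by [|V|]. Expanding the squares, the contrast at [Y]
    exceeds that at [V] by exactly the mean square of [|V| - |Y|], which must therefore be zero. *)
Lemma population_minimizer u (Z V Y : T -> R) :
  measurable_fun setT Z -> measurable_fun setT V -> measurable_fun setT Y ->
  past_fun xi u V -> past_fun xi u Y ->
  {ae P, forall w, Z w = xi u w * V w} ->
  (msq P Z < +oo)%E -> (msq P V < +oo)%E -> (msq P Y < +oo)%E ->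
  (msq P (fun w => `|Z w| - `|Y w|)%R <= msq P (fun w => `|Z w| - `|V w|)%R)%E ->
  {ae P, forall w, `|V w| = `|Y w|}.
Proof.
move=> mZ mV mY pV pY ZE Z2 V2 Y2 le.
have fin f : (msq P f < +oo)%E -> exists r, msq P f = r%:E.
  by move=> h; exists (fine (msq P f)); rewrite fineK// ge0_fin_numE// msq_ge0.
have mN (f g : T -> R) : measurable_fun setT f -> measurable_fun setT g ->
    measurable_fun setT (fun w => `|f w| - `|g w|).
  by move=> mf mg; apply: measurable_funB; exact: measurable_norm.
have E1 := msq_sub_norm mZ mY; have E2 := msq_sub_norm mZ mV.
have E3 := msq_sub_norm mV mY; have E4 := msq_sub_norm mV mV.
rewrite (integral_abs_innovation mZ mV mY pV pY ZE) in E1.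
rewrite (integral_abs_innovation mZ mV mV pV pV ZE) in E2.
have {E4} VV : (\int[P]_w (`|V w| * `|V w|)%:E = msq P V)%E.
  by apply: eq_integral => w _; rewrite -expr2 real_normK ?num_real.
rewrite VV in E2.
have [z zE] := fin _ Z2; have [v vE] := fin _ V2; have [y yE] := fin _ Y2.
set b := (\int[P]_w _)%E in E1 E3.
set p := msq P (fun w => `|Z w| - `|Y w|) in E1 le.
set q := msq P (fun w => `|Z w| - `|V w|) in E2 le.
set r := msq P (fun w => `|V w| - `|Y w|) in E3.
have [p0 q0 r0] : [/\ (0 <= p)%E, (0 <= q)%E & (0 <= r)%E] by split; exact: msq_ge0.
have b0 : (0 <= b)%E by apply: integral_ge0 => w _; rewrite lee_fin mulr_ge0.
suff : r = 0%E.
  move=> /msq_eq0-/(_ (mN _ _ mV mY)); apply: filterS => w /eqP.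
  by rewrite subr_eq0 => /eqP.
rewrite zE yE in E1; rewrite zE vE in E2; rewrite vE yE in E3.
(* Nonnegative terms with a finite sum are finite; the identities become linear equations over the
   reals. *)
have part (s t : \bar R) (c : R) : (0 <= s)%E -> (0 <= t)%E -> (s + t = c%:E)%E ->
    (exists c1, s = c1%:E) /\ exists c2, t = c2%:E.
  by case: s => [s| |]//; case: t => [t| |]// _ _ _; split; [exists s|exists t].
have b20 : (0 <= 2%:E * b)%E by rewrite mule_ge0.
have [[p' pE] [b2 b2E]] := part _ _ _ p0 b20 E1.
have [[r' rE] _] := part _ _ _ r0 b20 E3.
have v20 : (0 <= 2%:E * v%:E)%E by rewrite -vE mule_ge0// msq_ge0.
have [[q' qE] _] := part _ _ _ q0 v20 E2.
move: E1 E2 E3 le r0; rewrite b2E pE qE rE -!EFinM -!EFinD !lee_fin.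
by move=> [E1] [E2] [E3] le r0; congr EFin; lra.
Qed.

End population.

(** * Absence of atoms and continuity of finite predictors *)

Section predictor_continuity.
Context d (T : measurableType d) (R : realType) (P : probability T R).

(** The mass at [x] is at most [F x - F y] for every [y < x], and left continuity makes this
    difference small. *)
Lemma continuous_cdf_noatom (Y : {RV P >-> R}) : continuous (cdf Y) ->
  forall x, P (Y @^-1` [set x]) = 0%E.
Proof.
move=> cY x; pose F r := fine (cdf Y r).
have FE r : cdf Y r = (F r)%:E by rewrite fineK// fin_num_measure.
have cF : F y @[y --> x] --> F x.
  by apply: fine_cvg; rewrite -FE; exact: cY.
have mx : measurable (Y @^-1` [set x]).
  by rewrite -[_ @^-1` _]setTI; exact: measurable_funP.
have pE : P (Y @^-1` [set x]) = (fine (P (Y @^-1` [set x])))%:E.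
  by rewrite fineK// fin_num_measure.
set p := fine _ in pE.
have p0 : 0 <= p by rewrite fine_ge0.
have le y : y < x -> p + F y <= F x.
  move=> yx; rewrite -lee_fin EFinD -pE -!FE.
  rewrite -[X in (X + _)%E]/(distribution P Y [set x]) /cdf -measureU//.
  - apply: le_measure; rewrite ?inE//; first exact: measurableU.
    by move=> z /= [->|]; rewrite !in_itv/= ?lexx// => /le_trans; apply; exact: ltW.
  - by apply/seteqP; split=> z //= [->]; rewrite in_itv/= leNgt yx.
rewrite pE; congr EFin; apply/eqP; rewrite eq_le p0 andbT.
apply/ler_addgt0Pr => e e0; rewrite add0r.
have /cvg_at_left_filter/cvgrPdist_lt/(_ _ e0) near1 := cF.
have [y [h yx]] : exists y, `|F x - F y| < e /\ y < x.
  by apply: (@filter_ex _ x^'-); near=> y; split; near: y => //; exact: nbhs_left_lt.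
have := le y yx; have := ler_norm (F x - F y); lra.
Unshelve. all: by end_near.
Qed.

Variable X : int -> {RV P >-> R}.

Lemma contrastE l (a : nat -> 'rV[R]_l -> R) n th w :
  contrast a X n th w = n%:R^-1 *
  \sum_(i < n) (`|X i.+1%:Z w| - `|predictor (X^~ w) (a^~ th) i|) ^+ 2.
Proof.
by rewrite /contrast big_add1/= big_mkord; congr (_ * _).
Qed.

Variable s2 : R.
Hypothesis X_msq : forall t, (msq P (X t) <= s2%:E)%E.

Lemma linear_predictorB x p p' J : (0 < J)%N ->
  linear_predictor x p J 0 - linear_predictor x p' J 0 =
  \sum_(k < J) (p k - p' k) * (if (k : nat) == 0%N then 1 else x (1%:Z - k%:Z) : R).
Proof.
move=> J0; rewrite -(big_mkord xpredT (fun k => (p k - p' k) *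
  (if k == 0%N then 1 else x (1%:Z - k%:Z)))) (@big_cat_nat _ _ _ 1)//= big_nat1 eqxx mulr1.
rewrite /linear_predictor opprD addrACA -sumrB; congr +%R.
apply: eq_big_nat => k /andP[k0 _].
by rewrite ifF ?mulrBl//; apply/negbTE; rewrite -lt0n.
Qed.

Lemma msq_linear_predictorB J eta : (0 < J)%N -> 0 < eta ->
  exists2 delta, 0 < delta & forall p p',
    (forall j, (j < J)%N -> `|p j - p' j| <= delta) ->
    (msq P (fun w => linear_predictor (X^~ w) p J 0 -
                     linear_predictor (X^~ w) p' J 0)%R <= eta%:E)%E.
Proof.
move=> J0 eta0.
have s20 : 0 <= s2.
  by rewrite -lee_fin; apply: le_trans (X_msq 0); exact: msq_ge0.
have JJ : 0 < J%:R * (J%:R * (1 + s2)) :> R.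
  by rewrite !mulr_gt0 ?ltr0n// ltr_wpDr.
(* One factor [J] comes from Cauchy-Schwarz and the other from the number of terms, each of mean
   square at most [1 + s2]. *)
exists (Num.sqrt (eta / (J%:R * (J%:R * (1 + s2))))); first by rewrite sqrtr_gt0 divr_gt0.
set de := Num.sqrt _ => p p' pp.
have de0 : 0 <= de by exact: sqrtr_ge0.
pose Y (k : nat) w : R := if k == 0%N then 1 else X (1%:Z - k%:Z) w.
have mY k : measurable_fun setT (Y k) by rewrite /Y; case: eqP.
have Y2 k : (msq P (Y k) <= (1 + s2)%:E)%E.
  rewrite /Y; case: eqP => _; first by rewrite msq_cst expr1n lee_fin lerDl.
  by apply: le_trans (X_msq _) _; rewrite lee_fin lerDr.
have mY2 (c : R) k : measurable_fun setT (fun w => c * Y k w ^+ 2).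
  by apply: measurable_funM => //; exact: measurable_funX.
have mS n : measurable_fun setT (fun w => \sum_(k < n) (J%:R * de ^+ 2) * Y k w ^+ 2).
  by apply: measurable_sum => k; exact: mY2.
have c0 : 0 <= J%:R * de ^+ 2 by rewrite mulr_ge0 ?sqr_ge0.
apply: (@le_trans _ _ (\int[P]_w (\sum_(k < J) (J%:R * de ^+ 2) * Y k w ^+ 2)%:E)%E).
  apply: ge0_le_integral_EFin => // [|w|w].
  - by apply: measurable_funX; apply: measurable_funB; exact: measurable_linear_predictor.
  - exact: sqr_ge0.
  - rewrite linear_predictorB//; apply: le_trans (sqr_sum_le _ (fun k => (p k - p' k) * Y k w)) _.
    rewrite mulr_sumr; apply: ler_sum => k _; rewrite -mulrA ler_wpM2l// exprMn.
    rewrite ler_wpM2r ?sqr_ge0// -(real_normK (num_real (p k - p' k))).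
    by rewrite lerXn2r ?nnegrE ?normr_ge0// pp.
suff H n : (\int[P]_w (\sum_(k < n) (J%:R * de ^+ 2) * Y k w ^+ 2)%:E <=
    (n%:R * (J%:R * de ^+ 2 * (1 + s2)))%:E)%E.
  apply: le_trans (H J) _; rewrite lee_fin le_eqVlt; apply/orP; left; apply/eqP.
  have -> : J%:R * (J%:R * de ^+ 2 * (1 + s2)) = de ^+ 2 * (J%:R * (J%:R * (1 + s2))) by ring.
  by rewrite sqr_sqrtr ?divr_ge0 ?(ltW eta0) ?(ltW JJ)// divfK ?gt_eqF.
elim: n => [|n IH].
  by rewrite mul0r; under eq_integral do rewrite big_ord0; rewrite integral0.
under eq_integral do rewrite big_ord_recr.
have Y0 k w : 0 <= J%:R * de ^+ 2 * Y k w ^+ 2 by rewrite mulr_ge0 ?sqr_ge0.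
have S0 w : 0 <= \sum_(k < n) J%:R * de ^+ 2 * Y k w ^+ 2.
  by apply: sumr_ge0 => k _; exact: Y0.
rewrite /= (ge0_integral_EFinD P (mS n) (mY2 _ n) S0 (Y0 n)).
rewrite -natr1 mulrDl mul1r EFinD; apply: leeD => //.
have mYn : measurable_fun setT (fun w => Y n w ^+ 2) by exact: measurable_funX.
rewrite (ge0_integral_EFinZ P mYn _ c0) => [|w]; last exact: sqr_ge0.
have c0' : (0 <= (J%:R * de ^+ 2)%:E)%E by rewrite lee_fin.
by rewrite [in X in (_ <= X)%E]EFinM; exact: (lee_wpmul2l c0' (Y2 n)).
Qed.

End predictor_continuity.

(** * Cluster points of the minimizers *)

Section cluster_points.
Context d (T : measurableType d) (R : realType) (P : probability T R).
Variable X : int -> {RV P >-> R}.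
Variable s2 : R.
Hypothesis X_msq : forall t, (msq P (X t) <= s2%:E)%E.

Let X_lty t : (msq P (X t) < +oo)%E.
Proof. exact: le_lt_trans (X_msq t) (ltry _). Qed.

Lemma linear_of_lty p (Z : T -> R) : measurable_fun setT Z -> linear_of X p 1 Z ->
  (msq P Z < +oo)%E.
Proof.
move=> mZ /L2_cvg_msq lZ; have [N _ /(_ N (leqnn N)) h] := msq_near ltr01 lZ.
have mS := measurable_linear_sum X p 1 N.
have mD : measurable_fun setT (fun w => linear_sum X p 1 N w - Z w).
  exact: measurable_funB.
rewrite (_ : Z = fun w => linear_sum X p 1 N w + - (linear_sum X p 1 N w - Z w)); last first.
  by apply/funext => w; ring.
apply: msq_ltyD => //.
- exact: measurable_funN.
- exact: (msq_linear_predictor X_lty p N.+1 0).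
- by rewrite msqN (le_lt_trans h)// ltry.
Qed.

Definition rat_coef (s : seq rat) (k : nat) : R := ratr (nth 0 s k).

(** The predictors differ by at most [4 * eta] in mean square, and taking absolute values does not
    increase distances. [residual_predictor_le] is the counterpart for samples. *)
Lemma residual_approx (e : R) (p p' : nat -> R) (J : nat) (Z : T -> R) eta :
  0 < e -> measurable_fun setT Z -> (msq P Z < +oo)%E ->
  (msq P (fun w => linear_predictor (X^~ w) p J 0 - Z w)%R <= eta%:E)%E ->
  (msq P (fun w => linear_predictor (X^~ w) p J 0 -
                   linear_predictor (X^~ w) p' J 0)%R <= eta%:E)%E ->
  fine (msq P (fun w => `|X 1 w| - `|Z w|)%R) <=
    (1 + e) * fine (msq P (fun w => residual (X^~ w) p' J 0)) + (1 + e^-1) * (4 * eta) /\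
  fine (msq P (fun w => residual (X^~ w) p' J 0)) <=
    (1 + e) * fine (msq P (fun w => `|X 1 w| - `|Z w|)%R) + (1 + e^-1) * (4 * eta).
Proof.
move=> e0 mZ Z2 h1 h2.
have mL q := measurable_linear_predictor X q J 0.
pose U w := linear_predictor (X^~ w) p' J 0 - Z w.
have mU : measurable_fun setT U by exact: measurable_funB.
have U2 : (msq P U <= (4 * eta)%:E)%E.
  rewrite (_ : U = fun w => (linear_predictor (X^~ w) p J 0 - Z w) +
     - (linear_predictor (X^~ w) p J 0 - linear_predictor (X^~ w) p' J 0)); last first.
    by apply/funext => w; rewrite /U; ring.
  have m1 : measurable_fun setT (fun w => linear_predictor (X^~ w) p J 0 - Z w).
    exact: measurable_funB.
  have m2 : measurable_fun setT (fun w =>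
      - (linear_predictor (X^~ w) p J 0 - linear_predictor (X^~ w) p' J 0)).
    by apply: measurable_funN; exact: measurable_funB.
  apply: le_trans (msq_le2D P m1 m2) _; rewrite msqN.
  have p2 : (0 <= 2%:E :> \bar R)%E by rewrite lee_fin.
  apply: le_trans (leeD (lee_wpmul2l p2 h1) (lee_wpmul2l p2 h2)) _.
  by rewrite -!EFinM -EFinD lee_fin; lra.
have mX1 : measurable_fun setT (fun w => `|X 1 w|) by exact: measurable_norm.
pose f w := `|X 1 w| - `|Z w|; pose g w := residual (X^~ w) p' J 0.
have mf : measurable_fun setT f.
  by apply: measurable_funB => //; exact: measurable_norm.
have mg : measurable_fun setT g by exact: measurable_residual.
have f2 : (msq P f < +oo)%E by exact: msq_lty_sub_norm.
have g2 : (msq P g < +oo)%E by exact: msq_residual.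
have fg w : `|f w - g w| <= `|U w|.
  have -> : f w - g w = `|linear_predictor (X^~ w) p' J 0| - `|Z w|.
    by rewrite /f /g /residual; ring.
  exact: ler_dist_dist.
have gf w : `|g w - f w| <= `|U w| by rewrite distrC.
have fin (h : T -> R) : (msq P h < +oo)%E -> (fine (msq P h))%:E = msq P h.
  by move=> h'; rewrite fineK// ge0_fin_numE// msq_ge0.
have c2 : (0 <= (1 + e^-1)%:E)%E by rewrite lee_fin addr_ge0// invr_ge0 ltW.
rewrite -!lee_fin !EFinD ![((_ + _) * _)%:E]EFinM (fin f f2) (fin g g2).
split.
- apply: le_trans (msq_le_eps P e0 mf mg mU fg) _.
  by apply: leeD => //; exact: lee_wpmul2l.
- apply: le_trans (msq_le_eps P e0 mg mf mU gf) _.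
  by apply: leeD => //; exact: lee_wpmul2l.
Qed.

Lemma residual_predictor_le (e : R) (x : int -> R) (p c : nat -> R) J n D : 0 < e ->
  \sum_(i < n) (linear_predictor x p J i - predictor x c i) ^+ 2 <= D ->
  \sum_(i < n) residual x p J i ^+ 2 <=
    (1 + e) * (\sum_(i < n) (`|x i.+1%:Z| - `|predictor x c i|) ^+ 2) + (1 + e^-1) * D /\
  \sum_(i < n) (`|x i.+1%:Z| - `|predictor x c i|) ^+ 2 <=
    (1 + e) * (\sum_(i < n) residual x p J i ^+ 2) + (1 + e^-1) * D.
Proof.
move=> e0 hD.
have c2 : 0 <= 1 + e^-1 by rewrite addr_ge0// invr_ge0 ltW.
have h i : `|residual x p J i - (`|x i.+1%:Z| - `|predictor x c i|)| <=
    `|linear_predictor x p J i - predictor x c i|.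
  have -> : residual x p J i - (`|x i.+1%:Z| - `|predictor x c i|) =
      `|predictor x c i| - `|linear_predictor x p J i| by rewrite /residual; ring.
  by rewrite [X in _ <= X]distrC ler_dist_dist.
split.
- apply: le_trans (@sum_sqr_le_eps R e n (residual x p J)
    (fun i => `|x i.+1%:Z| - `|predictor x c i|)
    (fun i => linear_predictor x p J i - predictor x c i) e0 (fun i _ => h i)) _.
  by rewrite lerD2l ler_wpM2l.
- have h' i : (i < n)%N -> `|(`|x i.+1%:Z| - `|predictor x c i|) - residual x p J i| <=
    `|linear_predictor x p J i - predictor x c i| by rewrite distrC.
  apply: le_trans (@sum_sqr_le_eps R e n (fun i => `|x i.+1%:Z| - `|predictor x c i|)
    (residual x p J) (fun i => linear_predictor x p J i - predictor x c i) e0 h') _.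
  by rewrite lerD2l ler_wpM2l.
Qed.

End cluster_points.

Section cluster_points_of_minimizers.
Context d (T : measurableType d) (R : realType) (P : probability T R).
Variable X : int -> {RV P >-> R}.
Variable s2 : R.
Hypothesis X_msq : forall t, (msq P (X t) <= s2%:E)%E.
Variables (l : nat) (a : nat -> 'rV[R]_l -> R) (Theta : set 'rV[R]_l).
Hypothesis a_cont : forall j, continuous (a j).
Variables (Ca dbar : R).
Hypothesis a_box : forall th, Theta th -> forall k, (1 <= k)%N ->
  `|a k th| <= Ca * k%:R `^ (dbar - 1).
Variables (w : T) (thhat : nat -> 'rV[R]_l).
Hypothesis average_w : forall s : seq rat,
  n%:R^-1 * (\sum_(i < n) residual (X^~ w) (rat_coef R s) (size s) i ^+ 2)
    @[n --> \oo] --> fine (msq P (fun w => residual (X^~ w) (rat_coef R s) (size s) 0)).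
Hypothesis tail_w : forall eta : R, 0 < eta -> exists K0, forall K, (K0 <= K)%N ->
    forall n (c : nat -> R),
      (forall j, (1 <= j)%N -> `|c j| <= Ca * j%:R `^ (dbar - 1)) ->
      \sum_(t < n) (\sum_(2 ^ K <= j < t.+1) c j * X (t - j)%N.+1%:Z w) ^+ 2 <=
      n%:R * eta.
Hypothesis thhat_min : forall n, (1 <= n)%N -> Theta (thhat n) /\
  forall th, Theta th -> contrast a X n (thhat n) w <= contrast a X n th w.

(** At a fixed [w], the chain runs from the limit contrast at [th0] to a rational predictor, to the
    sample contrast at [thhat n], by minimality to that at [th1], to a second rational predictor,
    and to the limit contrast at [th1]. The four approximations each cost a factor [1 + e] and a
    multiple of [eta]. *)
Lemma cluster_le (th0 th1 : 'rV[R]_l) (Y0 Y1 : T -> R) :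
  Theta th0 -> Theta th1 -> measurable_fun setT Y0 -> measurable_fun setT Y1 ->
  linear_of X (a^~ th0) 1 Y0 -> linear_of X (a^~ th1) 1 Y1 ->
  (forall V, nbhs th0 V -> forall n0, exists2 n, (n0 <= n)%N & V (thhat n)) ->
  fine (msq P (fun w => `|X 1 w| - `|Y0 w|)) <=
  fine (msq P (fun w => `|X 1 w| - `|Y1 w|)).
Proof.
move=> Th0 Th1 mY0 mY1 lY0 lY1 freq.
have X_lty t : (msq P (X t) < +oo)%E by exact: le_lt_trans (X_msq t) (ltry _).
have Y02 := linear_of_lty X_msq mY0 lY0; have Y12 := linear_of_lty X_msq mY1 lY1.
apply: le_of_le_eps => [|e e0]; first by rewrite fine_ge0// msq_ge0.
set F0 := fine (msq P (fun w => `|X 1 w| - `|Y0 w|)).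
set F1 := fine (msq P (fun w => `|X 1 w| - `|Y1 w|)).
(* The accumulated errors amount to 40 in place of 100 at most, each power of [1 + e] being bounded
   by the fourth. *)
exists (100 * (1 + e) ^+ 4 * (1 + e^-1)) => eta eta0.
pose s02 := fine (msq P (fun w => residual (X^~ w) (rat_coef R [::]) 0 0)).
have s020 : 0 <= s02 by rewrite fine_ge0// msq_ge0.
(* The empty sequence codes the zero predictor, whose squared residuals are the squares of [X]. *)
have energy : \forall n \near \oo, \sum_(i < n) X i.+1%:Z w ^+ 2 <= n%:R * (s02 + 1).
  have := @average_w [::]; rewrite -/s02 => /cvgrPdist_le /(_ _ ltr01) [N _ hN].
  near=> n; have n0 : (0 < n)%N by near: n; exists 1%N.
  have /hN /= : (N <= n)%N by near: n; exists N.
  rewrite distrC => /(le_trans (ler_norm _)); rewrite lerBlDr addrC mulrC.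
  rewrite ler_pdivrMr ?ltr0n// [_ * n%:R]mulrC; apply: le_trans.
  apply: ler_sum => i _; rewrite /residual /linear_predictor big_geq//.
  rewrite /rat_coef/= raddf0 addr0 normr0 subr0 real_normK ?num_real//.
have A0 : 0 < s02 + 1 by rewrite ltr_wpDl.
have [K0 hK0] := tail_w eta0.
have near_lin th Y : measurable_fun setT Y -> linear_of X (a^~ th) 1 Y ->
   exists N, forall n, (N <= n)%N ->
     (msq P (fun w => linear_predictor (X^~ w) (a^~ th) n.+1 0 - Y w)%R <= eta%:E)%E.
  move=> mY /L2_cvg_msq lY; have [N _ hN] := msq_near eta0 lY; exists N => n Nn.
  exact: hN.
have [N0 hN0] := near_lin _ _ mY0 lY0; have [N1 hN1] := near_lin _ _ mY1 lY1.
(* A power of 2, as the tail bound demands, and large enough for both truncated series to be within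
   [eta] of their limits. *)
pose K := maxn K0 (maxn N0 N1); pose J := (2 ^ K)%N.
have J0 : (0 < J)%N by rewrite expn_gt0.
have KJ : (K < J)%N by rewrite ltn_expl.
have JE : J = J.-1.+1 by rewrite prednK.
have J1K : (K <= J.-1)%N by rewrite -ltnS -JE.
have approx0 : (msq P (fun w => linear_predictor (X^~ w) (a^~ th0) J 0 - Y0 w)%R <= eta%:E)%E.
  by rewrite JE; apply: hN0; apply: leq_trans J1K; rewrite !leq_max leqnn orbT.
have approx1 : (msq P (fun w => linear_predictor (X^~ w) (a^~ th1) J 0 - Y1 w)%R <= eta%:E)%E.
  by rewrite JE; apply: hN1; apply: leq_trans J1K; rewrite !leq_max leqnn !orbT.
have [tau tau0 htau] := predictor_approx (x := X^~ w) A0 energy J0 eta0.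
have [de de0 hde] := msq_linear_predictorB X_msq J0 eta0.
(* Half of [tau] is kept for the distance between the coefficients of [thhat n] and [th0]; [de]
   serves the mean squares. *)
pose r := Num.min (tau / 2) de.
have r0 : 0 < r by rewrite lt_min divr_gt0.
have rtau : r <= tau / 2 by rewrite ge_min lexx.
have rde : r <= de by rewrite ge_min lexx orbT.
have [q0 q0J hq0] := rat_approx (a^~ th0) J r0.
have [q1 q1J hq1] := rat_approx (a^~ th1) J r0.
have d0 : (msq P (fun w => linear_predictor (X^~ w) (a^~ th0) J 0 -
    linear_predictor (X^~ w) (rat_coef R q0) J 0)%R <= eta%:E)%E.
  by apply: hde => j jJ; exact: le_trans (hq0 j jJ) rde.
have d1 : (msq P (fun w => linear_predictor (X^~ w) (a^~ th1) J 0 -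
    linear_predictor (X^~ w) (rat_coef R q1) J 0)%R <= eta%:E)%E.
  by apply: hde => j jJ; exact: le_trans (hq1 j jJ) rde.
have [b0 _] := residual_approx X_msq e0 mY0 Y02 approx0 d0.
have [_ b1] := residual_approx X_msq e0 mY1 Y12 approx1 d1.
rewrite -/F0 in b0; rewrite -/F1 in b1.
set G0 := fine _ in b0; set G1 := fine _ in b1.
(* Only finitely many coefficients are constrained, so continuity of each makes [V] a
   neighbourhood. *)
pose V := [set th | forall j : 'I_J, `|a j th - a j th0| <= tau / 2].
have nV : nbhs th0 V.
  have h (j : 'I_J) : \forall th \near th0, `|a j th - a j th0| <= tau / 2.
    have := @a_cont j th0 => /cvgrPdist_le /(_ (tau / 2)).
    rewrite divr_gt0// => /(_ isT); apply: filterS => th /=.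
    by rewrite distrC.
  exact: (filter_forall _ h).
have av0 := @average_w q0; have av1 := @average_w q1.
rewrite q0J -/G0 in av0; rewrite q1J -/G1 in av1.
have key : \forall n \near \oo, V (thhat n) ->
    n%:R^-1 * (\sum_(i < n) residual (X^~ w) (rat_coef R q0) J i ^+ 2) <=
    (1 + e) * ((1 + e) * (n%:R^-1 * (\sum_(i < n) residual (X^~ w) (rat_coef R q1) J i ^+ 2))
      + (1 + e^-1) * (16 * eta)) + (1 + e^-1) * (16 * eta).
  have h0 := htau (rat_coef R q0); have h1 := htau (rat_coef R q1).
  near=> n => Vn; have n0 : (0 < n)%N by near: n; exists 1%N.
  have [Thn minn_] := thhat_min n0.
  have n0' : 0 < n%:R^-1 :> R by rewrite invr_gt0 ltr0n.
  have tl th : Theta th -> \sum_(i < n) (\sum_(J <= j < i.+1) a j th * X (i - j)%N.+1%:Z w) ^+ 2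
      <= n%:R * eta.
    by move=> Th; apply: (hK0 K) => [|j j1]; [rewrite leq_maxl|exact: a_box].
  have c0 j : (j < J)%N -> `|a j (thhat n) - rat_coef R q0 j| <= tau.
    move=> jJ; apply: le_trans (ler_distD (a j th0) _ _) _.
    by have := Vn (Ordinal jJ); have := hq0 j jJ; rewrite /= /rat_coef; lra.
  have c1 j : (j < J)%N -> `|a j th1 - rat_coef R q1 j| <= tau.
    by move=> jJ; have := hq1 j jJ; rewrite /rat_coef; lra.
  have D0 : \sum_(i < n) (linear_predictor (X^~ w) (rat_coef R q0) J i -
      predictor (X^~ w) (a^~ (thhat n)) i) ^+ 2 <= n%:R * (16 * eta).
    have h : forall c : nat -> R, (forall j, (j < J)%N -> `|c j - rat_coef R q0 j| <= tau) ->
      \sum_(i < n) (\sum_(J <= j < i.+1) c j * X (i - j)%N.+1%:Z w) ^+ 2 <= n%:R * eta ->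
      \sum_(i < n) (linear_predictor (X^~ w) (rat_coef R q0) J i -
        predictor (X^~ w) c i) ^+ 2 <= n%:R * (16 * eta) by near: n.
    exact: h c0 (tl _ Thn).
  have D1 : \sum_(i < n) (linear_predictor (X^~ w) (rat_coef R q1) J i -
      predictor (X^~ w) (a^~ th1) i) ^+ 2 <= n%:R * (16 * eta).
    have h : forall c : nat -> R, (forall j, (j < J)%N -> `|c j - rat_coef R q1 j| <= tau) ->
      \sum_(i < n) (\sum_(J <= j < i.+1) c j * X (i - j)%N.+1%:Z w) ^+ 2 <= n%:R * eta ->
      \sum_(i < n) (linear_predictor (X^~ w) (rat_coef R q1) J i -
        predictor (X^~ w) c i) ^+ 2 <= n%:R * (16 * eta) by near: n.
    exact: h c1 (tl _ Th1).
  have [s0 _] := residual_predictor_le e0 D0.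
  have [_ s1] := residual_predictor_le e0 D1.
  have m := minn_ _ Th1; rewrite !contrastE in m.
  have s0' := ler_wpM2l (ltW n0') s0; have s1' := ler_wpM2l (ltW n0') s1.
  rewrite mulrDr [X in _ <= X + _]mulrCA [n%:R^-1 * ((1 + e^-1) * _)]mulrCA
    mulKf ?pnatr_eq0 -?lt0n// in s0'.
  rewrite mulrDr [X in _ <= X + _]mulrCA [n%:R^-1 * ((1 + e^-1) * _)]mulrCA
    mulKf ?pnatr_eq0 -?lt0n// in s1'.
  apply: le_trans s0' _; rewrite lerD2r ler_wpM2l ?addr_ge0 ?(ltW e0)//.
  exact: le_trans m s1'.
(* The reverse strict inequality would hold between the averages for all large [n], against [key] at
   one of the infinitely many [n] with [thhat n] in [V]. *)
have key2 : G0 <= (1 + e) * ((1 + e) * G1 + (1 + e^-1) * (16 * eta)) + (1 + e^-1) * (16 * eta).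
  rewrite leNgt; apply/negP => gt.
  set u := fun n => (n%:R^-1 * (\sum_(i < n) residual (X^~ w) (rat_coef R q0) J i ^+ 2)) : R.
  set v := fun n => (1 + e) * ((1 + e) *
    (n%:R^-1 * (\sum_(i < n) residual (X^~ w) (rat_coef R q1) J i ^+ 2)) +
    (1 + e^-1) * (16 * eta)) + (1 + e^-1) * (16 * eta) : R.
  have cv : u n - v n @[n --> \oo] -->
      G0 - ((1 + e) * ((1 + e) * G1 + (1 + e^-1) * (16 * eta)) + (1 + e^-1) * (16 * eta)).
    apply: cvgB => //; apply: cvgD; last exact: cvg_cst.
    apply: cvgM; first exact: cvg_cst.
    apply: cvgD; last exact: cvg_cst.
    by apply: cvgM => //; exact: cvg_cst.
  rewrite -subr_gt0 in gt.
  have [N _ hN] := cvgr_gt _ cv _ gt.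
  have [N' _ hN'] := key.
  have [n nN Vn] := freq V nV (maxn N N').
  have := hN n (leq_trans (leq_maxl _ _) nN); rewrite /= subr_gt0 ltNge.
  by rewrite (hN' n (leq_trans (leq_maxr _ _) nN) Vn).
have F10 : 0 <= F1 by rewrite fine_ge0// msq_ge0.
pose c := 1 + e; have c1 : 1 <= c by rewrite lerDl ltW.
have c0 : 0 <= c by exact: le_trans c1.
pose D := (1 + e^-1) * eta.
have D0 : 0 <= D by rewrite mulr_ge0 ?(ltW eta0)// addr_ge0// invr_ge0 ltW.
have E4 : (1 + e^-1) * (4 * eta) = 4 * D by rewrite /D; ring.
have E16 : (1 + e^-1) * (16 * eta) = 16 * D by rewrite /D; ring.
rewrite -/c E4 in b0 b1; rewrite -/c E16 in key2; rewrite -/c.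
have -> : 100 * c ^+ 4 * (1 + e^-1) * eta = 100 * c ^+ 4 * D by rewrite /D; ring.
have f1 := ler_wpM2l c0 b1.
have f2 : G0 <= c * (c * (c * F1 + 4 * D) + 16 * D) + 16 * D.
  by apply: le_trans key2 _; rewrite lerD2r ler_wpM2l// lerD2r.
have f3 : F0 <= c * (c * (c * (c * F1 + 4 * D) + 16 * D) + 16 * D) + 4 * D.
  by apply: le_trans b0 _; rewrite lerD2r ler_wpM2l.
apply: le_trans f3 _.
have -> : c * (c * (c * (c * F1 + 4 * D) + 16 * D) + 16 * D) + 4 * D =
  c ^+ 4 * F1 + (4 * c ^+ 3 + 16 * c ^+ 2 + 16 * c + 4) * D by ring.
rewrite lerD2l ler_wpM2r//.
have pw k : (k <= 4)%N -> c ^+ k <= c ^+ 4 by move=> k4; exact: ler_weXn2l.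
have p0 := pw 0%N isT; have p1 := pw 1%N isT; have p2 := pw 2%N isT; have p3 := pw 3%N isT.
rewrite expr0 in p0; rewrite expr1 in p1.
move: p0 p1 p2 p3; set x4 := c ^+ 4; set x3 := c ^+ 3; set x2 := c ^+ 2; lra.
Unshelve. all: by end_near.
Qed.

End cluster_points_of_minimizers.

(** * Convergence in a compact parameter set *)

Section parameters.
Context {R : realType} {l : nat}.

Lemma derivative_norm_ge0 k (f : 'rV[R]_l -> R) x : 0 <= derivative_norm k f x.
Proof. exact: sqrtr_ge0. Qed.

Lemma derivative_norm0 (f : 'rV[R]_l -> R) x : derivative_norm 0 f x = `|f x|.
Proof.
rewrite /derivative_norm (big_pred1 [tuple]) => [|s]; last by apply/esym/eqP; exact: tuple0.
by rewrite sqrtr_sqr.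
Qed.

(** Every point of [Theta] outside the interior of [U] has a neighbourhood that the sequence
    eventually avoids; compactness gives an index common to all of them. *)
Lemma cvg_of_cluster (Theta : set 'rV[R]_l) (u : nat -> 'rV[R]_l) (th : 'rV[R]_l) :
  compact Theta -> (forall n, (1 <= n)%N -> Theta (u n)) ->
  (forall th0, Theta th0 ->
    (forall V, nbhs th0 V -> forall n0, exists2 n, (n0 <= n)%N & V (u n)) -> th0 = th) ->
  u n @[n --> \oo] --> th.
Proof.
move=> cT uT cl U nU.
have cK : compact (Theta `&` ~` U^°).
  by apply: compact_closedI => //; apply: open_closedC; exact: open_interior.
have /compact_near_coveringP := cK.
move=> /(_ nat \oo (fun n th' => u n <> th') _) h.
have {}h : \forall n \near \oo, Theta `&` ~` U^° `<=` (fun th' => u n <> th').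
  apply: h => th0 [Th0 Uth0].
  (* Otherwise [th0] would be a cluster point, hence equal to [th], which is interior to [U]. *)
  have [V nV [n0 hV]] : exists2 V, nbhs th0 V & exists n0, forall n, (n0 <= n)%N -> ~ V (u n).
    apply: contrapT => no; apply: Uth0.
    rewrite (cl th0 Th0); first exact: nU.
    move=> V nV n0; apply: contrapT => no'; apply: no.
    exists V => //; exists n0 => n nn0 Vn; apply: no'; by exists n.
  exists (V, [set n | (n0 <= n)%N]); first by split => //; exists n0.
  by move=> [th' n] /= [Vth' nn0] uE; apply: (hV n nn0); rewrite uE.
suff : \forall n \near \oo, U (u n) by [].
near=> n; have n1 : (1 <= n)%N by near: n; exists 1%N.
have hn : Theta `&` ~` U^° `<=` (fun th' => u n <> th') by near: n.
apply: interior_subset; apply: contrapT => nUn.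
exact: (hn (u n) (conj (uT n n1) nUn)).
Unshelve. all: by end_near.
Qed.

End parameters.

(** * Strong consistency of the estimator *)

Theorem corollary3p3 (d : measure_display) (T : measurableType d)
  (R : realType) (P : probability T R)
  (l : nat) (hl : (1 <= l)%N)
  (xi : int -> {RV P >-> R})
  (xi_iid : iid xi)
  (xi_sym : symmetric_rv (xi 0))
  (xi_centered : 'E_P[xi 0%R]%E = 0%E)
  (xi_cont : continuous (cdf (xi 0)))
  (xi_abs : 'E_P[(fun w => `|xi 0 w|)%R]%E = 1%E)
  (xi_sq : ('E_P[(fun w => xi 0 w ^+ 2)%R] < +oo)%E)
  (a : nat -> 'rV[R]_l -> R)
  (a_cont : forall j, continuous (a j))
  (a0_gt0 : forall th, 0 < a 0%N th)
  (Theta : set 'rV[R]_l)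
  (Theta_compact : compact Theta)
  (Theta_sub : Theta `<=` Theta2 xi a)
  (a_long_memory : forall th, Theta th ->
     exists (dth : R) (L : R -> R),
       [/\ 0 < dth < 1 / 2, slowly_varying L &
           forall j, (1 <= j)%N -> a j th = L j%:R * j%:R `^ (dth - 1)])
  (thstar : 'rV[R]_l) (thstar_Theta : Theta thstar)
  (X : int -> {RV P >-> R})
  (X_larch : larch_process xi a thstar X)
  (a_smooth : forall k, Ck_on l Theta (a k))
  (a_bound : exists Ca dbar : R, [/\ 0 < Ca, dbar < 1 / 2 &
     forall k, (1 <= k)%N -> forall th, Theta th ->
       \sum_(0 <= j < l.+1) derivative_norm j (a k) th
         <= Ca * k%:R `^ (dbar - 1)])
  (M : 'rV[R]_l -> int -> {RV P >-> R})
  (M_def : forall th t, Theta th -> is_M a X th t (M th t))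
  (M_separable : forall t, separable_process P Theta (fun th => M th t))
  (a_ident : forall th th', Theta th -> Theta th' ->
     (forall i, a i th = a i th') -> th = th')
  (thhat : nat -> T -> 'rV[R]_l)
  (thhat_min : forall n w, (1 <= n)%N ->
     Theta (thhat n w) /\
     forall th, Theta th -> contrast a X n (thhat n w) w <= contrast a X n th w) :
  {ae P, forall w, thhat n w @[n --> \oo] --> thstar}.
Proof.
have [X_eq0 X_stat X_erg X_causal X_sq] := X_larch.
(* One version of the functional at [thstar] is chosen for each time, the one through which the
   equation of the process holds. *)
have [Ms Ms_prop] : {Ms : int -> {RV P >-> R} & forall t,
    is_M a X thstar t (Ms t) /\ {ae P, forall w, X t w = xi t w * Ms t w}}.
  pose Q t (Mt : {RV P >-> R}) :=
    is_M a X thstar t Mt /\ {ae P, forall w, X t w = xi t w * Mt w}.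
  apply: (@boolp.choice _ _ Q) => t.
  by have [Mt h1 h2] := X_eq0 t; exists Mt.
have Ms_linear t : linear_of X (a^~ thstar) t (Ms t) by have [] := Ms_prop t.
have X_eq t : {ae P, forall w, X t w = xi t w * Ms t w} by have [] := Ms_prop t.
have Ms_past t : past_fun xi t (Ms t) by exact: past_fun_linear (Ms_linear t).
have X0_lty : (msq P (X 0%R) < +oo)%E by move: X_sq; rewrite unlock.
pose s2 := fine (msq P (X 0)).
have X_msq t : (msq P (X t) <= s2%:E)%E.
  by rewrite (msq_stationary X_stat) fineK// ge0_fin_numE// msq_ge0.
have X_lty t : (msq P (X t) < +oo)%E by exact: le_lt_trans (X_msq t) (ltry _).
have xi1 : (\int[P]_w (`|xi 0%R w|)%:E = 1)%E by move: xi_abs; rewrite unlock.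
have noatom := continuous_cdf_noatom xi_cont.
have [Ca [dbar [Ca0 dbar12 bnd]]] := a_bound.
have a_box th : Theta th -> forall k, (1 <= k)%N -> `|a k th| <= Ca * k%:R `^ (dbar - 1).
  move=> Th k k1; apply: le_trans (bnd k k1 th Th).
  rewrite big_nat_recl// derivative_norm0 lerDl sumr_ge0// => j _.
  exact: derivative_norm_ge0.
have avg : {ae P, forall w, forall s : seq rat,
    n%:R^-1 * (\sum_(i < n) residual (X^~ w) (rat_coef R s) (size s) i ^+ 2)
      @[n --> \oo] --> fine (msq P (fun w => residual (X^~ w) (rat_coef R s) (size s) 0))}.
  (* Enumerating the rational sequences by natural numbers gives one null set for all of them. *)
  have : {ae P, forall w, forall k : nat, let s : seq rat := odflt [::] (unpickle k) in
    n%:R^-1 * (\sum_(i < n) residual (X^~ w) (rat_coef R s) (size s) i ^+ 2)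
      @[n --> \oo] --> fine (msq P (fun w => residual (X^~ w) (rat_coef R s) (size s) 0))}.
    by apply/ae_foralln => k; exact: residual_average.
  by apply: filterS => w h s; have := h (pickle s); rewrite pickleK.
have tl := tail_ae xi_iid xi_sym X_stat X_causal Ms_past X_eq X_msq Ca0 dbar12.
apply: filterS2 avg tl => w avg_w tail_w.
have hmin n : (1 <= n)%N -> Theta (thhat n w) /\
    forall th, Theta th -> contrast a X n (thhat n w) w <= contrast a X n th w.
  exact: thhat_min.
apply: (cvg_of_cluster Theta_compact) => [n n1|th0 Th0 freq]; first by have [] := hmin n n1.
have mM th t : measurable_fun setT (M th t) by [].
have mMs t : measurable_fun setT (Ms t) by [].
have M_lin : linear_of X (a^~ th0) 1 (M th0 1) by exact: M_def.
(* From here [w] is fixed: a cluster point [th0] of the estimators does at least as well as [thstar]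
   in the limiting contrast. *)
have := cluster_le X_msq a_cont a_box avg_w tail_w hmin Th0 thstar_Theta
  (mM th0 1) (mMs 1) M_lin (Ms_linear 1) freq.
have Y2 := linear_of_lty X_msq (mM th0 1) M_lin.
have V2 := linear_of_lty X_msq (mMs 1) (Ms_linear 1).
have XY2 : (msq P (fun w => `|X 1 w| - `|M th0 1 w|)%R < +oo)%E.
  exact: msq_lty_sub_norm.
have XV2 : (msq P (fun w => `|X 1 w| - `|Ms 1 w|)%R < +oo)%E.
  exact: msq_lty_sub_norm.
rewrite -lee_fin !fineK ?ge0_fin_numE ?msq_ge0// => le.
have M_past : past_fun xi 1 (M th0 1) by exact: past_fun_linear M_lin.
have MM := population_minimizer xi_iid xi1 (_ : measurable_fun setT (X 1))
  (mMs 1) (mM th0 1) (Ms_past 1) M_past (X_eq 1) (X_lty 1) V2 Y2 le.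
(* The two functionals have equal absolute values almost surely, and the sum of their constant terms
   is positive; so all their coefficients agree. *)
apply/esym/a_ident => //.
apply: (linear_ident xi_iid noatom X_causal _ Ms_linear X_eq (mMs 1) (mM th0 1)
  (Ms_linear 1) M_lin) => //.
- by rewrite gt_eqF.
- by rewrite gt_eqF// addr_gt0.
- exact: MM.
Qed.
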